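(* For every nonempty set $\{\mathbb A^{(s)}\}_{s\in S}\subset\mathcal{CDD}_N$ and each $\mathbb B\in\mathcal{CDD}_N$, $$\mathbb B\wedge\Bigl(\bigvee_{s\in S}\mathbb A^{(s)}\Bigr)=\bigvee_{s\in S}(\mathbb B\wedge\mathbb A^{(s)}),\qquad \mathbb B\vee\Bigl(\bigwedge_{s\in S}\mathbb A^{(s)}\Bigr)=\bigwedge_{s\in S}(\mathbb B\vee\mathbb A^{(s)}).$$
   Context: $N\ge 1$ is a fixed integer. Hilbert spaces are complex and of arbitrary dimension (possibly $0$, possibly uncountable). $\mathrm{CDD}_N$ is the class of all $N$-tuples $A=(A_1,\dots,A_N)$ of closed densely defined linear operators acting in a common (arbitrary) Hilbert space. For a closed subspace $E$ with orthogonal projection $P_E$: $E\in\mathrm{red}(A)$ means $P_EA_j\subset A_jP_E$ for all $j$; then $A|_E$ is the tuple of restrictions of $A_j$ to $D(A_j)\cap E$, regarded as operators in $E$. $A\equiv B$ means $A_j=U^{-1}B_jU$ for all $j$ for some unitary $U$. $\mathcal{CDD}_N$ is the class of unitary equivalence classes $\mathbb A$ of members $A$ of $\mathrm{CDD}_N$. For $\mathbb A,\mathbb B\in\mathcal{CDD}_N$ with representatives $A,B$: $\mathbb A\le\mathbb B$ iff $A\equiv B|_E$ for some $E\in\mathrm{red}(B)$. This is a partial order on $\mathcal{CDD}_N$ with respect to which every nonempty set has a least upper bound ($\bigvee,\vee$) and a greatest lower bound ($\bigwedge,\wedge$). *)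

(* Defs.v *)
From HB Require Import structures.
From mathcomp Require Import all_boot all_order all_algebra sesquilinear.
From mathcomp Require Import complex.
From mathcomp Require Import boolp classical_sets filter reals topology.
From mathcomp Require Import normedtype.

Set Implicit Arguments.
Unset Strict Implicit.
Unset Printing Implicit Defensive.

Import Order.TTheory GRing.Theory Num.Theory.
Import numFieldNormedType.Exports.

Local Open Scope classical_set_scope.
Local Open Scope ring_scope.

Record hilbertType (R : realType) := Hilbert {
  hilbert_sort :> completeNormedModType R[i];
  inner : {dot hilbert_sort for Num.conj};
  inner_norm : forall x : hilbert_sort, `|x| ^+ 2 = inner x x }.

Record closedSubspace (R : realType) (H : hilbertType R) := ClosedSubspace {
  subspace_set :> set H;
  subspace_submod : submod_closed (mem subspace_set);
  subspace_closed : closed subspace_set }.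

Record subspace_elt (R : realType) (H : hilbertType R) (E : closedSubspace H) :=
  SubspaceElt { elt_val : H; elt_valP : elt_val \in (E : set H) }.

Section SubspaceHilbert.
Variables (R : realType) (H : hilbertType R) (E : closedSubspace H).
Local Notation T := (subspace_elt E).

HB.instance Definition _ := [isSub for @elt_val R H E].
HB.instance Definition _ := [Choice of T by <:].
HB.instance Definition _ := GRing.SubChoice_isSubLmodule.Build
  R[i] H (fun x => x \in (E : set H)) T (subspace_submod E).

Let subspace_norm (u : T) : R[i] := `|val u|.

Let subspace_normD u v :
  subspace_norm (u + v) <= subspace_norm u + subspace_norm v.
Proof. by rewrite /subspace_norm raddfD ler_normD. Qed.

Let subspace_normZ (l : R[i]) u : subspace_norm (l *: u) = `|l| * subspace_norm u.
Proof. by rewrite /subspace_norm linearZ normrZ. Qed.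

Let subspace_norm0 u : subspace_norm u = 0 -> u = 0.
Proof. by move/normr0_eq0 => u0; apply/val_inj; rewrite raddf0. Qed.

HB.instance Definition _ := Lmodule_isNormed.Build R[i] T
  subspace_normD subspace_normZ subspace_norm0.

Let subspace_complete (F : set_system T) : ProperFilter F -> cauchy F -> cvg F.
Proof.
move=> FF Fc; have GF : ProperFilter (elt_val (E := E) @ F).
  exact: fmap_proper_filter.
have /cauchy_cvg /cvg_ex[l Gl] : cauchy (elt_val (E := E) @ F).
  apply/cauchyP => e e0; have [x Fx] := (cauchyP F).1 Fc e e0.
  exists (val x); apply: filterS Fx => y xy.
  by rewrite /= -ball_normE; exact: xy.
have El : (E : set H) l.
  apply: subspace_closed => B /Gl FB.
  have [u Bu] : exists u : T, B (val u) by exact: (@filter_ex _ F _ _ FB).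
  by exists (val u); split=> //; exact/set_mem/elt_valP.
apply/cvg_ex; exists (SubspaceElt (mem_set El)).
apply/cvg_ballP => e e0; have /cvg_ballP/(_ e e0) := Gl.
by apply: filterS => y; rewrite -ball_normE.
Qed.

HB.instance Definition _ := Uniform_isComplete.Build T subspace_complete.

Let subspace_inner (u v : T) : R[i] := inner H (val u) (val v).

Let subspace_inner_bilinear : bilinear_for
  (GRing.Scale.Law.clone _ _ *%R _) (GRing.Scale.Law.clone _ _ (Num.conj \; *%R) _)
  subspace_inner.
Proof.
split=> u l v w; rewrite /subspace_inner linearD linearZ.
- by rewrite linearDl linearZl.
- by [].
Qed.

HB.instance Definition _ := bilinear_isBilinear.Build R[i] T T R[i]
  *%R (Num.conj \; *%R) subspace_inner subspace_inner_bilinear.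

Let subspace_inner_herm u v :
  subspace_inner u v = (-1) ^+ false * (subspace_inner v u)^*.
Proof. exact: hermitian_subproof. Qed.

HB.instance Definition _ := isHermitianSesquilinear.Build R[i] T
  false Num.conj subspace_inner subspace_inner_herm.

Let subspace_inner_gt0 u : u != 0 -> 0 < subspace_inner u u.
Proof.
move=> u0; apply: neq0_dnorm_gt0; apply: contraNneq u0 => u0.
by apply/eqP/val_inj; rewrite u0 raddf0.
Qed.

HB.instance Definition _ := isDotProduct.Build R[i] T
  subspace_inner subspace_inner_gt0.

Let subspace_inner_norm (u : T) : `|u| ^+ 2 = subspace_inner u u.
Proof. exact: inner_norm. Qed.

Definition subspace_hilbert : hilbertType R :=
  @Hilbert R T subspace_inner subspace_inner_norm.

End SubspaceHilbert.

Definition zero_space (R : realType) : Type := unit.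

Section ZeroHilbert.
Variable R : realType.
Local Notation T := (zero_space R).

HB.instance Definition _ := Choice.on T.

Let zadd (_ _ : T) : T := tt.
Let zopp (_ : T) : T := tt.
Let zscale (_ : R[i]) (_ : T) : T := tt.

Let zaddA : associative zadd. Proof. by []. Qed.
Let zaddC : commutative zadd. Proof. by []. Qed.
Let zadd0 : left_id (tt : T) zadd. Proof. by case. Qed.
Let zaddN : left_inverse (tt : T) zopp zadd. Proof. by []. Qed.

HB.instance Definition _ := GRing.isZmodule.Build T zaddA zaddC zadd0 zaddN.

Let zscaleA a b v : zscale a (zscale b v) = zscale (a * b) v.
Proof. by []. Qed.
Let zscale1 : left_id 1 zscale. Proof. by case. Qed.
Let zscaleDr : right_distributive zscale +%R. Proof. by []. Qed.
Let zscaleDl v : {morph zscale^~ v : a b / a + b}. Proof. by []. Qed.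

HB.instance Definition _ := GRing.Zmodule_isLmodule.Build R[i] T
  zscaleA zscale1 zscaleDr zscaleDl.

Let znorm (_ : T) : R[i] := 0.

Let znormD x y : znorm (x + y) <= znorm x + znorm y.
Proof. by rewrite /znorm addr0. Qed.
Let znormZ (l : R[i]) x : znorm (l *: x) = `|l| * znorm x.
Proof. by rewrite /znorm mulr0. Qed.
Let znorm0 x : znorm x = 0 -> x = 0.
Proof. by case: x. Qed.

HB.instance Definition _ := Lmodule_isNormed.Build R[i] T znormD znormZ znorm0.

Let zcomplete (F : set_system T) : ProperFilter F -> cauchy F -> cvg F.
Proof.
move=> FF _; apply/cvg_ex; exists 0 => A A0.
by apply: filterS filterT => -[] _; exact: nbhs_singleton A0.
Qed.

HB.instance Definition _ := Uniform_isComplete.Build T zcomplete.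

Let zinner (_ _ : T) : R[i] := 0.

Let zinner_bilinear : bilinear_for
  (GRing.Scale.Law.clone _ _ *%R _) (GRing.Scale.Law.clone _ _ (Num.conj \; *%R) _)
  zinner.
Proof. by split=> u l v w; rewrite /zinner /= mulr0 addr0. Qed.

HB.instance Definition _ := bilinear_isBilinear.Build R[i] T T R[i]
  *%R (Num.conj \; *%R) zinner zinner_bilinear.

Let zinner_herm u v : zinner u v = (-1) ^+ false * (zinner v u)^*.
Proof. by rewrite /zinner rmorph0 mulr0. Qed.

HB.instance Definition _ := isHermitianSesquilinear.Build R[i] T
  false Num.conj zinner zinner_herm.

Let zinner_gt0 u : u != 0 -> 0 < zinner u u.
Proof. by case: u. Qed.

HB.instance Definition _ := isDotProduct.Build R[i] T zinner zinner_gt0.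

Let zinner_norm (u : T) : `|u| ^+ 2 = zinner u u.
Proof. by case: u; rewrite normr0 expr0n. Qed.

Definition zero_hilbert : hilbertType R := @Hilbert R T zinner zinner_norm.

End ZeroHilbert.

(* Linear operators, not necessarily everywhere defined, are given by their
   graphs: inclusion, equality and composition of operators then mean inclusion,
   equality and composition of graphs, domains included. *)
Record operator (R : realType) (H : hilbertType R) := Operator {
  graph : set (H * H)%type;
  graph_submod : submod_closed (mem graph);
  graph_fun : forall y, graph (0, y) -> y = 0 }.

Definition domain (R : realType) (H : hilbertType R) (A : operator H) : set H :=
  fst @` graph A.

Record optuple (R : realType) (N : nat) := Optuple {
  hspace : hilbertType R;
  op : 'I_N -> operator hspace }.

Definition is_cdd (R : realType) (N : nat) (A : optuple R N) : Prop :=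
  forall j, closed (graph (op A j)) /\ dense (domain (op A j)).

Record cdd (R : realType) (N : nat) := Cdd {
  cdd_tuple :> optuple R N;
  cddP : is_cdd cdd_tuple }.

(* P_E x; the default value 0 of xget is never reached, since E is closed. *)
Definition orthoproj (R : realType) (H : hilbertType R) (E : closedSubspace H)
    (x : H) : H :=
  xget 0 [set y | (E : set H) y /\
    forall z, (E : set H) z -> inner H (x - y) z = 0].

(* P_E A_j `<=` A_j P_E for all j. *)
Definition reducing (R : realType) (N : nat) (A : optuple R N)
    (E : closedSubspace (hspace A)) : Prop :=
  forall j, [set (p.1, orthoproj E p.2) | p in graph (op A j)] `<=`
            [set p | graph (op A j) (orthoproj E p.1, p.2)].

Section Restriction.
Variables (R : realType) (H : hilbertType R).
Variables (A : operator H) (E : closedSubspace H).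
Local Notation K := (subspace_hilbert E).

Definition restrict_graph : set (K * K)%type :=
  [set p | graph A (elt_val p.1, elt_val p.2)].

Let restrict_submod : submod_closed (mem restrict_graph).
Proof.
have [A0 AP] := graph_submod A; split; first exact/mem_set/set_mem/A0.
move=> a p q /set_mem Ap /set_mem Aq; apply/mem_set.
exact/set_mem/(AP a _ _ (mem_set Ap) (mem_set Aq)).
Qed.

Let restrict_fun y : restrict_graph (0, y) -> y = 0.
Proof. by move=> /graph_fun y0; exact/val_inj. Qed.

Definition restrict_op : operator K := Operator restrict_submod restrict_fun.
End Restriction.

(* A|_E, meaningful for E reducing A: then A_j maps domain (A_j) `&` E into E. *)
Definition restrict (R : realType) (N : nat) (A : optuple R N)
    (E : closedSubspace (hspace A)) : optuple R N :=
  @Optuple R N (subspace_hilbert E) (fun j => restrict_op (op A j) E).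

Definition unitary (R : realType) (H K : hilbertType R) (U : {linear H -> K}) :
    Prop :=
  (forall x y, inner K (U x) (U y) = inner H x y) /\ (forall z, exists x, U x = z).

(* A_j = U^-1 B_j U for all j. *)
Definition uequiv (R : realType) (N : nat) (A B : optuple R N) : Prop :=
  exists U : {linear hspace A -> hspace B}, unitary U /\
    forall j, graph (op A j) = [set p | graph (op B j) (U p.1, U p.2)].

Record uclass (R : realType) (N : nat) := Uclass {
  member : cdd R N -> Prop;
  memberP : exists A : cdd R N, member = (fun B => uequiv A B) }.

Definition ule (R : realType) (N : nat) (a b : uclass R N) : Prop :=
  exists A B : cdd R N, [/\ member a A, member b B &
    exists E : closedSubspace (hspace B), reducing E /\ uequiv A (restrict E)].

Definition is_lub (R : realType) (N : nat) (P : uclass R N -> Prop)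
    (c : uclass R N) : Prop :=
  (forall a, P a -> ule a c) /\
  (forall d, (forall a, P a -> ule a d) -> ule c d).

Definition is_glb (R : realType) (N : nat) (P : uclass R N -> Prop)
    (c : uclass R N) : Prop :=
  (forall a, P a -> ule c a) /\
  (forall d, (forall a, P a -> ule d a) -> ule d c).

Section ZeroClass.
Variables (R : realType) (N : nat).
Local Notation H := (zero_hilbert R).

Let zero_submod : submod_closed (mem (setT : set (H * H)%type)).
Proof. by split=> [|a x y _ _]; exact/mem_set. Qed.

Let zero_fun (y : H) : (setT : set (H * H)%type) (0, y) -> y = 0.
Proof. by case: y. Qed.

Let zero_tuple : optuple R N :=
  @Optuple R N H (fun=> Operator zero_submod zero_fun).

Let zero_is_cdd : is_cdd zero_tuple.
Proof.
move=> j; split; first exact: closedT.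
move=> O [x Ox] _; exists x; split=> //.
by exists (x, x).
Qed.

Definition zero_class : uclass R N := @Uclass R N
  (fun B => uequiv (Cdd zero_is_cdd) B) (ex_intro _ (Cdd zero_is_cdd) erefl).
End ZeroClass.

(* Least upper and greatest lower bounds are picked among all elements with the
   bound property; ule being antisymmetric, there is at most one.  A family has
   both as soon as its index type is nonempty and no larger than the carriers of
   Hilbert spaces, so that the default zero_class is not reached for these. *)
Definition the_class (R : realType) (N : nat) (P : uclass R N -> Prop) :
    uclass R N :=
  match pselect (exists c, P c) with
  | left e => sval (cid e)
  | right _ => zero_class R N
  end.

Definition bigjoin (R : realType) (N : nat) (S : Type) (A : S -> uclass R N) :
    uclass R N :=
  the_class (is_lub (fun c => exists s, c = A s)).

Definition bigmeet (R : realType) (N : nat) (S : Type) (A : S -> uclass R N) :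
    uclass R N :=
  the_class (is_glb (fun c => exists s, c = A s)).

Definition join (R : realType) (N : nat) (a b : uclass R N) : uclass R N :=
  the_class (is_lub (fun c => c = a \/ c = b)).

Definition meet (R : realType) (N : nat) (a b : uclass R N) : uclass R N :=
  the_class (is_glb (fun c => c = a \/ c = b)).

(* Main.v *)
Require Import Defs.
From HB Require Import structures.
From mathcomp Require Import all_boot all_order all_algebra sesquilinear.
From mathcomp Require Import finmap complex.
From mathcomp Require Import boolp classical_sets filter reals topology.
From mathcomp Require Import interval_inference.
From mathcomp Require Import normedtype sequences.
From mathcomp Require wochoice.
From mathcomp Require Import ring lra.

Set Implicit Arguments.
Unset Strict Implicit.
Unset Printing Implicit Defensive.

Import Order.TTheory GRing.Theory Num.Theory.
Import numFieldNormedType.Exports.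

Local Open Scope classical_set_scope.
Local Open Scope ring_scope.
Local Open Scope complex_scope.

(** Reducing subspaces of a tuple are the projections of a von Neumann algebra,
    the commutant of the tuple, and unitary equivalence of the restrictions is
    Murray-von Neumann equivalence of the projections. The theorem thus says
    that classes of projections, in algebras of any type and without any
    countability assumption, form a lattice that is infinitely distributive in
    both ways. The proof is an algebraic study of the classes under orthogonal
    sums [Sum] and [add], and it avoids the classification into types.

    The analysis supplies a few facts about these sums. A bounded intertwiner
    has a polar decomposition ([polar]), which gives the refinement property of
    sums ([refinement]) and the fact that a nonzero class below a sum has a
    common part with one of the terms ([common_part]). Nested subspaces give
    [remainder], Zorn's lemma gives maximal families ([max_family]), and
    transfinite recursion places a well-ordered family of classes into a given
    one, term by term ([packing]).

    Call two classes disjoint when they have no nonzero common part. Every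
    set [X] of classes then generates a band, and each class splits uniquely
    into a part [pr X a] inside the band and a part disjoint from it; the
    projections [pr X] play the role of central projections. Any two classes
    are comparable on complementary bands ([comparability]), and there is a
    largest band on which one is below the other ([strict_part]). A refinement
    argument shows that [a ++ c = b ++ c] forces [a] and [b] to agree up to
    parts that [c] absorbs ([cancellation]). With these tools, for all [a] and
    [c] there is a least [f] with [a <<= c ++ f] ([residual_exists]).

    Least upper bounds follow: well-order the index set, let [f s] be the least
    class that has to be added to the sum of the earlier [f t] in order to reach
    [A s], and take the sum of all [f s]. Minimality provides room for [f s]
    inside any upper bound, so [packing] puts the whole sum below it. Greatest
    lower bounds are least upper bounds of lower bounds. Finally each of the two
    nontrivial inequalities is proved on the band where it is supposed to fail.
    There comparability of the two classes involved identifies the meet, or the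
    join, with one of them, and the inequality becomes obvious. *)

(** * Real and complex inner products *)

Section HilbertBasics.
Variables (R : realType) (H : hilbertType R).
Implicit Types x y z : H.

Local Notation "'[ x , y ]" := (inner H x y).

Lemma ipC x y : '[x, y] = Num.conj '[y, x].
Proof. by rewrite -[RHS]mul1r; exact: (hermitian_subproof (s := inner H)). Qed.

Lemma ipDl x y z : '[x + y, z] = '[x, z] + '[y, z].
Proof. exact: (linearDl (inner H)). Qed.

Lemma ipDr x y z : '[x, y + z] = '[x, y] + '[x, z].
Proof. exact: (linearDr (inner H)). Qed.

Lemma ipZl a x y : '[a *: x, y] = a * '[x, y].
Proof. exact: (linearZl_LR (inner H)). Qed.

Lemma ipZr a x y : '[x, a *: y] = Num.conj a * '[x, y].
Proof. exact: (linearZr_LR (inner H)). Qed.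

Lemma ipNl x y : '[- x, y] = - '[x, y].
Proof. exact: (linearNl (inner H)). Qed.

Lemma ipNr x y : '[x, - y] = - '[x, y].
Proof. exact: (linearNr (inner H)). Qed.

Lemma ipBl x y z : '[x - y, z] = '[x, z] - '[y, z].
Proof. by rewrite ipDl ipNl. Qed.

Lemma ipBr x y z : '[x, y - z] = '[x, y] - '[x, z].
Proof. by rewrite ipDr ipNr. Qed.

Lemma ip0l y : '[0, y] = 0.
Proof. exact: (linear0l (inner H)). Qed.

Lemma ip0r y : '[y, 0] = 0.
Proof. exact: (linear0r (inner H)). Qed.

Lemma ip_eq0 x : '[x, x] = 0 -> x = 0.
Proof. by move/eqP; rewrite dnorm_eq0 => /eqP. Qed.

Lemma ip_ext x y : (forall z, '[x, z] = '[y, z]) -> x = y.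
Proof.
by move=> xy; apply/subr0_eq/ip_eq0; rewrite ipBl xy subrr.
Qed.

(** Norms and inner products have values in [R[i]], while estimates and limits
    take place in [R]: hence this real norm and real inner product. *)
Definition rip x y : R := complex.Re '[x, y].
Definition hn x : R := complex.Re `|x|.

Lemma normE x : `|x| = (hn x)%:C.
Proof. by rewrite /hn RRe_real // ger0_real. Qed.

Lemma hn_ge0 x : 0 <= hn x.
Proof. by rewrite -ler0c -normE. Qed.

Lemma ipE x : '[x, x] = (hn x ^+ 2)%:C.
Proof. by rewrite -inner_norm normE -rmorphXn. Qed.

Lemma ripE x : rip x x = hn x ^+ 2.
Proof. by rewrite /rip ipE. Qed.

Lemma hn0_eq0 x : hn x = 0 -> x = 0.
Proof. by move=> x0; apply: ip_eq0; rewrite ipE x0 expr0n. Qed.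

Lemma hn0 : hn 0 = 0.
Proof. by rewrite /hn normr0. Qed.

Lemma hnN x : hn (- x) = hn x.
Proof. by rewrite /hn normrN. Qed.

Lemma hnB x y : hn (x - y) = hn (y - x).
Proof. by rewrite -hnN opprB. Qed.

Lemma hnZ (a : R) x : hn (a%:C *: x) = `|a| * hn x.
Proof.
apply: complexI; rewrite rmorphM -normE normrZ; congr (_ * _); last exact: normE.
by rewrite normc_def /= expr0n addr0 sqrtr_sqr.
Qed.

Lemma ler_hnD x y : hn (x + y) <= hn x + hn y.
Proof. by rewrite -lecR rmorphD /= -!normE ler_normD. Qed.

Lemma ler_hnB x y : hn (x - y) <= hn x + hn y.
Proof. by rewrite -(hnN y) ler_hnD. Qed.

Lemma ripC x y : rip x y = rip y x.
Proof. by rewrite /rip ipC; case: '[y, x]. Qed.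

Lemma ripDl x y z : rip (x + y) z = rip x z + rip y z.
Proof. by rewrite /rip ipDl; case: '[x, z]; case: '[y, z]. Qed.

Lemma ripNl x y : rip (- x) y = - rip x y.
Proof. by rewrite /rip ipNl; case: '[x, y]. Qed.

Lemma ripBl x y z : rip (x - y) z = rip x z - rip y z.
Proof. by rewrite ripDl ripNl. Qed.

Lemma ripDr x y z : rip z (x + y) = rip z x + rip z y.
Proof. by rewrite ripC ripDl !(ripC z). Qed.

Lemma ripNr x y : rip x (- y) = - rip x y.
Proof. by rewrite ripC ripNl ripC. Qed.

Lemma ripBr x y z : rip z (x - y) = rip z x - rip z y.
Proof. by rewrite ripDr ripNr. Qed.

Lemma ripZl (a : R) x y : rip (a%:C *: x) y = a * rip x y.
Proof. by rewrite /rip ipZl; case: '[x, y] => b c /=; rewrite mul0r subr0. Qed.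

Lemma hnDE x y : hn (x + y) ^+ 2 = hn x ^+ 2 + hn y ^+ 2 + 2 * rip x y.
Proof. by rewrite -!ripE !(ripDl, ripDr) (ripC y x); ring. Qed.

Lemma hnBE x y : hn (x - y) ^+ 2 = hn x ^+ 2 + hn y ^+ 2 - 2 * rip x y.
Proof. by rewrite hnDE hnN ripNr mulrN. Qed.

(** Cauchy-Schwarz, read off the triangle inequality of the norm. *)
Lemma rip_le x y : `|rip x y| <= hn x * hn y.
Proof.
wlog r0 : x / 0 <= rip x y.
  move=> W; have [/W//|/ltW r0] := leP 0 (rip x y).
  by rewrite -(hnN x) -normrN -ripNl W // ripNl oppr_ge0.
have := ler_hnD x y.
rewrite -(ler_pXn2r (n := 2)) ?nnegrE ?addr_ge0 ?hn_ge0 // hnDE ger0_norm //.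
rewrite sqrrD; lra.
Qed.

(** The real part of an inner product determines the inner product. *)
Lemma ipE2 x y : '[x, y] = rip x y +i* rip x ('i *: y).
Proof.
rewrite /rip ipZr; case: '[x, y] => a b.
have -> : Num.conj ('i : R[i]) = 0 -i* 1 by [].
by rewrite /= !(mul0r, mul1r, opprK, sub0r, mulN1r).
Qed.
End HilbertBasics.

(** * Limits in a Hilbert space *)

Section Convergence.
Variables (R : realType) (I : Type) (F : set_system I).
Context {FF : ProperFilter F}.

(** Convergence along a filter, so that sequences and sums over finite subsets
    of an arbitrary index type are treated alike. *)
Definition cvH (H : hilbertType R) (x : I -> H) (l : H) :=
  hn (x i - l) @[i --> F] --> (0 : R).

Section OneSpace.
Variable H : hilbertType R.
Implicit Types (x y : I -> H) (l m : H).

Lemma cvHP x l : cvH x l <->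
  forall e : R, 0 < e -> \forall i \near F, hn (x i - l) < e.
Proof.
split=> [/cvgr0Pnorm_lt xl e e0|xl].
  by near=> i; rewrite -[ltLHS]ger0_norm ?hn_ge0 //; near: i; exact: xl.
apply/cvgr0Pnorm_lt => e e0.
by near=> i; rewrite ger0_norm ?hn_ge0 //; near: i; exact: xl.
Unshelve. all: by end_near. Qed.

Lemma cvH_cvg x l : cvH x l <-> x @ F --> l.
Proof.
split=> [/cvHP xl|/cvgrPdist_lt xl].
  apply/cvgrPdist_lt => e e0.
  have er : e = (complex.Re e)%:C by rewrite RRe_real // gtr0_real.
  have e0' : 0 < complex.Re e by rewrite -ltcR -er.
  near=> i; rewrite normE er ltcR hnB; near: i; exact: xl.
apply/cvHP => e e0; have /xl : 0 < e%:C by rewrite ltcR.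
by apply: filterS => i; rewrite normE ltcR hnB.
Unshelve. all: by end_near. Qed.

Lemma cvH_unique x l m : cvH x l -> cvH x m -> l = m.
Proof. by move=> /cvH_cvg xl /cvH_cvg; exact: cvg_unique. Qed.

Lemma cvH_near x y l : (\forall i \near F, x i = y i) -> cvH x l -> cvH y l.
Proof.
move=> xy xl; apply: cvg_trans xl; apply: near_eq_cvg.
by apply: filterS xy => i ->.
Qed.

Lemma cvH_cst l : cvH (fun=> l) l.
Proof. by apply/cvH_cvg; exact: cvg_cst. Qed.

Lemma cvHB x y l m : cvH x l -> cvH y m -> cvH (fun i => x i - y i) (l - m).
Proof. by move=> /cvH_cvg xl /cvH_cvg ym; apply/cvH_cvg; exact: cvgB. Qed.

Lemma cvHZ a x l : cvH x l -> cvH (fun i => a *: x i) (a *: l).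
Proof. by move=> /cvH_cvg xl; apply/cvH_cvg; exact: cvgZl_tmp. Qed.

Lemma cvH_rip x y l m : cvH x l -> cvH y m ->
  rip (x i) (y i) @[i --> F] --> rip l m.
Proof.
move=> xl ym; apply/subr_cvg0.
have -> : (fun i => rip (x i) (y i) - rip l m) =
  (fun i => rip (x i - l) (y i - m) + (rip (x i - l) m + rip l (y i - m))).
  by apply/funext => i; rewrite !(ripBl, ripBr); ring.
have aux (u v : I -> H) (b : I -> R) : (forall i, hn (u i) * hn (v i) <= b i) ->
    b @ F --> (0 : R) -> rip (u i) (v i) @[i --> F] --> (0 : R).
  move=> ub b0; apply: norm_cvg0; apply: (@squeeze_cvgr _ _ _ _ (fun=> 0) b) => //.
    by near=> i; rewrite normr_ge0 /=; apply: le_trans (rip_le _ _) (ub i).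
  exact: cvg_cst.
rewrite -(addr0 (0 : R)) -{2}(addr0 (0 : R)).
apply: cvgD; last apply: cvgD.
- apply: (aux _ _ (fun i => hn (x i - l) * hn (y i - m))) => //.
  by rewrite -(mulr0 0); exact: cvgM.
- apply: (aux _ (fun=> m) (fun i => hn (x i - l) * hn m)) => //.
  by rewrite -(mul0r (hn m)); apply: cvgMr_tmp.
- apply: (aux (fun=> l) _ (fun i => hn l * hn (y i - m))) => //.
  by rewrite -(mulr0 (hn l)); apply: cvgMl_tmp.
Unshelve. all: by end_near. Qed.

Lemma cvH_hn x l : cvH x l -> hn (x i) @[i --> F] --> hn l.
Proof.
move=> xl; apply/subr_cvg0; apply: norm_cvg0.
apply: (@squeeze_cvgr _ _ _ _ (fun=> 0) (fun i => hn (x i - l))) => //; last first.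
  exact: cvg_cst.
near=> i; rewrite normr_ge0 /= ler_norml; apply/andP; split.
  by have := ler_hnD (l - x i) (x i); rewrite subrK hnB; lra.
by have := ler_hnD (x i - l) l; rewrite subrK; lra.
Unshelve. all: by end_near. Qed.

Lemma cvH_closed x l (E : set H) : closed E -> (\forall i \near F, E (x i)) ->
  cvH x l -> E l.
Proof. by move=> cE Ex /cvH_cvg; exact: closed_cvg. Qed.

Lemma cvH_closed2 x y l m (E : set (H * H)) : closed E ->
  (\forall i \near F, E (x i, y i)) -> cvH x l -> cvH y m -> E (l, m).
Proof.
move=> cE Ex /cvH_cvg xl /cvH_cvg ym.
have xy : (fun i => (x i, y i)) @ F --> (l, m) by exact: cvg_pair xl ym.
apply: cE => B /xy /= Bxy; have [i [Ei Bi]] := filter_ex (filterI Ex Bxy).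
by exists (x i, y i).
Qed.

Lemma cvH_complete x :
  (forall e : R, 0 < e -> exists z, \forall i \near F, hn (x i - z) < e) ->
  exists l, cvH x l.
Proof.
move=> xc; have /cauchy_cvg/cvg_ex[l xl] : cauchy (x @ F); last first.
  by exists l; apply/cvH_cvg.
apply: cauchy_exP => e e0.
have er : e = (complex.Re e)%:C by rewrite RRe_real // gtr0_real.
have /xc[z xz] : 0 < complex.Re e by rewrite -ltcR -er.
exists z; apply: filterS xz => i; rewrite -ball_normE /= => xz.
by rewrite normE er ltcR hnB.
Qed.

End OneSpace.

(** Adjoint relations survive pointwise limits. It suffices to treat real parts,
    since the complex identity is the real one at [a] and at ['i *: a]. *)
Lemma cvH_ip_eq (H K : hilbertType R) (x : I -> H) l a (y : I -> K) m b :
  cvH x l -> cvH y m ->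
  (forall i, inner H (x i) a = inner K b (y i)) -> inner H l a = inner K b m.
Proof.
have re (a' : H) (y' : I -> K) m' : cvH x l -> cvH y' m' ->
    (forall i, inner H (x i) a' = inner K b (y' i)) -> rip l a' = rip b m'.
  move=> xl ym xy; have := cvH_rip xl (cvH_cst a').
  under eq_fun do rewrite /rip xy.
  have := cvH_rip (cvH_cst b) ym; rewrite /rip => h1 h2.
  exact: cvg_unique h2 h1.
move=> xl ym xy; rewrite !ipE2; congr (_ +i* _); first exact: re ym xy.
apply: (re ('i *: a) (fun i => 'i *: y i)) => //; first exact: cvHZ.
by move=> i; rewrite !ipZr xy.
Qed.

End Convergence.

(** * Intertwining operators *)

#[local] Obligation Tactic := idtac.

Section Hom.
Variables (R : realType) (N : nat).
Implicit Types X Y Z : cdd R N.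

(** An operator [T] intertwining two tuples, in the sense that [T] maps [X_j]
    into [Y_j] and [T^*] maps [Y_j] into [X_j], graphwise. The operator is given
    together with its adjoint; the relation between the two forces linearity. *)
Record hom X Y := Hom {
  fwd : hspace X -> hspace Y;
  bwd : hspace Y -> hspace X;
  hom_adj : forall x y, inner _ (fwd x) y = inner _ x (bwd y);
  fwd_graph : forall j x x', graph (op X j) (x, x') ->
    graph (op Y j) (fwd x, fwd x');
  bwd_graph : forall j y y', graph (op Y j) (y, y') ->
    graph (op X j) (bwd y, bwd y') }.

Lemma hom_adjC X Y (T : hom X Y) y x :
  inner _ (bwd T y) x = inner _ y (fwd T x).
Proof. by rewrite ipC -hom_adj -ipC. Qed.

Definition dual X Y (T : hom X Y) : hom Y X :=
  Hom (hom_adjC T) (@bwd_graph _ _ T) (@fwd_graph _ _ T).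

Lemma fwdD X Y (T : hom X Y) x y : fwd T (x + y) = fwd T x + fwd T y.
Proof. by apply: ip_ext => z; rewrite ipDl !hom_adj ipDl. Qed.

Lemma fwdZ X Y (T : hom X Y) a x : fwd T (a *: x) = a *: fwd T x.
Proof. by apply: ip_ext => z; rewrite ipZl !hom_adj ipZl. Qed.

Lemma fwdN X Y (T : hom X Y) x : fwd T (- x) = - fwd T x.
Proof. by rewrite -scaleN1r fwdZ scaleN1r. Qed.

Lemma fwdB X Y (T : hom X Y) x y : fwd T (x - y) = fwd T x - fwd T y.
Proof. by rewrite fwdD fwdN. Qed.

Lemma fwd0 X Y (T : hom X Y) : fwd T 0 = 0.
Proof. by rewrite -(scale0r 0) fwdZ !scale0r. Qed.

Lemma bwdD X Y (T : hom X Y) x y : bwd T (x + y) = bwd T x + bwd T y.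
Proof. exact: (fwdD (dual T)). Qed.

Lemma bwdB X Y (T : hom X Y) x y : bwd T (x - y) = bwd T x - bwd T y.
Proof. exact: (fwdB (dual T)). Qed.

Lemma bwd0 X Y (T : hom X Y) : bwd T 0 = 0.
Proof. exact: (fwd0 (dual T)). Qed.

Lemma rip_adj X Y (T : hom X Y) x y : rip (fwd T x) y = rip x (bwd T y).
Proof. by rewrite /rip hom_adj. Qed.

Lemma bwd_ext X Y (S T : hom X Y) : fwd S =1 fwd T -> bwd S =1 bwd T.
Proof. by move=> ST y; apply: ip_ext => x; rewrite !hom_adjC ST. Qed.

Definition idh X : hom X X :=
  @Hom X X id id (fun _ _ => erefl) (fun _ _ _ h => h) (fun _ _ _ h => h).

Lemma comph_adj X Y Z (S : hom Y Z) (T : hom X Y) x z :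
  inner _ (fwd S (fwd T x)) z = inner _ x (bwd T (bwd S z)).
Proof. by rewrite !hom_adj. Qed.

Definition comph X Y Z (S : hom Y Z) (T : hom X Y) : hom X Z :=
  Hom (comph_adj S T)
    (fun j x x' h => fwd_graph S (fwd_graph T h))
    (fun j z z' h => bwd_graph T (bwd_graph S h)).

Lemma graphD (H : hilbertType R) (A : operator H) x x' y y' :
  graph A (x, x') -> graph A (y, y') -> graph A (x + y, x' + y').
Proof.
have [_ AP] := graph_submod A; move=> Ax Ay.
have := AP 1 (x, x') (y, y') (mem_set Ax) (mem_set Ay).
by move/set_mem; rewrite scale1r.
Qed.

Lemma graph0 (H : hilbertType R) (A : operator H) : graph A (0, 0).
Proof. by have [/set_mem] := graph_submod A. Qed.

Lemma graphZ (H : hilbertType R) (A : operator H) a x x' :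
  graph A (x, x') -> graph A (a *: x, a *: x').
Proof.
have [A0 AP] := graph_submod A; move=> Ax.
have := AP a (x, x') 0 (mem_set Ax) A0.
by move/set_mem; rewrite addr0.
Qed.

Program Definition addh X Y (S T : hom X Y) : hom X Y :=
  @Hom X Y (fun x => fwd S x + fwd T x) (fun y => bwd S y + bwd T y) _ _ _.
Next Obligation. by move=> X Y S T x y /=; rewrite ipDl ipDr !hom_adj. Qed.
Next Obligation. by move=> X Y S T j x x' xx'; apply: graphD; exact: fwd_graph. Qed.
Next Obligation. by move=> X Y S T j x x' xx'; apply: graphD; exact: bwd_graph. Qed.

Program Definition scaleh X Y (a : R) (T : hom X Y) : hom X Y :=
  @Hom X Y (fun x => a%:C *: fwd T x) (fun y => a%:C *: bwd T y) _ _ _.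
Next Obligation.
move=> X Y a T x y; rewrite ipZl ipZr hom_adj; congr (_ * _); apply/esym; exact: conjc_real.
Qed.
Next Obligation. by move=> X Y a T j x x' xx'; apply: graphZ; exact: fwd_graph. Qed.
Next Obligation. by move=> X Y a T j x x' xx'; apply: graphZ; exact: bwd_graph. Qed.

Definition subh X Y (S T : hom X Y) := addh S (scaleh (-1) T).

Lemma subhE X Y (S T : hom X Y) x : fwd (subh S T) x = fwd S x - fwd T x.
Proof. by rewrite /= rmorphN scaleN1r. Qed.

Lemma subhE' X Y (S T : hom X Y) y : bwd (subh S T) y = bwd S y - bwd T y.
Proof. by rewrite /= rmorphN scaleN1r. Qed.

Definition zeroh X Y : hom X Y.
Proof.
exists (fun=> 0) (fun=> 0) => [x y|j x x' _|j y y' _]; last 2 first.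
- exact: graph0.
- exact: graph0.
by rewrite ip0l ip0r.
Defined.

(** Pointwise limits of homs, with their adjoints, are homs because the graphs
    are closed. *)
Lemma hom_lim X Y (I : Type) (F : set_system I) {FF : ProperFilter F}
    (T : I -> hom X Y) f g :
  (forall x, cvH F (fun i => fwd (T i) x) (f x)) ->
  (forall y, cvH F (fun i => bwd (T i) y) (g y)) ->
  exists S : hom X Y, fwd S = f /\ bwd S = g.
Proof.
move=> Tf Tg; unshelve eexists; first exists f g.
- move=> x y; apply: (cvH_ip_eq (Tf x) (Tg y)) => i; exact: hom_adj.
- move=> j x x' xx'; apply: (cvH_closed2 _ _ (Tf x) (Tf x')).
    by have [] := cddP Y j.
  by apply: nearW => i; exact: fwd_graph.
- move=> j x x' xx'; apply: (cvH_closed2 _ _ (Tg x) (Tg x')).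
    by have [] := cddP X j.
  by apply: nearW => i; exact: bwd_graph.
by [].
Qed.

Definition isometric X Y (V : hom X Y) := forall x, bwd V (fwd V x) = x.

Lemma isometric_ip X Y (V : hom X Y) x y : isometric V ->
  inner _ (fwd V x) (fwd V y) = inner _ x y.
Proof. by move=> iV; rewrite hom_adj iV. Qed.

Lemma isometric_hn X Y (V : hom X Y) x : isometric V -> hn (fwd V x) = hn x.
Proof.
move=> iV; apply/eqP; rewrite -(eqrXn2 (n := 2)) ?hn_ge0 //.
by rewrite -!ripE rip_adj iV.
Qed.

Lemma coisometric_hn X Y (V : hom X Y) y : isometric V -> hn (bwd V y) <= hn y.
Proof.
move=> iV; have [/eqP|y0] := eqVneq (hn (bwd V y)) 0.
  by move/eqP => ->; exact: hn_ge0.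
have p : 0 < hn (bwd V y) by rewrite lt_neqAle eq_sym y0 hn_ge0.
rewrite -(ler_pM2l p) -expr2 -ripE -rip_adj -(isometric_hn (bwd V y) iV).
exact: le_trans (ler_norm _) (rip_le _ _).
Qed.

Lemma isometric_comp X Y Z (V : hom Y Z) (W : hom X Y) :
  isometric V -> isometric W -> isometric (comph V W).
Proof. by move=> iV iW x; rewrite /= iV iW. Qed.

End Hom.

Lemma near_inv (R : realType) (e : R) : 0 < e ->
  \forall n \near \oo, n.+1%:R^-1 < e.
Proof. by move=> e0; exact: near_infty_natSinv_lt (PosNum e0). Qed.

(** * Orthogonal projections *)

Section Projection.
Variables (R : realType) (H : hilbertType R) (E : closedSubspace H).

Lemma subspace0 : (E : set H) 0.
Proof. by have [/set_mem] := subspace_submod E. Qed.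

Lemma subspaceP a x y : (E : set H) x -> (E : set H) y -> (E : set H) (a *: x + y).
Proof.
have [_ EP] := subspace_submod E; move=> Ex Ey.
exact/set_mem/(EP a x y (mem_set Ex) (mem_set Ey)).
Qed.

Lemma subspaceZ a x : (E : set H) x -> (E : set H) (a *: x).
Proof. by move=> Ex; rewrite -[_ *: _]addr0; exact: subspaceP subspace0. Qed.

Lemma subspaceD x y : (E : set H) x -> (E : set H) y -> (E : set H) (x + y).
Proof. by move=> Ex Ey; rewrite -[x]scale1r; exact: subspaceP. Qed.

(** A sequence that minimizes the distance to [E] is Cauchy by the parallelogram
    law; the quadratic function [t |-> |x - y - t z|^2] is minimal at [t = 0] for
    the minimizer [y], which makes [x - y] orthogonal to [z]. *)
Lemma projection_exists x : exists y, (E : set H) y /\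
  forall z, (E : set H) z -> inner H (x - y) z = 0.
Proof.
pose D := [set hn (x - y) ^+ 2 | y in (E : set H)].
have D0 : D !=set0 by exists (hn (x - 0) ^+ 2), 0 => //; exact: subspace0.
have Dlb : lbound D 0 by move=> _ [y _ <-]; exact: sqr_ge0.
pose d := inf D.
have dle y : (E : set H) y -> d <= hn (x - y) ^+ 2.
  by move=> Ey; apply: ge_inf; [exists 0|exists y].
have /choice[u uP] (n : nat) :
    exists y, (E : set H) y /\ hn (x - y) ^+ 2 < d + n.+1%:R^-1.
  have [|_ [y Ey <-] yd] := @inf_adherent _ D n.+1%:R^-1 _ (conj D0 (ex_intro _ 0 Dlb)).
    by rewrite invr_gt0 ltr0n.
  by exists y.
have par y z : (E : set H) y -> (E : set H) z ->
    hn (y - z) ^+ 2 <= 2 * (hn (x - y) ^+ 2 - d) + 2 * (hn (x - z) ^+ 2 - d).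
  move=> Ey Ez.
  have := dle _ (subspaceZ (2^-1)%:C (subspaceD Ey Ez)).
  have -> : x - (2^-1)%:C *: (y + z) = (2^-1)%:C *: ((x - y) + (x - z)).
    rewrite addrACA -opprD scalerBr; congr (_ - _).
    rewrite scalerDr -scalerDl -rmorphD (_ : 2^-1 + 2^-1 = 1 :> R); last by field.
    by rewrite rmorph1 scale1r.
  rewrite hnZ exprMn (hnDE (x - y)) => h.
  have -> : y - z = (x - z) - (x - y) by rewrite opprB [RHS]addrC subrKA.
  rewrite hnBE (ripC (x - z)); move: h.
  by rewrite ger0_norm ?invr_ge0 //; lra.
have [|y uy] := @cvH_complete R nat \oo _ H u.
  move=> e e0.
  have [n nP] : exists n : nat, n.+1%:R^-1 < e ^+ 2 / 4.
    have e4 : 0 < e ^+ 2 / 4 by rewrite divr_gt0 ?exprn_gt0.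
    exact: filter_ex (near_inv e4).
  exists (u n); near=> m.
  rewrite -(ltr_pXn2r (n := 2)) ?nnegrE ?hn_ge0 ?(ltW e0) //.
  have [[Em um] [En un]] := (uP m, uP n).
  apply: le_lt_trans (par _ _ Em En) _.
  suff mn : m.+1%:R^-1 <= n.+1%:R^-1 :> R.
    move: (m.+1%:R^-1) (n.+1%:R^-1) um un nP mn => p q; lra.
  rewrite lef_pV2 ?posrE ?ltr0n // ler_nat ltnS.
  by near: m; exists n.
have Ey : (E : set H) y.
  apply: (cvH_closed (subspace_closed (c := E)) _ uy).
  by apply: nearW => n; have [] := uP n.
have dy : hn (x - y) ^+ 2 <= d.
  apply/ler_addgt0Pr => e e0.
  have : (fun n => hn (x - u n) ^+ 2) @ \oo --> hn (x - y) ^+ 2.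
    have /cvH_hn h : cvH \oo (fun n => x - u n) (x - y) by apply: cvHB; first exact: cvH_cst.
    by rewrite expr2; under eq_fun do rewrite expr2; exact: cvgM.
  move=> /cvgr_to_le; apply.
  have := near_inv e0; apply: filterS => n /= ne.
  by have [_ /ltW/le_trans->//] := uP n; rewrite lerD2l ltW.
exists y; split=> //.
have re z : (E : set H) z -> rip (x - y) z = 0.
  move=> Ez; set r := rip _ _; set a := hn z ^+ 2.
  have a0 : 0 <= a by exact: sqr_ge0.
  have tP t : 0 <= t ^+ 2 * a - 2 * (t * r).
    have := dle _ (subspaceD Ey (subspaceZ t%:C Ez)).
    rewrite opprD addrA hnBE hnZ exprMn real_normK ?num_real // ripC ripZl ripC.
    by move: dy; rewrite -/a -/r; lra.
  (* At this value of t the quadratic is at most -(r / (a + 1))^2. *)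
  have := tP (r / (a + 1)).
  have -> : (r / (a + 1)) ^+ 2 * a - 2 * (r / (a + 1) * r) =
     - ((r / (a + 1)) ^+ 2 * (a + 2)) by field; lra.
  rewrite oppr_ge0 => h.
  have : (r / (a + 1)) ^+ 2 * (a + 2) == 0.
    by rewrite eq_le h mulr_ge0 ?sqr_ge0 //; lra.
  rewrite mulf_eq0 expf_eq0 /= mulf_eq0 invr_eq0 => /orP[/orP[/eqP//|]|] /eqP; lra.
by move=> z Ez; rewrite ipE2 !re //; exact: subspaceZ.
Unshelve. all: by end_near. Qed.

Lemma orthoprojP x : (E : set H) (orthoproj E x) /\
  forall z, (E : set H) z -> inner H (x - orthoproj E x) z = 0.
Proof.
by have [y yP] := projection_exists x; rewrite /orthoproj; case: xgetP => // /(_ y).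
Qed.

Lemma orthoproj_unique x y : (E : set H) y ->
  (forall z, (E : set H) z -> inner H (x - y) z = 0) -> orthoproj E x = y.
Proof.
move=> Ey yP; have [Ep pP] := orthoprojP x.
have Epy : (E : set H) (orthoproj E x - y).
  by rewrite addrC -scaleN1r; exact: subspaceP.
apply/subr0_eq/ip_eq0.
rewrite {1}(_ : _ - y = (x - y) - (x - orthoproj E x)).
  by rewrite ipBl yP // pP // subrr.
by rewrite opprB [RHS]addrC subrKA.
Qed.
End Projection.

(** * Subobjects *)

Section ClosedDense.
Variables (R : realType) (H : hilbertType R).

Lemma ball_hn (x y : H) (e : R[i]) : 0 < e ->
  ball x e y <-> hn (x - y) < complex.Re e.
Proof.
move=> e0; have er : e = (complex.Re e)%:C by rewrite RRe_real // gtr0_real.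
by rewrite -ball_normE /= normE {1}er ltcR.
Qed.

Lemma closed_hn (E : set H) :
  (forall x, (forall e : R, 0 < e -> exists2 y, E y & hn (x - y) < e) -> E x) ->
  closed E.
Proof.
move=> EP x xE; apply: EP => e e0; have eC : 0 < e%:C by rewrite ltcR.
have [y [Ey /(ball_hn _ _ eC)]] := xE _ (nbhsx_ballx x _ eC).
by exists y.
Qed.

Lemma closed2P (E : set (H * H)) : closed E <->
  (forall x x', (forall e : R, 0 < e -> exists y y',
     [/\ E (y, y'), hn (x - y) < e & hn (x' - y') < e]) -> E (x, x')).
Proof.
split=> [cE x x' xE|EP [x x'] xE].
  apply: cE => B [[B1 B2]] /= [/nbhs_ballP[e1 e10 B1e] /nbhs_ballP[e2 e20 B2e]] B12.
  have e1C : 0 < complex.Re e1 by rewrite -ltcR RRe_real // gtr0_real.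
  have e2C : 0 < complex.Re e2 by rewrite -ltcR RRe_real // gtr0_real.
  have [|y [y' [Ey]]] := xE (Num.min (complex.Re e1) (complex.Re e2)).
    by rewrite lt_min e1C.
  rewrite !lt_min => /andP[h1 _] /andP[_ h2].
  exists (y, y'); split=> //; apply: B12; split=> /=.
    by apply: B1e; exact/ball_hn.
  by apply: B2e; exact/ball_hn.
apply: EP => e e0; have eC : 0 < e%:C by rewrite ltcR.
have [|[y y'] [Ey [/= /(ball_hn _ _ eC) h1 /(ball_hn _ _ eC) h2]]] :=
    xE (ball x e%:C `*` ball x' e%:C).
  by exists (ball x e%:C, ball x' e%:C) => //; split; exact: nbhsx_ballx.
by exists y, y'.
Qed.

Lemma dense_hn (E : set H) : dense E <->
  (forall x (e : R), 0 < e -> exists2 y, E y & hn (x - y) < e).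
Proof.
split=> [dE x e e0|EP O [x Ox] oO].
  have eC : 0 < e%:C by rewrite ltcR.
  have [||y [xy Ey]] := dE (ball x e%:C)°.
  - exists x; exact: nbhsx_ballx.
  - exact: open_interior.
  exists y => //; apply/(ball_hn _ _ eC); exact: interior_subset.
have /nbhs_ballP[e /= e0 Oe] : nbhs x O by exact: open_nbhs_nbhs.
have e0' : 0 < complex.Re e by rewrite -ltcR RRe_real // gtr0_real.
have [y Ey xy] := EP x _ e0'.
by exists y; split=> //; apply: Oe; exact/ball_hn.
Qed.
End ClosedDense.

Section Subobjects.
Variables (R : realType) (N : nat).
Implicit Types X Y Z : cdd R N.

Section Reducing.
Variables (X : cdd R N) (E : closedSubspace (hspace X)).
Hypothesis rE : reducing E.

Lemma orthoproj_adj x y :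
  inner _ (orthoproj E x) y = inner _ x (orthoproj E y).
Proof.
have [Ex xP] := orthoprojP E x; have [Ey yP] := orthoprojP E y.
transitivity (inner _ (orthoproj E x) (orthoproj E y)); apply/eqP.
  by rewrite -subr_eq0 -ipBr ipC yP // rmorph0.
by rewrite eq_sym -subr_eq0 -ipBl xP.
Qed.

Lemma orthoproj_graph j x x' : graph (op X j) (x, x') ->
  graph (op X j) (orthoproj E x, orthoproj E x').
Proof. by move=> xx'; have /= := rE (j := j) (ex_intro2 _ _ (x, x') xx' erefl). Qed.

Definition orthoproj_hom : hom X X :=
  Hom orthoproj_adj orthoproj_graph orthoproj_graph.

Lemma orthoproj_id x : (E : set _) x -> orthoproj E x = x.
Proof. by move=> Ex; apply: orthoproj_unique => // z _; rewrite subrr ip0l. Qed.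

Lemma hn_orthoproj x : hn (orthoproj E x) <= hn x.
Proof.
have [Ex xP] := orthoprojP E x.
rewrite -(ler_pXn2r (n := 2)) ?nnegrE ?hn_ge0 //.
rewrite -[leRHS](congr1 (fun z => hn z ^+ 2) (subrK (orthoproj E x) x)) hnDE.
by rewrite /rip xP //= mulr0 addr0 lerDr sqr_ge0.
Qed.

Lemma hn_elt (u : subspace_hilbert E) : hn u = hn (elt_val u).
Proof. by []. Qed.

Lemma eltB (u v : subspace_hilbert E) : elt_val (u - v) = elt_val u - elt_val v.
Proof. by []. Qed.

Lemma restrict_cdd : is_cdd (Defs.restrict E).
Proof.
move=> j; have [/closed2P cG /dense_hn dD] := cddP X j; split.
  apply/closed2P => u u' uE; apply: cG => e /uE[v [v' [Gv h1 h2]]].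
  by exists (elt_val v), (elt_val v').
apply/dense_hn => u e e0.
have [_ [[d d'] /= dd' <- ud]] := dD (elt_val u) e e0.
have [Ed _] := orthoprojP E d; have [Ed' _] := orthoprojP E d'.
exists (SubspaceElt (mem_set Ed)).
  by exists (SubspaceElt (mem_set Ed), SubspaceElt (mem_set Ed')) => //=;
    exact: orthoproj_graph.
rewrite hn_elt eltB -(orthoproj_id (set_mem (elt_valP u))).
by rewrite -(fwdB orthoproj_hom) /=; exact: le_lt_trans (hn_orthoproj _) ud.
Qed.

Definition sub_cdd := Cdd restrict_cdd.

Definition subproj (x : hspace X) : subspace_hilbert E :=
  SubspaceElt (mem_set (orthoprojP E x).1).

Lemma incl_adj (u : hspace sub_cdd) x :
  inner _ (elt_val u) x = inner (hspace sub_cdd) u (subproj x).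
Proof.
rewrite -{1}(orthoproj_id (set_mem (elt_valP u))) orthoproj_adj //.
Qed.

Definition incl : hom sub_cdd X :=
  @Hom R N sub_cdd X _ _ incl_adj (fun j u u' h => h)
    (fun j x x' => @orthoproj_graph j x x').

Lemma incl_isometric : isometric incl.
Proof.
by move=> u; apply: val_inj; exact: (orthoproj_id (set_mem (elt_valP u))).
Qed.
End Reducing.

Section FixedSpace.
Variables (X : cdd R N) (P : hom X X).
Hypotheses (Psa : forall x, bwd P x = fwd P x)
  (Pid : forall x, fwd P (fwd P x) = fwd P x).

Lemma hn_proj x : hn (fwd P x) <= hn x.
Proof.
have [->|/eqP y0] := eqVneq (hn (fwd P x)) 0; first exact: hn_ge0.
have p : 0 < hn (fwd P x) by rewrite lt_neqAle eq_sym hn_ge0 andbT; apply/eqP.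
rewrite -(ler_pM2l p) -expr2 -ripE rip_adj Psa Pid ripC.
exact: le_trans (ler_norm _) (rip_le _ _).
Qed.

Definition fixed_set := [set x | fwd P x = x].

Lemma fixed_submod : submod_closed (mem fixed_set).
Proof.
split=> [|a x y /set_mem Ex /set_mem Ey]; apply: mem_set; first exact: fwd0.
by rewrite /fixed_set /= fwdD fwdZ Ex Ey.
Qed.

Lemma fixed_closed : closed fixed_set.
Proof.
apply: closed_hn => x xE; apply/subr0_eq/hn0_eq0/eqP.
rewrite eq_le hn_ge0 andbT; apply/ler_addgt0Pr => e e0; rewrite add0r.
have /xE[y Ey xy] : 0 < e / 2 by lra.
have -> : fwd P x - x = fwd P (x - y) - (x - y).
  by rewrite fwdB Ey opprB addrA subrK.
by have := ler_hnB (fwd P (x - y)) (x - y); have := hn_proj (x - y); lra.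
Qed.

Definition fixed_space := ClosedSubspace fixed_submod fixed_closed.

Lemma fixed_orthoproj x : orthoproj fixed_space x = fwd P x.
Proof.
apply: orthoproj_unique; first exact: Pid.
by move=> z /= Ez; rewrite -Ez -(Psa z) -hom_adj fwdB Pid subrr ip0l.
Qed.

Lemma fixed_reducing : reducing fixed_space.
Proof.
move=> j _ [[x x'] /= xx' <-]; rewrite /= !fixed_orthoproj; exact: fwd_graph.
Qed.

(** The fixed space of a self-adjoint idempotent reduces the tuple, and the
    restriction to it is the required subobject. *)
Lemma proj_split : exists Y, exists2 V : hom Y X, isometric V &
  forall x, fwd V (bwd V x) = fwd P x.
Proof.
exists (sub_cdd fixed_reducing), (incl fixed_reducing).
  exact: incl_isometric.
by move=> x; exact: fixed_orthoproj.
Qed.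
End FixedSpace.

Definition iso X Y := exists2 T : hom X Y, isometric T & isometric (dual T).

(** A unitary operator is inverted by its adjoint. *)
Lemma uequivP X Y : uequiv X Y <-> iso X Y.
Proof.
split=> [[U [[Uip /choice[V VP]] UG]]|[T iT iT']].
  have VK x : V (U x) = x.
    apply: ip_ext => z; rewrite -Uip VP Uip //.
  have ad x y : inner _ (U x) y = inner _ x (V y) by rewrite -{1}(VP y) Uip.
  have fg j x x' : graph (op X j) (x, x') -> graph (op Y j) (U x, U x').
    by rewrite UG.
  have bg j y y' : graph (op Y j) (y, y') -> graph (op X j) (V y, V y').
    by rewrite UG /= !VP.
  by exists (Hom ad fg bg).
pose U := HB.pack_for {linear hspace X -> hspace Y} (fwd T)
  (GRing.isLinear.Build _ _ _ _ (fwd T)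
    (fun a x y => etrans (fwdD T (a *: x) y) (congr1 (+%R^~ _) (fwdZ T a x)))).
exists U; split; first split.
- by move=> x y; exact: isometric_ip.
- by move=> z; exists (bwd T z); exact: iT'.
move=> j; apply/seteqP; split=> -[x x'] /=; first exact: fwd_graph.
by move/(bwd_graph T); rewrite !iT.
Qed.
End Subobjects.

(** * Sums over finite subsets *)

Lemma cvg_ext (I : Type) (F : set_system I) (R : realType) (f g : I -> R) (l : R) :
  f =1 g -> f @ F --> l -> g @ F --> l.
Proof. by move=> /funext ->. Qed.

Lemma cvg_seqsum (I T : Type) (F : set_system I) {FF : Filter F} (R : realType)
    (r : seq T) (f : T -> I -> R) (l : T -> R) :
  (forall t, f t @ F --> l t) ->
  (fun i => \sum_(t <- r) f t i) @ F --> \sum_(t <- r) l t.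
Proof.
move=> fl; elim: r => [|t r IH].
  by rewrite big_nil; apply: cvg_ext (cvg_cst _) => i; rewrite big_nil.
by rewrite big_cons; apply: cvg_ext (cvgD (fl t) IH) => i; rewrite big_cons.
Qed.

Section FiniteSums.
Variable I : choiceType.

(** The directed set of finite subsets: unordered sums are limits along it. *)
Definition finsets : set_system {fset I} :=
  filter_from setT (fun A => [set B | A `<=` B]%fset).

Global Instance finsets_filter : ProperFilter finsets.
Proof.
apply: filter_from_proper => [|A _]; last by exists A => /=; exact: fsubset_refl.
apply: filter_fromT_filter; first by exists fset0.
by move=> A B; exists (A `|` B)%fset => C /=; rewrite fsubUset => /andP[].
Qed.

Lemma near_finsets (A : {fset I}) : \forall B \near finsets, (A `<=` B)%fset.
Proof. by exists A. Qed.

Variable R : realType.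
Implicit Types f g : I -> R.

Lemma psum_diff (V : zmodType) (f : I -> V) (A B : {fset I}) : (A `<=` B)%fset ->
  \sum_(i <- B) f i - \sum_(i <- A) f i = \sum_(i <- (B `\` A)%fset) f i.
Proof.
move=> AB; apply/eqP; rewrite subr_eq addrC; apply/eqP.
rewrite (big_fsetID _ (mem A)) /=; congr (_ + _).
  apply: eq_fbigl => i; rewrite !inE /=.
  by apply/andP/idP => [[]//|iA]; split=> //; exact: (fsubsetP AB).
by apply: eq_fbigl => i; rewrite !inE /= andbC.
Qed.

Lemma psum_mono f (A B : {fset I}) : (forall i, 0 <= f i) -> (A `<=` B)%fset ->
  \sum_(i <- A) f i <= \sum_(i <- B) f i.
Proof. by move=> f0 AB; rewrite -subr_ge0 psum_diff // sumr_ge0. Qed.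

Lemma psum_cvg f (M : R) : (forall i, 0 <= f i) ->
  (forall A : {fset I}, \sum_(i <- A) f i <= M) ->
  exists s : R, [/\ (fun A : {fset I} => \sum_(i <- A) f i) @ finsets --> s,
    s <= M & forall A : {fset I}, \sum_(i <- A) f i <= s].
Proof.
move=> f0 fM; pose D := range (fun A : {fset I} => \sum_(i <- A) f i).
have Dsup : has_sup D.
  split; first by exists (\sum_(i <- fset0) f i), fset0.
  by exists M => _ [A _ <-].
have ub A : \sum_(i <- A : {fset I}) f i <= sup D by apply: sup_upper_bound => //; exists A.
exists (sup D); split=> //; last first.
  by apply: ge_sup => [|_ [A _ <-]//]; exact: Dsup.1.
apply/cvgrPdist_lt => e e0.
have [_ [A _ <-] As] := sup_adherent e0 Dsup.
have := near_finsets A; apply: filterS => B AB.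
rewrite ger0_norm ?subr_ge0 ?ub // ltrBlDr -ltrBlDl.
exact: lt_le_trans As (psum_mono f0 AB).
Qed.

(** [f] is the difference of the nonnegative families [f + g] and [g], whose
    partial sums are bounded. *)
Lemma psum_cvg_abs f g (M : R) : (forall i, `|f i| <= g i) ->
  (forall A : {fset I}, \sum_(i <- A) g i <= M) ->
  exists s : R, (fun A : {fset I} => \sum_(i <- A) f i) @ finsets --> s.
Proof.
move=> fg gM.
have [||s [sP _ _]] := @psum_cvg g M.
- by move=> i; apply: le_trans (fg i).
- by [].
have [||t [tP _ _]] := @psum_cvg (fun i => f i + g i) (2 * M).
- by move=> i; have := fg i; rewrite ler_norml => /andP[]; lra.
- move=> A; rewrite big_split /=; have := gM A.
  suff : \sum_(i <- A) f i <= \sum_(i <- A) g i by lra.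
  by apply: ler_sum => i _; exact: le_trans (ler_norm _) (fg i).
exists (t - s).
have -> : (fun A : {fset I} => \sum_(i <- A) f i) =
  (fun A : {fset I} => \sum_(i <- A) (f i + g i) - \sum_(i <- A) g i).
  by apply/funext => A; rewrite big_split /= addrK.
exact: cvgB.
Qed.

Lemma psum_support f (A B : {fset I}) : (forall i, 0 <= f i) ->
  (forall i, i \notin A -> f i = 0) ->
  \sum_(i <- B) f i <= \sum_(i <- A) f i.
Proof.
move=> f0 fA; apply: (@le_trans _ _ (\sum_(i <- (A `|` B)%fset) f i)).
  by apply: psum_mono => //; exact: fsubsetUr.
rewrite -subr_le0 psum_diff ?fsubsetUl // big1_seq // => i /=.
by rewrite !inE => /andP[/fA].
Qed.
End FiniteSums.
Arguments finsets {I}.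

Section ComplexLimits.
Variables (R : realType) (I : Type) (F : set_system I).
Context {FF : ProperFilter F}.
Implicit Types z w : I -> R[i].

(** Convergence in [R[i]] by components, which reduces it to the completeness
    of [R]. *)
Definition cvC z (l : R[i]) :=
  (complex.Re (z i) @[i --> F] --> complex.Re l) /\
  (complex.Im (z i) @[i --> F] --> complex.Im l).

Lemma cvC_unique z l m : cvC z l -> cvC z m -> l = m.
Proof.
move=> [zr zi] [zr' zi']; apply/eqP; rewrite eq_complex; apply/andP; split; apply/eqP.
  exact: cvg_unique zr zr'.
exact: cvg_unique zi zi'.
Qed.

Lemma cvCD z w l m : cvC z l -> cvC w m -> cvC (fun i => z i + w i) (l + m).
Proof.
move=> [zr zi] [wr wi]; split.
  have -> : complex.Re (l + m) = complex.Re l + complex.Re m by case: l m {zr zi wr wi} => ? ? [].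
  rewrite (_ : (fun i => _) = (fun i => complex.Re (z i) + complex.Re (w i))); first exact: cvgD.
  by apply/funext => i; case: (z i) (w i) => ? ? [].
have -> : complex.Im (l + m) = complex.Im l + complex.Im m by case: l m {zr zi wr wi} => ? ? [].
rewrite (_ : (fun i => _) = (fun i => complex.Im (z i) + complex.Im (w i))); first exact: cvgD.
by apply/funext => i; case: (z i) (w i) => ? ? [].
Qed.

Lemma cvCM a z l : cvC z l -> cvC (fun i => a * z i) (a * l).
Proof.
move=> [zr zi]; split.
  have E (u : R[i]) : complex.Re (a * u) =
    complex.Re a * complex.Re u - complex.Im a * complex.Im u by case: a u => ? ? [].
  rewrite E; under eq_fun do rewrite E.
  by apply: cvgB; exact: cvgMl_tmp.
have E (u : R[i]) : complex.Im (a * u) =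
  complex.Re a * complex.Im u + complex.Im a * complex.Re u by case: a u => ? ? [].
rewrite E; under eq_fun do rewrite E.
by apply: cvgD; exact: cvgMl_tmp.
Qed.

Lemma cvC_conj z l : cvC z l -> cvC (fun i => Num.conj (z i)) (Num.conj l).
Proof.
move=> [zr zi]; split.
  have E (u : R[i]) : complex.Re (Num.conj u) = complex.Re u by case: u.
  by rewrite E; under eq_fun do rewrite E.
have E (u : R[i]) : complex.Im (Num.conj u) = - complex.Im u by case: u.
by rewrite E; under eq_fun do rewrite E; exact: cvgN.
Qed.

Lemma cvC_near z w l : (\forall i \near F, z i = w i) -> cvC z l -> cvC w l.
Proof.
move=> zw [zr zi]; split.
  by apply: cvg_trans zr; apply: near_eq_cvg; apply: filterS zw => i ->.
by apply: cvg_trans zi; apply: near_eq_cvg; apply: filterS zw => i ->.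
Qed.

Lemma cvC_cst l : cvC (fun=> l) l.
Proof. by split; exact: cvg_cst. Qed.
End ComplexLimits.

(** * The Hilbert space direct sum *)

Lemma hnZC (R : realType) (H : hilbertType R) (a : R[i]) (x : H) :
  hn (a *: x) = complex.Re `|a| * hn x.
Proof.
apply: complexI; rewrite rmorphM -normE normrZ; congr (_ * _); last exact: normE.
Qed.

Lemma hnD_sqr (R : realType) (H : hilbertType R) (x y : H) :
  hn (x + y) ^+ 2 <= 2 * hn x ^+ 2 + 2 * hn y ^+ 2.
Proof.
have := sqr_ge0 (hn (x - y)); rewrite hnDE hnBE; lra.
Qed.

Section DirectSumHilbert.
Variables (R : realType) (I : choiceType) (H : I -> hilbertType R).

Definition sqsum (x : forall i, H i) (A : {fset I}) := \sum_(i <- A) hn (x i) ^+ 2.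

Definition sqsummable (x : forall i, H i) := exists M, forall A, sqsum x A <= M.

Record dsum := Dsum { dval :> forall i, H i; dvalP : sqsummable dval }.

Lemma dsum_ext (x y : dsum) : (forall i, x i = y i) -> x = y.
Proof.
case: x y => [x xP] [y yP] /= xy; have {}xy : x = y by exact: functional_extensionality_dep.
by case: y / xy yP => yP; congr Dsum; exact: Prop_irrelevance.
Qed.

HB.instance Definition _ := gen_eqMixin dsum.
HB.instance Definition _ := gen_choiceMixin dsum.

Lemma dzero_subproof : sqsummable (fun=> 0).
Proof. by exists 0 => A; rewrite /sqsum big1 // => i _; rewrite hn0 expr0n. Qed.

Lemma dopp_subproof (x : dsum) : sqsummable (fun i => - x i).
Proof.
have [M xM] := dvalP x; exists M => A; rewrite /sqsum.
under eq_bigr do rewrite hnN.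
exact: xM.
Qed.

Lemma dadd_subproof (x y : dsum) : sqsummable (fun i => x i + y i).
Proof.
have [[M xM] [K yK]] := (dvalP x, dvalP y); exists (2 * M + 2 * K) => A.
apply: (@le_trans _ _ (2 * sqsum x A + 2 * sqsum y A)).
  rewrite /sqsum !mulr_sumr -big_split; apply: ler_sum => i _; exact: hnD_sqr.
by rewrite lerD // ler_pM2l.
Qed.

Lemma dscale_subproof a (x : dsum) : sqsummable (fun i => a *: x i).
Proof.
have [M xM] := dvalP x; exists (complex.Re `|a| ^+ 2 * M) => A.
rewrite /sqsum; under eq_bigr do rewrite hnZC exprMn.
by rewrite -mulr_sumr ler_wpM2l ?sqr_ge0 // xM.
Qed.

Let dzero := Dsum dzero_subproof.
Let dopp x := Dsum (dopp_subproof x).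
Let dadd x y := Dsum (dadd_subproof x y).
Let dscale a x := Dsum (dscale_subproof a x).

Let daddA : associative dadd.
Proof. by move=> x y z; apply: dsum_ext => i /=; rewrite addrA. Qed.
Let daddC : commutative dadd.
Proof. by move=> x y; apply: dsum_ext => i /=; rewrite addrC. Qed.
Let dadd0 : left_id dzero dadd.
Proof. by move=> x; apply: dsum_ext => i /=; rewrite add0r. Qed.
Let daddN : left_inverse dzero dopp dadd.
Proof. by move=> x; apply: dsum_ext => i /=; rewrite addNr. Qed.

HB.instance Definition _ := GRing.isZmodule.Build dsum daddA daddC dadd0 daddN.

Let dscaleA a b v : dscale a (dscale b v) = dscale (a * b) v.
Proof. by apply: dsum_ext => i /=; rewrite scalerA. Qed.
Let dscale1 : left_id 1 dscale.
Proof. by move=> x; apply: dsum_ext => i /=; rewrite scale1r. Qed.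
Let dscaleDr : right_distributive dscale +%R.
Proof. by move=> a x y; apply: dsum_ext => i /=; rewrite scalerDr. Qed.
Let dscaleDl v : {morph dscale^~ v : a b / a + b}.
Proof. by move=> a b; apply: dsum_ext => i /=; rewrite scalerDl. Qed.

HB.instance Definition _ := GRing.Zmodule_isLmodule.Build R[i] dsum
  dscaleA dscale1 dscaleDr dscaleDl.

Definition psum_ip (x y : dsum) (A : {fset I}) := \sum_(i <- A) inner (H i) (x i) (y i).

Lemma Re_sum (T : Type) (r : seq T) (z : T -> R[i]) :
  complex.Re (\sum_(i <- r) z i) = \sum_(i <- r) complex.Re (z i).
Proof. exact: (raddf_sum (@complex.Re R : Rcomplex R -> R)). Qed.

Lemma Im_sum (T : Type) (r : seq T) (z : T -> R[i]) :
  complex.Im (\sum_(i <- r) z i) = \sum_(i <- r) complex.Im (z i).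
Proof. exact: (raddf_sum (@complex.Im R : Rcomplex R -> R)). Qed.

(** Both components of the partial sums converge because their terms are
    dominated by [|x_i|^2 + |y_i|^2]. *)
Lemma dinner_exists (x y : dsum) : exists s, cvC finsets (psum_ip x y) s.
Proof.
have re (u v : dsum) : exists s : R,
    (fun A : {fset I} => \sum_(i <- A) rip (u i) (v i)) @ finsets --> s.
  have [[M uM] [K vK]] := (dvalP u, dvalP v).
  apply: (@psum_cvg_abs _ _ _ (fun i => hn (u i) ^+ 2 + hn (v i) ^+ 2) (M + K)).
    move=> i; apply: le_trans (rip_le _ _) _.
    by have := sqr_ge0 (hn (u i) - hn (v i));
      have := mulr_ge0 (hn_ge0 (u i)) (hn_ge0 (v i)); rewrite sqrrB; lra.
  by move=> A; rewrite big_split; exact: lerD (uM A) (vK A).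
have [[s sP] [t tP]] := (re x y, re x ('i *: y)).
exists (s +i* t); rewrite /psum_ip; split=> /=.
  by apply: cvg_ext sP => A; exact/esym/Re_sum.
by apply: cvg_ext tP => A; rewrite Im_sum; apply: eq_bigr => i _; rewrite ipE2.
Qed.

Definition dinner (x y : dsum) : R[i] := sval (cid (dinner_exists x y)).

Lemma dinnerP x y : cvC finsets (psum_ip x y) (dinner x y).
Proof. exact: svalP (cid (dinner_exists x y)). Qed.

Let dinner_bilinear : bilinear_for
  (GRing.Scale.Law.clone _ _ *%R _) (GRing.Scale.Law.clone _ _ (Num.conj \; *%R) _)
  dinner.
Proof.
split=> u a v w.
- apply: cvC_unique (@dinnerP _ _) _.
  apply: cvC_near (cvCD (cvCM a (@dinnerP v u)) (@dinnerP w u)).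
  apply: nearW => A; rewrite /psum_ip mulr_sumr -big_split /=.
  by apply: eq_bigr => i _; rewrite ipDl ipZl.
- apply: cvC_unique (@dinnerP _ _) _.
  apply: cvC_near (cvCD (cvCM (Num.conj a) (@dinnerP u v)) (@dinnerP u w)).
  apply: nearW => A; rewrite /psum_ip mulr_sumr -big_split /=.
  by apply: eq_bigr => i _; rewrite ipDr ipZr.
Qed.

HB.instance Definition _ := bilinear_isBilinear.Build R[i] dsum dsum R[i]
  *%R (Num.conj \; *%R) dinner dinner_bilinear.

Let dinner_herm u v : dinner u v = (-1) ^+ false * (dinner v u)^*%R.
Proof.
rewrite mul1r; apply: cvC_unique (@dinnerP _ _) _.
apply: cvC_near (cvC_conj (@dinnerP v u)).
apply: nearW => A; rewrite /psum_ip rmorph_sum.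
by apply: eq_bigr => i _; rewrite [RHS]ipC.
Qed.

HB.instance Definition _ := isHermitianSesquilinear.Build R[i] dsum
  false Num.conj dinner dinner_herm.

Definition dsq (x : dsum) : R := complex.Re (dinner x x).

Lemma dsqP (x : dsum) : sqsum x @ finsets --> dsq x.
Proof.
have [h _] := dinnerP x x; apply: cvg_trans h; apply: near_eq_cvg.
by apply: nearW => A; rewrite Re_sum; apply: eq_bigr => i _; exact: ripE.
Qed.

Lemma dinner_real (x : dsum) : dinner x x = (dsq x)%:C.
Proof.
have h : dinner x x = Num.conj (dinner x x).
  by rewrite {1}dinner_herm mul1r.
move: h; rewrite /dsq; case: (dinner x x) => a b /= [] h.
by apply/eqP; rewrite eq_complex eqxx /=; apply/eqP; lra.
Qed.

Lemma sqsum_le_dsq (x : dsum) A : sqsum x A <= dsq x.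
Proof.
apply: (cvgr_to_ge (@dsqP x)); have := near_finsets A; apply: filterS => B AB.
by apply: psum_mono => // i; exact: sqr_ge0.
Qed.

Lemma dsq_le (x : dsum) (M : R) : (forall A, sqsum x A <= M) -> dsq x <= M.
Proof. by move=> xM; apply: (cvgr_to_le (@dsqP x)); exact: nearW. Qed.

Lemma hn_le_dsq (x : dsum) i : hn (x i) ^+ 2 <= dsq x.
Proof. by have := sqsum_le_dsq x [fset i]%fset; rewrite /sqsum big_seq_fset1. Qed.

Lemma dsq_ge0 x : 0 <= dsq x.
Proof. by have := sqsum_le_dsq x fset0; rewrite /sqsum big_seq_fset0. Qed.

Lemma dsq_eq0 x : dsq x = 0 -> x = 0.
Proof.
move=> x0; apply: dsum_ext => i; apply: hn0_eq0; apply/eqP.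
by rewrite -sqrf_eq0 eq_le sqr_ge0 -{1}x0 hn_le_dsq.
Qed.

Let dinner_gt0 u : u != 0 -> 0 < dinner u u.
Proof.
move=> u0; rewrite dinner_real ltcR lt_neqAle dsq_ge0 andbT.
by apply: contraNneq u0 => /esym/dsq_eq0 ->.
Qed.

HB.instance Definition _ := isDotProduct.Build R[i] dsum dinner dinner_gt0.

Definition dnorm (x : dsum) : R[i] := (Num.sqrt (dsq x))%:C.

Let drip (x y : dsum) := complex.Re (dinner x y).

Let dsqD (t : R) (x y : dsum) :
  dsq (x + t%:C *: y) = dsq x + t ^+ 2 * dsq y + 2 * (t * drip x y).
Proof.
have e : dinner (x + t%:C *: y) (x + t%:C *: y) =
    dinner x x + (t ^+ 2)%:C * dinner y y + (t%:C * dinner x y + t%:C * Num.conj (dinner x y)).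
  have dl u v w : dinner (u + v) w = dinner u w + dinner v w by exact: (linearDl dinner).
  have dr u v w : dinner w (u + v) = dinner w u + dinner w v by exact: (linearDr dinner).
  have zl a u v : dinner (a *: u) v = a * dinner u v by exact: (linearZl_LR dinner).
  have zr a u v : dinner u (a *: v) = Num.conj a * dinner u v by exact: (linearZr_LR dinner).
  rewrite !(dl, dr, zl, zr).
  have -> : Num.conj t%:C = t%:C by exact: conjc_real.
  have -> : Num.conj (dinner x y) = dinner y x by rewrite [RHS]dinner_herm mul1r.
  by rewrite rmorphXn /=; ring.
rewrite /dsq e /drip; case: (dinner x x) (dinner y y) (dinner x y) => [a b] [c d] [f g] /=.
by rewrite !mul0r !subr0; ring.
Qed.

Let drip_le x y : drip x y <= Num.sqrt (dsq x) * Num.sqrt (dsq y).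
Proof.
have [y0|y0] := eqVneq (dsq y) 0.
  move/dsq_eq0: y0 => ->; rewrite /drip (linear0r dinner).
  by rewrite mulr_ge0 ?sqrtr_ge0.
have := dsq_ge0 (x + (- (drip x y / dsq y))%:C *: y).
have yp : 0 < dsq y by rewrite lt_neqAle eq_sym y0 dsq_ge0.
rewrite dsqD -sqrtrM ?dsq_ge0 // => h.
apply: le_trans (ler_norm _) _; rewrite -sqrtr_sqr ler_wsqrtr //.
rewrite -subr_ge0; have -> : dsq x * dsq y - drip x y ^+ 2 =
  dsq y * (dsq x + (- (drip x y / dsq y)) ^+ 2 * dsq y +
     2 * (- (drip x y / dsq y) * drip x y)) by field.
by rewrite mulr_ge0 // ltW.
Qed.

Let dnormD x y : dnorm (x + y) <= dnorm x + dnorm y.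
Proof.
rewrite /dnorm -rmorphD lecR -(ler_pXn2r (n := 2)) ?nnegrE ?addr_ge0 ?sqrtr_ge0 //.
rewrite sqr_sqrtr ?dsq_ge0 // sqrrD !sqr_sqrtr ?dsq_ge0 //.
have := dsqD 1 x y; rewrite rmorph1 scale1r => ->.
by have := drip_le x y; rewrite expr1n; lra.
Qed.

Let dnormZ (l : R[i]) x : dnorm (l *: x) = `|l| * dnorm x.
Proof.
have lr : `|l| = (complex.Re `|l|)%:C by rewrite RRe_real // ger0_real.
rewrite /dnorm [X in _ = X * _]lr -rmorphM; congr (_%:C).
have -> : dsq (l *: x) = complex.Re `|l| ^+ 2 * dsq x.
  apply: (cvg_unique _ (@dsqP _)) => //.
  apply: cvg_ext (cvgMl_tmp (a := complex.Re `|l| ^+ 2) (@dsqP x)) => A.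
  by rewrite /sqsum mulr_sumr; apply: eq_bigr => i _; rewrite hnZC exprMn.
rewrite sqrtrM ?sqr_ge0 // sqrtr_sqr ger0_norm //.
by rewrite -ler0c -lr.
Qed.

Let dnorm0 x : dnorm x = 0 -> x = 0.
Proof.
move=> [] /eqP; rewrite sqrtr_eq0 => x0; apply/dsq_eq0/eqP.
by rewrite eq_le x0 dsq_ge0.
Qed.

HB.instance Definition _ := Lmodule_isNormed.Build R[i] dsum dnormD dnormZ dnorm0.

Lemma dsum_normE (x : dsum) : `|x| = (Num.sqrt (dsq x))%:C.
Proof. by []. Qed.

Let dcomplete (F : set_system dsum) : ProperFilter F -> cauchy F -> cvg F.
Proof.
move=> FF /cauchyP Fc.
have {}Fc (e : R) : 0 < e -> exists x : dsum, \forall y \near F, dsq (x - y) < e.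
  move=> e0; have eC : 0 < (Num.sqrt e)%:C by rewrite ltcR sqrtr_gt0.
  have [x xP] := Fc _ eC; exists x; apply: filterS xP => y.
  by rewrite -ball_normE /= dsum_normE ltcR ltr_sqrt.
have /(_ _)/cid-/all_sig[l lP] i : exists l, cvH F (fun x : dsum => x i) l.
  apply: cvH_complete => e e0; have [x xP] := Fc (e ^+ 2) (exprn_gt0 2 e0).
  exists (x i); apply: filterS xP => y xy.
  rewrite -(ltr_pXn2r (n := 2)) ?nnegrE ?hn_ge0 ?(ltW e0) // hnB.
  exact: le_lt_trans (hn_le_dsq (x - y) i) xy.
(* Each coordinate has a limit; bounds on finitely many coordinates pass to
   it, uniformly in the finite set, and this gives both square summability and
   convergence in norm. *)
have near_l (x : dsum) (e : R) : (\forall y \near F, dsq (x - y) < e) ->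
    forall A, sqsum (fun i => x i - l i) A <= e.
  move=> xe A.
  have c : (fun y : dsum => sqsum (x - y) A) @ F --> sqsum (fun i => x i - l i) A.
    apply: cvg_seqsum => i.
    have h : hn (x i - (y : dsum) i) @[y --> F] --> hn (x i - l i).
      by apply: cvH_hn; apply: cvHB (lP i); exact: cvH_cst.
    have hh : hn (x i - (y : dsum) i) * hn (x i - y i) @[y --> F] -->
      hn (x i - l i) * hn (x i - l i) by apply: cvgM.
    by rewrite expr2; apply: cvg_ext hh => y; rewrite expr2.
  apply: (cvgr_to_le c).
  by apply: filterS xe => y /ltW; apply: le_trans; exact: sqsum_le_dsq.
have ls : sqsummable l.
  have [x /near_l xl] := Fc 1 ltr01; have [M xM] := dvalP x.
  exists (2 * M + 2 * 1) => A; apply: (@le_trans _ _ (2 * sqsum x A + 2 * sqsum (fun i => x i - l i) A)).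
    rewrite /sqsum !mulr_sumr -big_split; apply: ler_sum => i _ /=.
    rewrite (hnB (x i)) {1}(_ : l i = x i + (l i - x i)); last by rewrite addrC subrK.
    exact: hnD_sqr.
  by rewrite lerD // ler_pM2l.
apply/cvg_ex; exists (Dsum ls); apply/cvgrPdist_lt => e e0.
have er : e = (complex.Re e)%:C by rewrite RRe_real // gtr0_real.
have e0' : 0 < complex.Re e by rewrite -ltcR -er.
set d := complex.Re e in er e0'.
have [|x xP] := Fc (d ^+ 2 / 8); first by rewrite divr_gt0 ?exprn_gt0.
have xl := near_l _ _ xP.
apply: filterS xP => y xy; rewrite dsum_normE er ltcR.
rewrite -[ltRHS]ger0_norm ?(ltW e0') // -sqrtr_sqr ltr_sqrt ?exprn_gt0 //.
apply: (@le_lt_trans _ _ (2 * (d ^+ 2 / 8) + 2 * (d ^+ 2 / 8))); last first.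
  by have := exprn_gt0 2 e0'; lra.
apply: dsq_le => A.
apply: (@le_trans _ _ (2 * sqsum (fun i => x i - l i) A + 2 * sqsum (x - y) A)).
  rewrite /sqsum !mulr_sumr -big_split; apply: ler_sum => i _ /=.
  have -> : l i - y i = (l i - x i) + (x i - y i) by rewrite subrKA.
  by rewrite (hnB (x i) (l i)); exact: hnD_sqr.
by rewrite lerD // ler_pM2l //; apply: le_trans (sqsum_le_dsq _ _) (ltW xy).
Qed.

HB.instance Definition _ := Uniform_isComplete.Build dsum dcomplete.

Let dinner_norm (u : dsum) : `|u| ^+ 2 = dinner u u.
Proof. by rewrite dinner_real dsum_normE -rmorphXn sqr_sqrtr ?dsq_ge0. Qed.

Definition dsum_hilbert : hilbertType R := @Hilbert R dsum dinner dinner_norm.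

Lemma hn_dsum (x : dsum_hilbert) : hn x ^+ 2 = dsq x.
Proof. by rewrite -ripE. Qed.
End DirectSumHilbert.

(** * Direct sums of tuples *)

Section DirectSumTuple.
Variables (R : realType) (N : nat) (I : choiceType) (X : I -> cdd R N).
Local Notation D := (dsum (fun i => hspace (X i))).
Local Notation DH := (dsum_hilbert (fun i => hspace (X i))).

Lemma hn_coord (x : DH) i : hn ((x : D) i) <= hn x.
Proof.
by rewrite -(ler_pXn2r (n := 2)) ?nnegrE ?hn_ge0 // hn_dsum hn_le_dsq.
Qed.

Definition dsum_graph j : set (DH * DH) :=
  [set p | forall i, graph (op (X i) j) ((p.1 : D) i, (p.2 : D) i)].

Lemma dsum_graph_submod j : submod_closed (mem (dsum_graph j)).
Proof.
split=> [|a [x x'] [y y'] /set_mem Gx /set_mem Gy]; apply: mem_set => i /=.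
  exact: graph0.
by apply: graphD (Gy i); exact: graphZ (Gx i).
Qed.

Lemma dsum_graph_fun j (y : DH) : dsum_graph j (0, y) -> y = 0.
Proof. by move=> Gy; apply: dsum_ext => i; exact: graph_fun (Gy i). Qed.

Definition dsum_tuple : optuple R N :=
  Optuple (fun j => Operator (@dsum_graph_submod j) (@dsum_graph_fun j)).

Lemma finite_sqsummable (x : forall i, hspace (X i)) (A : {fset I}) :
  (forall i, i \notin A -> x i = 0) -> sqsummable x.
Proof.
move=> xA; exists (sqsum x A) => B; apply: psum_support => i.
  exact: sqr_ge0.
by move=> /xA ->; rewrite hn0 expr0n.
Qed.

Lemma dsum_is_cdd : is_cdd dsum_tuple.
Proof.
move=> j; split.
  apply/closed2P => x x' xG i; have [/closed2P cG _] := cddP (X i) j.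
  apply: cG => e /xG[y [y' [Gy h h']]]; exists ((y : D) i), ((y' : D) i); split.
  - exact: Gy.
  - exact: le_lt_trans (hn_coord (x - y) i) h.
  - exact: le_lt_trans (hn_coord (x' - y') i) h'.
apply/dense_hn => x e e0.
(* Outside a finite set A the vector x is negligible; on A its coordinates are
   approximated within the domains of the summands. *)
have [A xA] : exists A, dsq x - sqsum x A < e ^+ 2 / 4.
  have e4 : 0 < e ^+ 2 / 4 by rewrite divr_gt0 ?exprn_gt0.
  have /cvgrPdist_lt/(_ _ e4)/filter_ex[A h] := @dsqP _ _ _ x.
  by exists A; exact: le_lt_trans (ler_norm _) h.
pose d := e / (2 * (#|` A|.+1)%:R).
have d0 : 0 < d by rewrite divr_gt0 // mulr_gt0 ?ltr0n.
have /(_ _)/cid-/all_sig[y yP] i :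
    exists p, graph (op (X i) j) p /\ hn ((x : D) i - p.1) < d.
  have [_ /dense_hn/(_ ((x : D) i) _ d0)[_ [p Gp <-] xp]] := cddP (X i) j.
  by exists p.
pose z (i : I) := if i \in A then (y i).1 else 0.
pose z' (i : I) := if i \in A then (y i).2 else 0.
have zs : sqsummable z by apply: (finite_sqsummable (A := A)) => i /negPf iA; rewrite /z iA.
have zs' : sqsummable z' by apply: (finite_sqsummable (A := A)) => i /negPf iA; rewrite /z' iA.
exists (Dsum zs).
  exists (Dsum zs, Dsum zs') => // i /=; rewrite /z /z'; case: ifP => _.
    by case: (y i) (yP i) => ? ? [].
  exact: graph0.
rewrite -(ltr_pXn2r (n := 2)) ?nnegrE ?hn_ge0 ?(ltW e0) // hn_dsum.
apply: (@le_lt_trans _ _ (e ^+ 2 / 2)); last by have := exprn_gt0 2 e0; lra.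
have hA : sqsum (x - Dsum zs : D) A <= e ^+ 2 / 4.
  apply: (@le_trans _ _ (\sum_(i <- A) d ^+ 2)).
    rewrite /sqsum !big_seq; apply: ler_sum => i iA; rewrite ler_pXn2r ?nnegrE ?hn_ge0 ?(ltW d0) //.
    by apply: ltW; have [_] := yP i; rewrite /= /z iA.
  rewrite big_const_seq count_predT iter_addr addr0 -mulr_natr.
  have m0 : 0 < #|` A|.+1%:R :> R by rewrite ltr0n.
  have em : e = 2 * d * #|` A|.+1%:R.
    by rewrite /d; move: (_.+1%:R) m0 => m m0; field; rewrite gt_eqF.
  have nm : #|` A|%:R <= #|` A|.+1%:R ^+ 2 :> R.
    by rewrite -natrX ler_nat; apply: leq_trans (leqnSn _) _; rewrite leq_pmulr.
  have := ler_wpM2l (sqr_ge0 d) nm; rewrite em; lra.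
apply: dsq_le => B; apply: (@le_trans _ _ (sqsum (x - Dsum zs : D) (A `|` B)%fset)).
  by apply: psum_mono => [i|]; [exact: sqr_ge0|exact: fsubsetUr].
rewrite -(subrK (sqsum (x - Dsum zs : D) A) (sqsum _ (A `|` B)%fset)).
rewrite /sqsum psum_diff ?fsubsetUl // -/(sqsum _ A).
have : \sum_(i <- ((A `|` B) `\` A)%fset) hn ((x - Dsum zs : D) i) ^+ 2 <= e ^+ 2 / 4.
  have -> : \sum_(i <- ((A `|` B) `\` A)%fset) hn ((x - Dsum zs : D) i) ^+ 2 =
     \sum_(i <- ((A `|` B) `\` A)%fset) hn ((x : D) i) ^+ 2.
    rewrite !big_seq; apply: eq_bigr => i; rewrite !inE => /andP[/negPf iA _].
    by rewrite /= /z iA subr0.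
  rewrite -psum_diff ?fsubsetUl //; apply: le_trans (ltW xA); rewrite lerD2r.
  exact: sqsum_le_dsq.
by move: hA; lra.
Qed.

Definition dsum_cdd := Cdd dsum_is_cdd.

Section Injection.
Variable i : I.

Lemma inj_sqsummable (h : hspace (X i)) : sqsummable (@dfwith I (fun k => hspace (X k)) (fun=> 0) i h).
Proof.
apply: (@finite_sqsummable _ [fset i]%fset) => k.
by rewrite inE eq_sym => ki; rewrite dfwith_out.
Qed.

Definition dinj (h : hspace (X i)) : hspace dsum_cdd := Dsum (inj_sqsummable h).

Lemma dinj_adj (h : hspace (X i)) (x : hspace dsum_cdd) :
  inner _ (dinj h) x = inner _ h ((x : D) i).
Proof.
apply: cvC_unique (@dinnerP _ _ _ (dinj h) x) _.
apply: cvC_near (cvC_cst _); have := near_finsets [fset i]%fset.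
apply: filterS => A; rewrite fsub1set => iA.
rewrite /psum_ip (big_fsetD1 i) //= dfwith_in big1_seq ?addr0 // => k /=.
by rewrite !inE eq_sym => /andP[ki _]; rewrite dfwith_out // ip0l.
Qed.

Lemma dinj_graph j x x' : graph (op (X i) j) (x, x') ->
  graph (op dsum_cdd j) (dinj x, dinj x').
Proof.
move=> xx' k /=; case: (eqVneq i k) => [<-|ik]; first by rewrite !dfwith_in.
rewrite !dfwith_out //; exact: graph0.
Qed.

Definition dinj_hom : hom (X i) dsum_cdd :=
  @Hom R N (X i) dsum_cdd _ _ dinj_adj dinj_graph (fun j x x' h => h i).
End Injection.
End DirectSumTuple.

(** * Orthogonal families of embeddings *)

Section Families.
Variables (R : realType) (N : nat).
Implicit Types X Y Z : cdd R N.

Definition orthofam (I : Type) (X : I -> cdd R N) Z (V : forall i, hom (X i) Z) :=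
  (forall i, isometric (V i)) /\
  (forall i j x, i <> j -> bwd (V j) (fwd (V i) x) = 0).

Definition total (I : Type) (X : I -> cdd R N) Z (V : forall i, hom (X i) Z) :=
  forall z, (forall i, bwd (V i) z = 0) -> z = 0.

Definition sumof (I : Type) (X : I -> cdd R N) Z :=
  exists2 V : forall i, hom (X i) Z, orthofam V & total V.

Lemma sumof_exists (I : Type) (X : I -> cdd R N) : exists Z, sumof X Z.
Proof.
exists (dsum_cdd (X : {classic I} -> cdd R N)).
exists (@dinj_hom R N {classic I} X); first split.
- by move=> i x /=; rewrite dfwith_in.
- by move=> i j x; have [//|ij _] := @eqVneq {classic I} i j; rewrite /= dfwith_out.
- by move=> z z0; apply: dsum_ext => i; exact: z0.
Qed.

Section Glue.
Variables (I : Type) (X : I -> cdd R N) (Y Z : cdd R N).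
Variables (V : forall i, hom (X i) Z) (W : forall i, hom (X i) Y).
Hypotheses (oV : orthofam V) (oW : orthofam W).
Local Notation J := {classic I}.

Lemma pythagoras (s : seq J) (u : forall i, hspace (X i)) : uniq s ->
  hn (\sum_(i <- s) fwd (W i) (u i)) ^+ 2 = \sum_(i <- s) hn (u i) ^+ 2.
Proof.
have [iW dW] := oW; elim: s => [|i s IH]; first by rewrite !big_nil hn0 expr0n.
rewrite /= => /andP[si us]; rewrite !big_cons hnDE IH // isometric_hn //.
rewrite rip_adj (_ : bwd _ _ = 0) ?/rip ?ip0r ?mulr0 ?addr0 //.
elim: s si {IH us} => [|k s IH]; first by rewrite big_nil bwd0.
rewrite inE negb_or eq_sym => /andP[/eqP ik /IH h].
by rewrite big_cons bwdD h addr0 dW.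
Qed.

Lemma bessel (A : {fset J}) z :
  \sum_(i <- A) hn (bwd (W i) z) ^+ 2 <= hn z ^+ 2.
Proof.
have := sqr_ge0 (hn (z - \sum_(i <- A) fwd (W i) (bwd (W i) z))).
rewrite hnBE pythagoras ?fset_uniq //.
suff -> : rip z (\sum_(i <- A) fwd (W i) (bwd (W i) z)) =
   \sum_(i <- A) hn (bwd (W i) z) ^+ 2 by lra.
elim: (enum_fset A) => [|i s IH]; first by rewrite !big_nil /rip ip0r.
by rewrite !big_cons ripDr IH ripC rip_adj ripE.
Qed.

Fixpoint sumh (s : seq J) : hom Z Y :=
  if s is i :: s' then addh (comph (W i) (dual (V i))) (sumh s') else zeroh Z Y.

Lemma sumhE s z : fwd (sumh s) z = \sum_(i <- s) fwd (W i) (bwd (V i) z).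
Proof. by elim: s => [|i s IH] /=; rewrite ?big_nil ?big_cons ?IH. Qed.

Lemma sumhE' s y : bwd (sumh s) y = \sum_(i <- s) fwd (V i) (bwd (W i) y).
Proof. by elim: s => [|i s IH] /=; rewrite ?big_nil ?big_cons ?IH. Qed.
End Glue.

(** The increments of the partial sums have the norm of the increments of the
    Bessel sums of [z], which form a bounded increasing net. *)
Lemma glue_cvg (I : Type) (X : I -> cdd R N) Y Z
    (V : forall i, hom (X i) Z) (W : forall i, hom (X i) Y) :
  orthofam V -> orthofam W -> forall z, exists y,
  cvH finsets (fun A : {fset {classic I}} => fwd (sumh V W A) z) y.
Proof.
move=> oV oW z; apply: cvH_complete => e e0.
have [||s [sP _ sub]] := @psum_cvg _ _ (fun i : {classic I} => hn (bwd (V i) z) ^+ 2) (hn z ^+ 2).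
- by move=> i; exact: sqr_ge0.
- by move=> A; exact: (bessel oV).
have /cvgrPdist_lt/(_ _ (exprn_gt0 2 e0))/filter_ex[A sA] := sP.
exists (fwd (sumh V W A) z); have := near_finsets A; apply: filterS => B AB.
rewrite -(ltr_pXn2r (n := 2)) ?nnegrE ?hn_ge0 ?(ltW e0) //.
rewrite !sumhE psum_diff // (pythagoras oW) ?fset_uniq // -psum_diff //.
by apply: le_lt_trans (le_lt_trans (ler_norm _) sA); rewrite lerD2r.
Qed.

(** Two orthogonal families of embeddings of the same objects are carried to
    each other by a partial isometry, the strong sum of the [W_i V_i^*]; the
    Bessel inequality makes the partial sums, and those of the adjoints,
    converge. *)
Lemma glue (I : Type) (X : I -> cdd R N) Y Z
    (V : forall i, hom (X i) Z) (W : forall i, hom (X i) Y) :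
  orthofam V -> orthofam W -> exists T : hom Z Y,
  [/\ forall i x, fwd T (fwd (V i) x) = fwd (W i) x,
      forall i x, bwd T (fwd (W i) x) = fwd (V i) x,
      forall z, (forall i, bwd (V i) z = 0) -> fwd T z = 0 &
      forall y, (forall i, bwd (W i) y = 0) -> bwd T y = 0].
Proof.
move=> oV oW.
have [f fP] := choice (glue_cvg oV oW).
have [g gP] := choice (glue_cvg oW oV).
have gP' y : cvH finsets (fun A : {fset {classic I}} => bwd (sumh V W A) y) (g y).
  by apply: cvH_near (gP y); apply: nearW => A; rewrite sumhE sumhE'.
have [T [Tf Tg]] := hom_lim fP gP'.
have main (X' Y' : cdd R N) (V' : forall i, hom (X i) X') (W' : forall i, hom (X i) Y') :
    orthofam V' -> forall i x, cvH finsets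
    (fun A : {fset {classic I}} => fwd (sumh V' W' A) (fwd (V' i) x)) (fwd (W' i) x).
  move=> [iV dV] i x; apply: cvH_near (cvH_cst _).
  have := near_finsets ([fset (i : {classic I})]%fset); apply: filterS => A.
  rewrite fsub1set => iA; rewrite sumhE (big_fsetD1 (i : {classic I})) //= iV big1_seq ?addr0 // => k /=.
  by rewrite !inE eq_sym => /andP[/eqP ki _]; rewrite dV // fwd0.
have zero (X' Y' : cdd R N) (V' : forall i, hom (X i) X') (W' : forall i, hom (X i) Y') z :
    (forall i, bwd (V' i) z = 0) -> cvH finsets
    (fun A : {fset {classic I}} => fwd (sumh V' W' A) z) 0.
  move=> z0; apply: cvH_near (cvH_cst _); apply: nearW => A.
  by rewrite sumhE big1_seq // => i _; rewrite z0 fwd0.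
exists T; split.
- by move=> i x; rewrite Tf; apply: cvH_unique (fP _) _; exact: main.
- by move=> i x; rewrite Tg; apply: cvH_unique (gP _) _; exact: main.
- by move=> z z0; rewrite Tf; apply: cvH_unique (fP _) _; exact: zero.
- by move=> z z0; rewrite Tg; apply: cvH_unique (gP _) _; exact: zero.
Qed.

(** By duality [V_i^* T^* T = W_i^* T = V_i^*], so that [T^* T z] and [z] have the
    same coordinates. *)
Lemma glue_isometric (I : Type) (X : I -> cdd R N) Y Z
    (V : forall i, hom (X i) Z) (W : forall i, hom (X i) Y) (T : hom Z Y) :
  orthofam W -> total V ->
  (forall i x, fwd T (fwd (V i) x) = fwd (W i) x) ->
  (forall i x, bwd T (fwd (W i) x) = fwd (V i) x) -> isometric T.
Proof.
move=> [iW _] tV TV TW z; apply/subr0_eq/tV => i.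
have e1 y : bwd (V i) (bwd T y) = bwd (W i) y.
  by apply: (@bwd_ext _ _ _ _ (comph T (V i)) (W i)) => x /=.
have e2 y : bwd (W i) (fwd T y) = bwd (V i) y.
  by apply: (@bwd_ext _ _ _ _ (comph (dual T) (W i)) (V i)) => x /=.
by rewrite bwdB e1 e2 subrr.
Qed.

Lemma sumof_unique (I : Type) (X : I -> cdd R N) Y Z :
  sumof X Z -> sumof X Y -> iso Z Y.
Proof.
move=> [V oV tV] [W oW tW]; have [T [TV TW _ _]] := glue oV oW.
exists T; first exact: glue_isometric oW tV TV TW.
exact: (glue_isometric (T := dual T) oV tW).
Qed.

End Families.

(** * Square roots of positive intertwiners *)

Section SquareRoots.
Variables (R : realType) (N : nat).
Implicit Types X Y Z : cdd R N.

Lemma rip_ext (H : hilbertType R) (x y : H) : (forall z, rip x z = rip y z) -> x = y.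
Proof.
move=> xy; apply/subr0_eq/hn0_eq0/eqP.
by rewrite -sqrf_eq0 -ripE ripBl xy subrr.
Qed.

Definition contraction X Y (T : hom X Y) := forall x, hn (fwd T x) <= hn x.

Lemma contraction_dual X Y (T : hom X Y) : contraction T -> contraction (dual T).
Proof.
move=> cT y /=; have [->|y0] := eqVneq (hn (bwd T y)) 0; first exact: hn_ge0.
have p : 0 < hn (bwd T y) by rewrite lt_neqAle eq_sym y0 hn_ge0.
rewrite -(ler_pM2l p) -expr2 -ripE -rip_adj.
apply: le_trans (ler_norm _) (le_trans (rip_le _ _) _).
by rewrite ler_wpM2r ?hn_ge0.
Qed.

Section SquareRoot.
Variables (X Y : cdd R N) (T : hom X Y).
Hypothesis cT : contraction T.

(** [1 - T^* T]; the square root of [T^* T] is found as [1 - r], where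
    [(1 - r)^2 = 1 - defect]. *)
Definition defect : hom X X := subh (idh X) (comph (dual T) T).

Lemma defectE x : fwd defect x = x - bwd T (fwd T x).
Proof. by rewrite subhE. Qed.

Lemma defect_sa x : bwd defect x = fwd defect x.
Proof. by rewrite subhE subhE'. Qed.

Lemma defect_contraction : contraction defect.
Proof.
move=> x; rewrite -(ler_pXn2r (n := 2)) ?nnegrE ?hn_ge0 // defectE hnBE.
rewrite -rip_adj ripE.
have h : hn (bwd T (fwd T x)) ^+ 2 <= hn (fwd T x) ^+ 2.
  by rewrite ler_pXn2r ?nnegrE ?hn_ge0 //; exact: (contraction_dual cT).
by have := sqr_ge0 (hn (fwd T x)); lra.
Qed.

(** With [b] the defect, the iteration [r <- (b + r^2) / 2] converges to a solution
    of [(1 - r)^2 = 1 - b]; [rho] is its scalar instance [b = 1], which controls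
    the operator one in norm. *)
Fixpoint root_iter n : hom X X := if n is n'.+1
  then scaleh 2^-1 (addh defect (comph (root_iter n') (root_iter n')))
  else zeroh X X.

Fixpoint rho n : R := if n is n'.+1 then (1 + rho n' ^+ 2) / 2 else 0.

Lemma rho_ge0 n : 0 <= rho n.
Proof. by elim: n => //= n IH; rewrite divr_ge0 // addr_ge0 ?sqr_ge0. Qed.

Lemma rho_le1 n : rho n <= 1.
Proof.
elim: n => [|n IH] /=; first exact: ler01.
have : rho n ^+ 2 <= 1 by rewrite expr_le1 ?rho_ge0.
by lra.
Qed.

Lemma rho_mono n : rho n <= rho n.+1.
Proof. by have := sqr_ge0 (1 - rho n); rewrite /= sqrrB; lra. Qed.

Lemma root_iterS n x : fwd (root_iter n.+1) x =
  (2^-1)%:C *: (fwd defect x + fwd (root_iter n) (fwd (root_iter n) x)).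
Proof. by []. Qed.

Lemma root_iter_sa n x : bwd (root_iter n) x = fwd (root_iter n) x.
Proof.
elim: n x => [//|n IH] x; rewrite root_iterS -defect_sa.
by rewrite -!IH.
Qed.

Lemma root_iter_le n x : hn (fwd (root_iter n) x) <= rho n * hn x.
Proof.
elim: n x => [|n IH] x; first by rewrite /= hn0 mul0r.
rewrite root_iterS hnZ ger0_norm ?invr_ge0 // /=.
have := ler_hnD (fwd defect x) (fwd (root_iter n) (fwd (root_iter n) x)).
have := defect_contraction x.
have := le_trans (IH (fwd (root_iter n) x)) (ler_wpM2l (rho_ge0 n) (IH x)).
rewrite mulrA -expr2; lra.
Qed.
End SquareRoot.

(** Each iterate is a polynomial in the defect. *)
Lemma root_iter_comm X Y X' Y' (T : hom X Y) (T' : hom X' Y') (C : hom X X') n x :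
  (forall x, fwd (defect T') (fwd C x) = fwd C (fwd (defect T) x)) ->
  fwd (root_iter T' n) (fwd C x) = fwd C (fwd (root_iter T n) x).
Proof.
move=> h; elim: n x => [|n IH] x; first by rewrite /= fwd0.
by rewrite !root_iterS !IH h -fwdD -fwdZ.
Qed.

Section SquareRootLimit.
Variables (X Y : cdd R N) (T : hom X Y).
Hypothesis cT : contraction T.
Local Notation r := (root_iter T).

Lemma root_iterC m n x : fwd (r m) (fwd (r n) x) = fwd (r n) (fwd (r m) x).
Proof.
apply: root_iter_comm => z; apply/esym.
by apply: (@root_iter_comm _ _ _ _ T T (defect T)).
Qed.

(** Consecutive iterates differ by [(r_n - r_(n-1)) (r_n + r_(n-1)) / 2], because
    they commute; the scalar iteration satisfies the same identity. *)
Lemma root_iter_step n x :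
  hn (fwd (r n.+1) x - fwd (r n) x) <= (rho n.+1 - rho n) * hn x.
Proof.
elim: n x => [|n IH] x.
  rewrite root_iterS /= subr0 addr0 hnZ ger0_norm ?invr_ge0 //.
  by rewrite expr0n /= addr0 subr0 mul1r ler_pM2l ?invr_gt0 //; exact: defect_contraction.
have -> : fwd (r n.+2) x - fwd (r n.+1) x = (2^-1)%:C *:
   (fwd (r n.+1) (fwd (r n.+1) x + fwd (r n) x) -
    fwd (r n) (fwd (r n.+1) x + fwd (r n) x)).
  rewrite (root_iterS T n.+1) [in X in _ - X](root_iterS T n) -scalerBr.
  congr (_ *: _); rewrite !fwdD (root_iterC n.+1 n).
  by rewrite opprD addrACA subrr add0r opprD addrA addrK.
rewrite hnZ ger0_norm ?invr_ge0 //.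
have := IH (fwd (r n.+1) x + fwd (r n) x).
have := ler_hnD (fwd (r n.+1) x) (fwd (r n) x).
have := root_iter_le cT n.+1 x; have := root_iter_le cT n x.
have d0 : 0 <= rho n.+1 - rho n by rewrite subr_ge0 rho_mono.
set a := hn (_ + _); set b := hn (_ - _) => h1 h2 h3 h4.
have : a <= (rho n.+1 + rho n) * hn x by lra.
move/(ler_wpM2l d0).
have -> : rho n.+2 - rho n.+1 = (rho n.+1 - rho n) * (rho n.+1 + rho n) / 2.
  have e m : rho m.+1 = (1 + rho m ^+ 2) / 2 by [].
  by rewrite (e n.+1) [X in _ - X](e n); field.
by move: h4; move: (rho n.+1) (rho n) => p q; lra.
Qed.

Lemma root_iter_cauchy n k x :
  hn (fwd (r (n + k)) x - fwd (r n) x) <= (rho (n + k) - rho n) * hn x.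
Proof.
elim: k => [|k IH]; first by rewrite addn0 !subrr hn0 mul0r.
rewrite addnS -(subrKA (fwd (r (n + k)) x)).
apply: le_trans (ler_hnD _ _) _.
have := root_iter_step (n + k) x; move: IH.
by move: (rho (n + k).+1) => p; lra.
Qed.

Lemma root_iter_cvg x : exists y, cvH \oo (fun n => fwd (r n) x) y.
Proof.
have rc : cvgn (rho).
  apply: nondecreasing_is_cvgn; first by apply/nondecreasing_seqP; exact: rho_mono.
  by exists 1 => _ [n _ <-]; exact: rho_le1.
apply: cvH_complete => e e0.
have e0' : 0 < e / (hn x + 1) by rewrite divr_gt0 // ltr_wpDl ?hn_ge0.
have /cvgrPdist_lt/(_ _ e0')[n _ nP] := rc.
exists (fwd (r n) x); exists n => // m /= nm.
rewrite -(subnKC nm); apply: le_lt_trans (root_iter_cauchy _ _ _) _.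
have ub k : rho k <= limn (rho).
  by apply: nondecreasing_cvgn_le => //; apply/nondecreasing_seqP; exact: rho_mono.
have /= := nP _ (leqnn n); rewrite ger0_norm ?subr_ge0 ?ub // => ne.
have le : rho (n + (m - n)) - rho n < e / (hn x + 1).
  by apply: le_lt_trans ne; rewrite lerD2r.
move: le; rewrite ltr_pdivlMr ?ltr_wpDl ?hn_ge0 //; apply: le_lt_trans.
rewrite ler_wpM2l ?lerDl // subr_ge0.
by apply: (@nondecreasing_seqP _ R (rho)).1 => //; [exact: rho_mono|exact: leq_addr].
Qed.

Lemma root_exists : exists S : hom X X,
  forall x, cvH \oo (fun n => fwd (r n) x) (fwd S x).
Proof.
have [f fP] := choice root_iter_cvg.
have fP' x : cvH \oo (fun n => bwd (r n) x) (f x).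
  by apply: cvH_near (fP x); apply: nearW => n; rewrite root_iter_sa.
by have [S [Sf _]] := hom_lim fP fP'; exists S => x; rewrite Sf.
Qed.

Definition root : hom X X := sval (cid root_exists).

Lemma rootP x : cvH \oo (fun n => fwd (r n) x) (fwd root x).
Proof. exact: svalP (cid root_exists) x. Qed.

End SquareRootLimit.
End SquareRoots.

(** * Polar decomposition *)

Section PartialIsometry.
Variables (R : realType) (N : nat).
Implicit Types X Y Z : cdd R N.

Lemma cvH_sub (H : hilbertType R) (u : nat -> H) l (p : nat -> nat) :
  (forall n, (n <= p n)%N) -> cvH \oo u l -> cvH \oo (fun n => u (p n)) l.
Proof.
move=> np /cvHP ul; apply/cvHP => e /ul[n _ nP]; exists n => // m /= nm.
by apply: nP => /=; exact: leq_trans (np m).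
Qed.

(** Identities between operators pass to strong limits after pairing: an inner
    product of two convergent sequences converges. *)
Lemma cvH_rip_unique (H K : hilbertType R) (u v : nat -> H) (w z : nat -> K) a b c d :
  cvH \oo u a -> cvH \oo v b -> cvH \oo w c -> cvH \oo z d ->
  (forall n, rip (u n) (v n) = rip (w n) (z n)) -> rip a b = rip c d.
Proof.
move=> ua vb wc zd e; apply: cvg_unique (cvH_rip ua vb) _ => //.
by apply: cvg_ext (cvH_rip wc zd) => n; rewrite e.
Qed.

Section Root.
Variables (X Y : cdd R N) (T : hom X Y).
Hypothesis cT : contraction T.
Local Notation s := (root cT).

Lemma root_sa x : bwd s x = fwd s x.
Proof.
apply: ip_ext => z; rewrite hom_adjC; apply/esym.
apply: (cvH_ip_eq (rootP cT x) (rootP cT z)) => n.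
by rewrite hom_adj root_iter_sa.
Qed.

Lemma rip_root x y : rip (fwd s x) y = rip x (fwd s y).
Proof. by rewrite rip_adj root_sa. Qed.

Lemma root_contraction x : hn (fwd s x) <= hn x.
Proof.
apply: (cvgr_to_le (cvH_hn (rootP cT x))); apply: nearW => n.
apply: le_trans (root_iter_le cT n x) _.
by rewrite -[leRHS]mul1r ler_wpM2r ?hn_ge0 // rho_le1.
Qed.

(** The limit form of [2 r_(n+1) = defect + r_n^2]. *)
Lemma root_sqr x : fwd s (fwd s x) = 2%:C *: fwd s x - fwd (defect T) x.
Proof.
apply: rip_ext => y; rewrite rip_root.
apply: (cvH_rip_unique (rootP cT x) (rootP cT y) _ (cvH_cst y)).
  apply: cvHB (cvH_cst (fwd (defect T) x)).
  apply: cvHZ; exact: (cvH_sub _ (rootP cT x) (p := succn)).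
move=> n; rewrite -[fwd (root_iter T n) y]root_iter_sa -rip_adj root_iterS.
by rewrite scalerA -rmorphM divff // rmorph1 scale1r addrC addKr.
Qed.

(** The modulus [|T|] of [T], as a square root of [T^* T]; the fact [root_neg] on
    [s] takes the place of positivity. *)
Definition absh : hom X X := subh (idh X) s.

Lemma abshE x : fwd absh x = x - fwd s x.
Proof. by rewrite subhE. Qed.

Lemma absh_sa x : bwd absh x = fwd absh x.
Proof. by rewrite subhE' abshE root_sa. Qed.

Lemma absh_sqr x : fwd absh (fwd absh x) = bwd T (fwd T x).
Proof.
rewrite !abshE fwdB root_sqr defectE.
rewrite (_ : 2%:C = 1 + 1 :> R[i]); last by rewrite -rmorphD.
by rewrite scalerDl scale1r opprB (addrAC (_ + _)) addrK subrKA opprB addrC subrK.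
Qed.

Lemma absh_hn x : hn (fwd absh x) = hn (fwd T x).
Proof.
apply/eqP; rewrite -(eqrXn2 (n := 2)) ?hn_ge0 // -!ripE.
by rewrite rip_adj absh_sa absh_sqr -rip_adj.
Qed.

Fixpoint powh n : hom X X := if n is n'.+1 then comph s (powh n') else idh X.

Lemma powhD m n x : fwd (powh (m + n)) x = fwd (powh m) (fwd (powh n) x).
Proof. by elim: m => //= m ->. Qed.

Lemma powh_sa n x y : rip (fwd (powh n) x) y = rip x (fwd (powh n) y).
Proof.
elim: n x y => // n IH x y.
have -> : fwd (powh n.+1) y = fwd (powh n) (fwd s y) by rewrite -addn1 powhD.
by rewrite -IH -rip_root.
Qed.

Lemma rip_powh m n x y : rip (fwd (powh m) x) (fwd (powh n) y) = rip (fwd (powh (m + n)) x) y.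
Proof. by rewrite addnC powhD [RHS]powh_sa. Qed.

(** Polynomials [q_n] in [s] with [(1 - s) q_n = 1 - s^(2n)]. As the even powers
    of [s] converge to the projection onto the kernel of [|T| = 1 - s], the
    operators [T q_n] converge to the partial isometry in [T = U |T|]. *)
Definition quoth := fix quoth n : hom X X := if n is n'.+1
  then addh (comph (quoth n') (powh 2)) (addh (idh X) s) else zeroh X X.

Lemma absh_quoth n x : fwd absh (fwd (quoth n) x) = x - fwd (powh (n + n)) x.
Proof.
elim: n x => [|n IH] x.
  by transitivity (0 : hspace X); [exact: fwd0|exact/esym/subrr].
rewrite [fwd (quoth _) _]/= fwdD IH.
have -> : fwd absh (x + fwd s x) = x - fwd s (fwd s x).
  by rewrite abshE fwdD opprD addrA addrK.
by rewrite addSn addnS -addn2 (powhD (n + n) 2) addrC subrKA.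
Qed.

Lemma powh_le n x : hn (fwd (powh n.+1) x) <= hn (fwd (powh n) x).
Proof. exact: root_contraction. Qed.

(** The norms [|s^n x|] decrease, and [|s^(2n) x - s^(2m) x|^2] is a combination
    of their squares that vanishes in the limit. *)
Lemma powh_cvg x : exists y, cvH \oo (fun n => fwd (powh (n + n)) x) y.
Proof.
pose tau n := hn (fwd (powh n) x) ^+ 2.
have tau_dec : nonincreasing_seq tau.
  apply/nonincreasing_seqP => n; rewrite /tau ler_pXn2r ?nnegrE ?hn_ge0 //.
  exact: powh_le.
have tc : cvgn tau.
  by apply: nonincreasing_is_cvgn => //; exists 0 => _ [n _ <-]; exact: sqr_ge0.
have lb n : limn tau <= tau n by exact: nonincreasing_cvgn_ge.
apply: cvH_complete => e e0.
have e2 : 0 < e ^+ 2 / 2 by rewrite divr_gt0 ?exprn_gt0.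
have /cvgrPdist_lt/(_ _ e2)[n _ nP] := tc.
have close m : (n <= m)%N -> tau m < limn tau + e ^+ 2 / 2.
  by move=> /nP; rewrite /= distrC ger0_norm ?subr_ge0 ?lb // ltrBlDl.
exists (fwd (powh (n + n)) x); exists n => // m /= nm.
rewrite -(ltr_pXn2r (n := 2)) ?nnegrE ?hn_ge0 ?(ltW e0) // hnBE rip_powh.
have -> : rip (fwd (powh (m + m + (n + n))) x) x = tau (m + n)%N.
  by rewrite addnACA -rip_powh ripE.
have := close _ (leq_addl n n); have := close _ (leq_trans nm (leq_addl m m)).
by have := lb (m + n)%N; rewrite -/(tau _) -/(tau _); lra.
Qed.

(** [T] and [|T|] have the same norms, so the increments are those of the even
    powers of [s]. *)
Lemma polar_cvg x : exists y, cvH \oo (fun n => fwd T (fwd (quoth n) x)) y.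
Proof.
have [l /cvHP lP] := powh_cvg x.
apply: cvH_complete => e e0; have /lP[n _ nP] : 0 < e / 2 by lra.
exists (fwd T (fwd (quoth n) x)); exists n => // m nm.
rewrite -fwdB -absh_hn fwdB !absh_quoth opprB addrC subrKA.
have := nP _ nm; have := nP n (leqnn n) => /=.
rewrite -(subrKA l (fwd _ _)) => h1 h2; apply: le_lt_trans (ler_hnD _ _) _.
by rewrite (hnB l); lra.
Qed.

Definition powlim (x : hspace X) : hspace X := sval (cid (powh_cvg x)).

Lemma powlimP x : cvH \oo (fun n => fwd (powh (n + n)) x) (powlim x).
Proof. exact: svalP (cid (powh_cvg x)). Qed.

Lemma powlim_sa x y : rip (powlim x) y = rip x (powlim y).
Proof.
apply: (cvH_rip_unique (powlimP x) (cvH_cst y) (cvH_cst x) (powlimP y)) => n.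
exact: powh_sa.
Qed.

Lemma powlim_idem x : powlim (powlim x) = powlim x.
Proof.
apply: rip_ext => y; rewrite powlim_sa.
apply: (cvH_rip_unique (powlimP x) (powlimP y) _ (cvH_cst y)).
  apply: (cvH_sub _ (powlimP x) (p := fun n => n + n)%N) => n; exact: leq_addl.
by move=> n; rewrite rip_powh.
Qed.

(** [-1] is not an eigenvalue of [s]: there the defect would act as [-3], and it is
    a contraction. *)
Lemma root_neg w : fwd s w = - w -> w = 0.
Proof.
move=> sw; have h := root_sqr w; rewrite sw fwdN sw opprK in h.
have := defect_contraction cT w.
have -> : fwd (defect T) w = 2%:C *: (- w) - w.
  by rewrite [X in _ = _ - X]h opprB [RHS]addrC subrK.
have -> : 2%:C *: (- w) - w = - (3%:C *: w).
  rewrite scalerN -opprD -{2}(scale1r w) -scalerDl; congr (- (_ *: _)).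
  by rewrite -(rmorph1 (real_complex R)) -rmorphD; congr (_%:C); lra.
rewrite hnN hnZ ger0_norm // => wle; apply/hn0_eq0/eqP.
by rewrite eq_le hn_ge0 andbT; lra.
Qed.

Lemma powlim_root x : fwd s (powlim x) = powlim x.
Proof.
have e : fwd s (fwd s (powlim x)) = powlim x.
  apply: rip_ext => y; rewrite !rip_root.
  apply: (cvH_rip_unique (powlimP x) (cvH_cst _) _ (cvH_cst y)).
    exact: (cvH_sub _ (powlimP x) (p := succn)).
  by move=> n; rewrite -!rip_root addSn addnS.
by apply/subr0_eq/root_neg; rewrite fwdB e opprB.
Qed.

Lemma powlim_ker x : fwd T x = 0 <-> powlim x = x.
Proof.
have k z : fwd T z = 0 <-> fwd s z = z.
  split=> [Tz|sz].
    by apply/esym/subr0_eq/hn0_eq0; rewrite -abshE absh_hn Tz hn0.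
  by apply: hn0_eq0; rewrite -absh_hn abshE sz subrr hn0.
rewrite k; split=> [sx|<-]; last exact: powlim_root.
apply: cvH_unique (powlimP x) _; apply: cvH_near (cvH_cst x).
by apply: nearW => n; elim: (n + n)%N => //= m <-; rewrite sx.
Qed.
End Root.

Section RootComm.
Variables (X Y X' Y' : cdd R N) (T : hom X Y) (T' : hom X' Y') (C : hom X X').
Hypotheses (cT : contraction T) (cT' : contraction T').

Lemma root_comm x :
  (forall x, fwd (defect T') (fwd C x) = fwd C (fwd (defect T) x)) ->
  fwd (root cT') (fwd C x) = fwd C (fwd (root cT) x).
Proof.
move=> h; apply: rip_ext => y; rewrite [RHS]rip_adj.
apply: (cvH_rip_unique (rootP cT' _) (cvH_cst y) (rootP cT x) (cvH_cst _)) => n.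
by rewrite -rip_adj (root_iter_comm n x h).
Qed.

Hypothesis rC : forall x, fwd (root cT') (fwd C x) = fwd C (fwd (root cT) x).

Lemma quoth_comm n x : fwd (quoth cT' n) (fwd C x) = fwd C (fwd (quoth cT n) x).
Proof.
elim: n x => [|n IH] x; first by rewrite /= fwd0.
by rewrite /= !rC IH !fwdD.
Qed.
End RootComm.

Lemma quoth_sa X Y (T : hom X Y) (cT : contraction T) n x :
  bwd (quoth cT n) x = fwd (quoth cT n) x.
Proof.
elim: n x => [//|n IH] x; rewrite /= IH !root_sa.
by rewrite -!(@quoth_comm _ _ _ _ _ _ (root cT) cT cT).
Qed.

(** [U^* U] is the projection onto the complement of the kernel of [T]. *)
Lemma polar_half X Y (T : hom X Y) (cT : contraction T) (U : hom X Y) :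
  (forall x, cvH \oo (fun n => fwd T (fwd (quoth cT n) x)) (fwd U x)) ->
  (forall x, fwd U (bwd U (fwd U x)) = fwd U x) /\
  (forall x, fwd U x = 0 <-> fwd T x = 0).
Proof.
move=> UP.
have UU x : bwd U (fwd U x) = x - powlim cT x.
  apply: rip_ext => y; rewrite [LHS]ripC -rip_adj ripC.
  have -> : rip (x - powlim cT x) y = rip (x - powlim cT x) (y - powlim cT y).
    rewrite [RHS]ripBr -(powlim_sa cT (x - _) y).
    have -> : powlim cT (x - powlim cT x) = 0; last by rewrite /rip ip0l subr0.
    apply: rip_ext => z; rewrite powlim_sa ripBl (powlim_sa cT x (powlim cT z)) powlim_idem.
    by rewrite subrr /rip ip0l.
  apply: (cvH_rip_unique (UP x) (UP y) (cvHB (cvH_cst x) (powlimP cT x))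
    (cvHB (cvH_cst y) (powlimP cT y))) => n.
  by rewrite -!absh_quoth [LHS]rip_adj -(absh_sqr cT) -(absh_sa cT (fwd (absh cT) _)) -rip_adj.
have U0 x : fwd U x = 0 <-> powlim cT x = x.
  split=> [Ux|px]; first by apply/esym/subr0_eq; rewrite -UU Ux bwd0.
  by apply: ip_eq0; rewrite hom_adj UU px subrr ip0r.
split=> x; last exact: iff_trans (U0 x) (iff_sym (powlim_ker cT x)).
apply/esym/subr0_eq; rewrite -fwdB; apply/U0.
by rewrite UU opprB addrC subrK powlim_idem.
Qed.

(** The adjoints of the approximants [T q_n] are the approximants of [T^*], because
    [T] intertwines the square roots that belong to [T] and to [T^*]; hence both
    converge and the limit is an intertwiner. *)
Lemma polar X Y (T : hom X Y) : contraction T -> exists U : hom X Y,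
  [/\ forall x, fwd U (bwd U (fwd U x)) = fwd U x,
      forall y, bwd U (fwd U (bwd U y)) = bwd U y,
      forall x, fwd U x = 0 <-> fwd T x = 0 &
      forall y, bwd U y = 0 <-> bwd T y = 0].
Proof.
move=> cT; have cT' := contraction_dual cT.
have [f fP] := choice (polar_cvg cT); have [g gP] := choice (polar_cvg cT').
have gP' y : cvH \oo (fun n => bwd (comph T (quoth cT n)) y) (g y).
  apply: cvH_near (gP y); apply: nearW => n /=; rewrite quoth_sa.
  have h := @quoth_comm _ _ _ _ (dual T) T (dual T) cT' cT.
  rewrite -[bwd T _]/(fwd (dual T) _) -h // => z.
  by apply: root_comm => t; rewrite !defectE /= bwdB.
have [U [Uf Ug]] := @hom_lim _ _ _ _ _ _ _ (fun n => comph T (quoth cT n)) _ _ fP gP'.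
have [|U1 U2] := @polar_half _ _ T cT U; first by move=> x; rewrite Uf; exact: fP.
have [|V1 V2] := @polar_half _ _ (dual T) cT' (dual U); first by move=> y; rewrite [fwd (dual U) _]/= Ug; exact: gP.
by exists U.
Qed.
End PartialIsometry.

(** * Unitary equivalence classes *)

Section Classes.
Variables (R : realType) (N : nat).
Implicit Types X Y Z : cdd R N.
Local Notation M := (uclass R N).

Lemma iso_refl X : iso X X.
Proof. by exists (idh X). Qed.

Lemma iso_sym X Y : iso X Y -> iso Y X.
Proof. by move=> [T iT iT']; exists (dual T). Qed.

Lemma iso_trans X Y Z : iso X Y -> iso Y Z -> iso X Z.
Proof.
move=> [T iT iT'] [U iU iU']; exists (comph U T).
  exact: isometric_comp.
exact: (isometric_comp (V := dual T) (W := dual U)).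
Qed.

Definition cls X : M := Uclass (ex_intro _ X erefl).

Lemma cls_eq X Y : cls X = cls Y <-> iso X Y.
Proof.
split=> [/(congr1 (fun a => member a Y)) /= e|XY].
  by apply/uequivP; rewrite e; exact/uequivP/iso_refl.
have e : (fun Z : cdd R N => uequiv X Z) = (fun Z : cdd R N => uequiv Y Z).
  apply/funext => Z; apply/propext; rewrite !uequivP.
  by split; apply: iso_trans => //; exact: iso_sym.
rewrite /cls; move: (ex_intro _ X _) (ex_intro _ Y _); rewrite e => p q.
by congr Uclass; exact: Prop_irrelevance.
Qed.

Lemma cls_surj (a : M) : exists X, cls X = a.
Proof.
case: a => m [X mX]; exists X; move: (ex_intro _ X mX) => h.
by rewrite /cls; case: _ / (esym mX) h => h; congr Uclass; exact: Prop_irrelevance.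
Qed.

Definition rep (a : M) : cdd R N := sval (cid (cls_surj a)).

Lemma repK a : cls (rep a) = a.
Proof. exact: svalP (cid (cls_surj a)). Qed.

(** An isometric intertwiner has a reducing range, namely the fixed space of
    [V V^*]; conversely the inclusion of a reducing subspace is one. *)
Lemma ule_cls X Y : ule (cls X) (cls Y) <-> exists V : hom X Y, isometric V.
Proof.
split=> [[A [B [/uequivP[T iT _] /uequivP[U iU iU'] [E [rE]]]]]|[V iV]].
  move=> AE; have /uequivP[S iS _] : uequiv A (sub_cdd rE) by exact: AE.
  exists (comph (dual U) (comph (incl rE) (comph S T))).
  apply: (isometric_comp (V := dual U)) => //; apply: isometric_comp.
    exact: incl_isometric.
  exact: isometric_comp.
exists X, Y; split; [exact/uequivP/iso_refl|exact/uequivP/iso_refl|].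
pose P := comph V (dual V).
have Psa x : bwd P x = fwd P x by [].
have Pid x : fwd P (fwd P x) = fwd P x by rewrite /= iV.
have rF : reducing (fixed_space Psa Pid) by exact: fixed_reducing.
exists (fixed_space Psa Pid); split=> //.
suff : iso X (sub_cdd rF) by move=> /uequivP.
pose J := incl rF.
have JJ x : fwd J (bwd J x) = fwd V (bwd V x) by exact: (fixed_orthoproj Psa Pid).
have iJ : isometric J by exact: incl_isometric.
exists (comph (dual J) V) => [x|u].
  by rewrite -[LHS]/(bwd V (fwd J (bwd J (fwd V x)))) JJ !iV.
by rewrite -[LHS]/(bwd J (fwd V (bwd V (fwd J u)))) -JJ !iJ.
Qed.

(** * Orthogonal sums of classes *)

Lemma sumof_iso (I : Type) (X Y : I -> cdd R N) Z Z' :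
  (forall i, iso (X i) (Y i)) -> iso Z Z' -> sumof X Z -> sumof Y Z'.
Proof.
move=> XY [T iT iT'] [V [iV dV] tV].
have /(_ _)/cid-/all_sig[S SP] i : exists S : hom (X i) (Y i), isometric S /\ isometric (dual S).
  by have [S] := XY i; exists S.
exists (fun i => comph T (comph (V i) (dual (S i)))); first split.
- move=> i; apply: isometric_comp => //; apply: isometric_comp => //.
  exact: (SP i).2.
- by move=> i j y ij; rewrite /= iT dV // fwd0.
move=> z z0; have : bwd T z = 0.
  by apply: tV => i; have [iS _] := SP i; rewrite -(iS (bwd (V i) _)) [X in bwd _ X]z0 bwd0.
by move=> Tz; rewrite -(iT' z) /= Tz fwd0.
Qed.

Definition Sum (I : Type) (a : I -> M) : M :=
  cls (sval (cid (sumof_exists (fun i => rep (a i))))).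

Lemma SumP (I : Type) (X : I -> cdd R N) Z :
  cls Z = Sum (fun i => cls (X i)) <-> sumof X Z.
Proof.
have [W hW e] : exists2 W, sumof X W & Sum (fun i => cls (X i)) = cls W.
  rewrite /Sum; case: cid => W /= hW; exists W => //.
  apply: sumof_iso hW; last exact: iso_refl.
  by move=> i; apply/cls_eq; rewrite repK.
rewrite e cls_eq; split=> [ZW|hZ]; last exact: sumof_unique hZ hW.
by apply: sumof_iso hW; [move=> i; exact: iso_refl|exact: iso_sym].
Qed.

Lemma SumE (I : Type) (X : I -> cdd R N) Z :
  sumof X Z -> Sum (fun i => cls (X i)) = cls Z.
Proof. by move=> /SumP ->. Qed.

Lemma cls_fun (I : Type) (a : I -> M) : a = fun i => cls (rep (a i)).
Proof. by apply/funext => i; rewrite repK. Qed.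

Lemma Sum_reindex (I J : Type) (f : I -> J) (g : J -> I) (a : J -> M) :
  cancel f g -> cancel g f -> Sum (fun i => a (f i)) = Sum a.
Proof.
move=> fK gK; rewrite (cls_fun a).
have [Z [V [iV dV] tV]] := sumof_exists (fun j => rep (a j)).
have hZ : sumof (fun j => rep (a j)) Z by exists V.
rewrite (SumE hZ); apply: (@SumE _ (fun i => rep (a (f i)))).
exists (fun i => V (f i)); first split=> //.
  by move=> i i' x ii'; apply: dV => /(can_inj fK).
by move=> z z0; apply: tV => j; rewrite -(gK j).
Qed.

Lemma Sum_sigma (I : Type) (J : I -> Type) (a : forall i, J i -> M) :
  Sum (fun i => Sum (a i)) = Sum (fun p : {i & J i} => a (projT1 p) (projT2 p)).
Proof.
have aE i : a i = fun j => cls (rep (a i j)) by exact: cls_fun.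
have /choice[Y YP] i := sumof_exists (fun j => rep (a i j)).
have [Z hZ] := sumof_exists Y.
have -> : (fun i => Sum (a i)) = fun i => cls (Y i).
  by apply/funext => i; rewrite aE; apply: SumE.
rewrite (SumE hZ) (cls_fun (fun p => _)); apply/esym/SumE.
have [V [iV dV] tV] := hZ.
have /(_ _)/cid2-/all_sig2[W oW tW] := YP.
exists (fun p => comph (V (projT1 p)) (W (projT1 p) (projT2 p))); first split.
- by move=> [i j]; apply: isometric_comp => //; exact: (oW i).1.
- move=> [i j] [i' j'] x /= ne; have [ii'|ii'] := pselect (i = i'); last first.
    by rewrite dV // bwd0.
  by subst i'; rewrite iV (oW i).2 // => jj'; apply: ne; rewrite jj'.
- move=> z z0; apply: tV => i; apply: tW => j; exact: (z0 (existT _ i j)).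
Qed.

Lemma Sum_sum (I J : Type) (a : I -> M) (b : J -> M) :
  Sum (fun c : bool => if c then Sum a else Sum b) =
  Sum (fun s : I + J => match s with inl i => a i | inr j => b j end).
Proof.
pose K (c : bool) : Type := if c then I else J.
pose d (c : bool) : K c -> M := if c return K c -> M then a else b.
have -> : (fun c : bool => if c then Sum a else Sum b) = fun c => Sum (d c).
  by apply/funext => -[].
rewrite Sum_sigma.
pose f (p : {c & K c}) : I + J :=
  match p with existT true i => inl i | existT false j => inr j end.
pose g (s : I + J) : {c & K c} :=
  match s with inl i => existT K true i | inr j => existT K false j end.
rewrite -(@Sum_reindex _ _ f g); last 2 first.
- by move=> [[] x].
- by move=> [].
by congr Sum; apply/funext => -[[] x].
Qed.

Lemma Sum_unit (a : M) : Sum (fun _ : unit => a) = a.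
Proof.
rewrite -{2}(repK a) (cls_fun (fun _ => _)); apply: SumE.
exists (fun _ => idh (rep a)); first split=> //.
  by move=> [] [].
by move=> z /(_ tt).
Qed.

End Classes.

(** * Addition of classes *)

Section ClassMonoid.
Variables (R : realType) (N : nat).
Implicit Types X Y Z A B : cdd R N.
Local Notation M := (uclass R N).
Implicit Types a b c d m : M.

Definition add a b : M := Sum (fun i : bool => if i then a else b).
Definition zero : M := Sum (fun v : void => match v with end).
Local Notation "a ++ b" := (add a b).

Lemma zeroP X : cls X = zero <-> forall x : hspace X, x = 0.
Proof.
rewrite /zero (cls_fun (fun v : void => _)) SumP; split=> [[V _ tV] x|X0].
  by apply: tV.
exists (fun v : void => match v with end); first by split=> -[].
by move=> x _; exact: X0.
Qed.

Lemma addP A B Z : cls Z = cls A ++ cls B <->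
  exists (p : hom A Z) (q : hom B Z), [/\ isometric p, isometric q,
    (forall x, bwd q (fwd p x) = 0), (forall y, bwd p (fwd q y) = 0) &
    forall z, z = fwd p (bwd p z) + fwd q (bwd q z)].
Proof.
pose X (i : bool) := if i then A else B.
have -> : cls A ++ cls B = Sum (fun i => cls (X i)).
  by congr Sum; apply/funext => -[].
rewrite SumP; split=> [[V [iV dV] tV]|[p [q [ip iq qp pq pqz]]]].
  exists (V true), (V false); split.
  - exact: iV true.
  - exact: iV false.
  - by move=> x; exact: (dV true false).
  - by move=> x; exact: (dV false true).
  move=> z; apply/subr0_eq/tV => -[]; rewrite bwdB bwdD.
    by rewrite (iV true) (dV false true) // addr0 subrr.
  by rewrite (iV false) (dV true false) // add0r subrr.
exists (fun i : bool => if i return hom (X i) Z then p else q); first split.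
- by case.
- by move=> [] [] //= x _.
by move=> z z0; rewrite (pqz z) (z0 true) (z0 false) !fwd0 addr0.
Qed.

Lemma addC a b : a ++ b = b ++ a.
Proof.
rewrite /add -(@Sum_reindex _ _ _ _ negb negb _ negbK negbK).
by congr Sum; apply/funext => -[].
Qed.

Lemma add_Sum (I J : Type) (a : I -> M) (b : J -> M) : Sum a ++ Sum b =
  Sum (fun s : I + J => match s with inl i => a i | inr j => b j end).
Proof. exact: Sum_sum. Qed.

Lemma addA a b c : a ++ (b ++ c) = (a ++ b) ++ c.
Proof.
rewrite -{1}(Sum_unit a) -{2}(Sum_unit c) /(b ++ c) /(a ++ b) !add_Sum.
pose f (s : unit + bool) : bool + unit :=
  match s with inl _ => inl true | inr true => inl false | inr false => inr tt end.
pose g (s : bool + unit) : unit + bool :=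
  match s with inl true => inl tt | inl false => inr true | inr _ => inr false end.
rewrite -(@Sum_reindex _ _ _ _ f g); last 2 first.
- by move=> [[]|[]].
- by move=> [[]|[]].
by congr Sum; apply/funext => -[[]|[]].
Qed.

Lemma add0 a : a ++ zero = a.
Proof.
rewrite -[RHS]Sum_unit -{1}(Sum_unit a) add_Sum.
rewrite -[RHS](@Sum_reindex _ _ _ _ (fun s : unit + void => tt) (fun _ => inl tt)).
- by congr Sum; apply/funext => -[].
- by move=> [[]|[]].
- by move=> [].
Qed.

Lemma add0l a : zero ++ a = a.
Proof. by rewrite addC add0. Qed.

Lemma addCA a b c : a ++ (b ++ c) = b ++ (a ++ c).
Proof. by rewrite addA (addC a) -addA. Qed.

Lemma addAC a b c : (a ++ b) ++ c = (a ++ c) ++ b.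
Proof. by rewrite -addA (addC b) addA. Qed.

Lemma addACA a b c d : (a ++ b) ++ (c ++ d) = (a ++ c) ++ (b ++ d).
Proof. by rewrite -!addA (addCA b). Qed.

Lemma Sum_add (I : Type) (a b : I -> M) :
  Sum (fun i => a i ++ b i) = Sum a ++ Sum b.
Proof.
rewrite /add Sum_sigma Sum_sum.
pose f (p : {_ : I & bool}) : I + I := if projT2 p then inl (projT1 p) else inr (projT1 p).
pose g (s : I + I) : {_ : I & bool} :=
  match s with inl i => existT _ i true | inr i => existT _ i false end.
rewrite -[RHS](@Sum_reindex _ _ _ _ f g); last 2 first.
- by move=> [i []].
- by move=> [].
by congr Sum; apply/funext => -[i []].
Qed.

Lemma Sum_exchange (I J : Type) (a : I -> J -> M) :
  Sum (fun i => Sum (a i)) = Sum (fun j => Sum (fun i => a i j)).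
Proof.
rewrite !Sum_sigma.
pose f (p : {_ : I & J}) : {_ : J & I} := existT _ (projT2 p) (projT1 p).
pose g (p : {_ : J & I}) : {_ : I & J} := existT _ (projT2 p) (projT1 p).
by rewrite -[RHS](@Sum_reindex _ _ _ _ f g) // => -[].
Qed.

Lemma Sum_pred (I : Type) (P : I -> Prop) (a : I -> M) : Sum a =
  Sum (fun i : {i | P i} => a (sval i)) ++ Sum (fun i : {i | ~ P i} => a (sval i)).
Proof.
rewrite add_Sum.
pose f (s : {i | P i} + {i | ~ P i}) : I :=
  match s with inl i => sval i | inr i => sval i end.
pose g (i : I) : {i | P i} + {i | ~ P i} :=
  match pselect (P i) with left h => inl (exist _ i h) | right h => inr (exist _ i h) end.
rewrite -(@Sum_reindex _ _ _ _ f g).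
- by congr Sum; apply/funext => -[].
- move=> [[i h]|[i h]]; rewrite /g /=; case: pselect => h' //.
    by congr (inl (exist _ _ _)); exact: Prop_irrelevance.
  by congr (inr (exist _ _ _)); exact: Prop_irrelevance.
- by move=> i; rewrite /g; case: pselect.
Qed.

(** * Complements *)

(** Gluing the family to itself gives the projection onto the closed span of the
    ranges; [W] embeds the complementary subobject. *)
Lemma complement (I : Type) (X : I -> cdd R N) Z (V : forall i, hom (X i) Z) :
  orthofam V -> exists B, exists2 W : hom B Z, isometric W &
    (forall z, (forall i, bwd (V i) z = 0) <-> fwd W (bwd W z) = z) /\
    cls Z = Sum (fun i => cls (X i)) ++ cls B.
Proof.
move=> oV; have [T [TV TV' T0 T0']] := glue oV oV.
have VT i z : bwd (V i) (fwd T z) = bwd (V i) z.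
  by apply: (@bwd_ext _ _ _ _ (comph (dual T) (V i)) (V i)) => x /=.
have VT' i z : bwd (V i) (bwd T z) = bwd (V i) z.
  by apply: (@bwd_ext _ _ _ _ (comph T (V i)) (V i)) => x /=.
have TT z : fwd T (fwd T z) = fwd T z.
  by apply/esym/subr0_eq; rewrite -fwdB; apply: T0 => i; rewrite bwdB VT subrr.
have T'T z : bwd T (fwd T z) = bwd T z.
  apply/esym/subr0_eq; rewrite -bwdB; apply: T0' => i.
  by rewrite bwdB VT subrr.
have Tsa z : bwd T z = fwd T z.
  apply: ip_ext => w; rewrite -[in LHS]T'T hom_adjC.
  by rewrite (hom_adj T z w) -(T'T w) -hom_adj.
pose Q := subh (idh Z) T.
have QE z : fwd Q z = z - fwd T z by rewrite subhE.
have [B [W iW WQ]] : exists B, exists2 W : hom B Z, isometric W &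
    forall z, fwd W (bwd W z) = fwd Q z.
  apply: proj_split => z; first by rewrite subhE' QE Tsa.
  by rewrite !QE fwdB TT subrr subr0.
have kP z : (forall i, bwd (V i) z = 0) <-> fwd W (bwd W z) = z.
  rewrite WQ QE; split=> [/T0 ->|zT]; first by rewrite subr0.
  by move=> i; rewrite -zT bwdB VT subrr.
exists B, W => //; split=> //.
have VW i x : bwd (V i) (fwd W x) = 0 by move: i; apply/kP; rewrite iW.
rewrite -(Sum_unit (cls B)) add_Sum.
pose Y (s : I + unit) := match s with inl i => X i | inr _ => B end.
have -> : (fun s : I + unit => match s with inl i => cls (X i) | inr _ => cls B end) =
  fun s => cls (Y s) by apply/funext => -[].
apply/SumP; have [iV dV] := oV.
exists (fun s => match s return hom (Y s) Z with inl i => V i | inr _ => W end); first split.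
- by move=> [i|[]] /=.
- move=> [i|[]] [j|[]] x //= ij.
  + by apply: dV => ij'; apply: ij; rewrite ij'.
  + by apply: ip_ext => z; rewrite hom_adjC hom_adj VW ip0l ip0r.
- move=> z z0; have : forall i, bwd (V i) z = 0 by move=> i; exact: (z0 (inl i)).
  by move/kP => <-; rewrite (z0 (inr tt)) fwd0.
Qed.

Lemma complement1 A Z (V : hom A Z) : isometric V ->
  exists B, exists2 W : hom B Z, isometric W &
    (forall z, bwd V z = 0 <-> fwd W (bwd W z) = z) /\ cls Z = cls A ++ cls B.
Proof.
move=> iV; have [|B [W iW [kP e]]] := @complement unit (fun=> A) Z (fun=> V).
  by split=> // -[] [].
exists B, W => //; split; last by rewrite e Sum_unit.
by move=> z; rewrite -kP; split=> // /(_ tt).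
Qed.

Lemma ule_add a b : ule a b <-> exists c, b = a ++ c.
Proof.
rewrite -(repK a) -(repK b) ule_cls; split=> [[V iV]|[c]].
  by have [B [W _ [_ ->]]] := complement1 iV; exists (cls B).
by rewrite -(repK c) => /addP[p [q [ip _ _ _ _]]]; exists p.
Qed.

(** * Refinement *)

(** The partial isometry of the polar decomposition identifies the complements of
    the kernels of [T] and [T^*]. *)
Lemma polar_split A B (T : hom A B) : contraction T ->
  exists m A0 B0 (f : hom A0 A) (g : hom B0 B),
  [/\ isometric f /\ isometric g, cls A = m ++ cls A0, cls B = m ++ cls B0,
      m = zero -> forall x, fwd T x = 0 &
      (forall x, fwd T x = 0 <-> fwd f (bwd f x) = x) /\
      (forall y, bwd T y = 0 <-> fwd g (bwd g y) = y)].
Proof.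
move=> /polar[U [U1 U2 kU kU']].
have [A' [i i1 iP]] : exists A', exists2 i : hom A' A, isometric i &
    forall x, fwd i (bwd i x) = fwd (comph (dual U) U) x.
  by apply: proj_split => x //=; rewrite U2.
have j1 : isometric (comph U i).
  by move=> x /=; rewrite -[bwd U _]/(fwd (comph (dual U) U) _) -iP !i1.
have [A0 [f f1 [fP fe]]] := complement1 i1.
have [B0 [g g1 [gP ge]]] := complement1 j1.
have i0 x : bwd i x = 0 <-> fwd U x = 0.
  split=> [x0|Ux]; last by rewrite -(i1 (bwd i x)) iP /= Ux bwd0 bwd0.
  by rewrite -U1 -[bwd U _]/(fwd (comph (dual U) U) x) -iP x0 !fwd0.
have j0 y : bwd (comph U i) y = 0 <-> bwd U y = 0.
  split=> [|/= ->]; last by rewrite bwd0.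
  by move=> /= /i0; rewrite -{2}U2 => ->; rewrite bwd0.
exists (cls A'), A0, B0, f, g; split=> //.
- move=> /zeroP A'0 x; apply/kU/i0; exact: A'0.
- split=> z.
    exact: iff_trans (iff_sym (kU z)) (iff_trans (iff_sym (i0 z)) (fP z)).
  exact: iff_trans (iff_sym (kU' z)) (iff_trans (iff_sym (j0 z)) (gP z)).
Qed.

(** A vector of [A] whose image in [Z] is orthogonal to [Q] lies in [S] as well,
    and there it is orthogonal to [B]. *)
Lemma ker_iso A B S Q Z A0 S0 (p : hom A Z) (q : hom B Z) (r : hom Q Z) (s : hom S Z)
    (f : hom A0 A) (g : hom S0 S) :
  [/\ isometric p, (forall x, bwd q (fwd p x) = 0), isometric f &
    forall z, z = fwd r (bwd r z) + fwd s (bwd s z)] ->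
  (forall x, bwd r (fwd p x) = 0 <-> fwd f (bwd f x) = x) ->
  (forall y, bwd q (fwd s y) = 0 <-> fwd g (bwd g y) = y) ->
  isometric (comph (dual g) (comph (dual s) (comph p f))).
Proof.
move=> [ip qp if_ rs] fP gP x /=.
have rpf : bwd r (fwd p (fwd f x)) = 0 by apply/fP; rewrite if_.
have e : fwd s (bwd s (fwd p (fwd f x))) = fwd p (fwd f x).
  by rewrite [RHS]rs rpf fwd0 add0r.
have -> : fwd g (bwd g (bwd s (fwd p (fwd f x)))) = bwd s (fwd p (fwd f x)).
  by apply/gP; rewrite e qp.
by rewrite e ip if_.
Qed.

(** Inside [Z = A + B = C + D], the part of [A] on which its projection to [C]
    vanishes is the intersection of [A] and [D], and so on; polar decomposition
    matches what remains of [A] with what remains of [C], and likewise for [B]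
    and [D]. *)
Lemma refinement a b c d : a ++ b = c ++ d -> exists m n k l,
  [/\ a = m ++ n, b = k ++ l, c = m ++ k & d = n ++ l].
Proof.
move=> e; pose Z := rep (a ++ b).
have Zab : cls Z = cls (rep a) ++ cls (rep b) by rewrite !repK.
have Zcd : cls Z = cls (rep c) ++ cls (rep d) by rewrite !repK.
have [p [q [ip iq qp pq pqz]]] := (addP _ _ _).1 Zab.
have [r [s [ir is_ sr rs rsz]]] := (addP _ _ _).1 Zcd.
have con U U' (u : hom U Z) (v : hom U' Z) : isometric u -> isometric v ->
    contraction (comph (dual u) v).
  move=> iu iv x; apply: le_trans (coisometric_hn _ iu) _.
  by rewrite isometric_hn.
have [m [A0 [C0 [f [g [[if_ ig] ea ec _ [fP gP]]]]]]] := polar_split (con _ _ r p ir ip).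
have [l [B0 [D0 [f' [g' [[if' ig'] eb ed _ [fP' gP']]]]]]] := polar_split (con _ _ s q is_ iq).
have AD : cls A0 = cls D0.
  apply/cls_eq; exists (comph (dual g') (comph (dual s) (comph p f))).
    by apply: (ker_iso (q := q) (r := r)) => //; split.
  apply: (@ker_iso _ _ _ _ _ _ _ s r q p g' f) => //.
  by split=> // z; rewrite addrC.
have BC : cls B0 = cls C0.
  apply/cls_eq; exists (comph (dual g) (comph (dual r) (comph q f'))).
    apply: (@ker_iso _ _ _ _ _ _ _ q p s r f' g) => //.
    by split=> // z; rewrite addrC.
  apply: (@ker_iso _ _ _ _ _ _ _ r s p q g f') => //.
exists m, (cls A0), (cls B0), l.
rewrite -(repK a) -(repK b) -(repK c) -(repK d) ea eb ec ed AD BC.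
by split=> //; rewrite addC.
Qed.

(** Some component of an embedding of [w] into the sum is nonzero, and polar
    decomposition turns it into a common part. *)
Lemma common_part (I : Type) (y : I -> M) w : ule w (Sum y) -> w <> zero ->
  exists i m, [/\ m <> zero, ule m w & ule m (y i)].
Proof.
pose Z := rep (Sum y).
have [V oV tV] : sumof (fun i => rep (y i)) Z by apply/SumP; rewrite repK -cls_fun.
rewrite -{1}(repK w) -{1}(repK (Sum y)) => /ule_cls[U iU] w0.
have [i Ti] : exists i, ~ forall x, bwd (V i) (fwd U x) = 0.
  apply: contrapT => /forallNP h; apply: w0; rewrite -(repK w); apply/zeroP => x.
  rewrite -(iU x) (_ : fwd U x = 0) ?bwd0 //; apply: tV => i.
  by have /contrapT := h i; exact.
have cT : contraction (comph (dual (V i)) U).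
  move=> x; apply: le_trans (coisometric_hn _ (oV.1 i)) _.
  by rewrite isometric_hn.
have [m [A0 [B0 [_ [_ [_ ea eb m0 _]]]]]] := polar_split cT.
exists i, m; split.
- by move/m0.
- by apply/ule_add; exists (cls A0); rewrite -ea repK.
- by apply/ule_add; exists (cls B0); rewrite -eb repK.
Qed.

(** The [a n] are realized as a decreasing sequence of subspaces of [a 0] with
    differences [f n]; the remainder is their intersection. *)
Lemma remainder (a f : nat -> M) : (forall n, a n = f n ++ a n.+1) ->
  exists r, a 0 = r ++ Sum f /\ forall n, ule r (a n).
Proof.
move=> af.
have /(_ _)/cid-/all_sig[p] n : exists p : hom (rep (f n)) (rep (a n)) * hom (rep (a n.+1)) (rep (a n)),
    [/\ isometric p.1, isometric p.2, (forall x, bwd p.2 (fwd p.1 x) = 0),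
      (forall y, bwd p.1 (fwd p.2 y) = 0) &
      forall z, z = fwd p.1 (bwd p.1 z) + fwd p.2 (bwd p.2 z)].
  have [|u [v h]] := (addP (rep (f n)) (rep (a n.+1)) (rep (a n))).1.
    by rewrite !repK.
  by exists (u, v).
move=> /all_and5[ip iq qp pq pqz].
pose e := fix e n : hom (rep (a n)) (rep (a 0)) :=
  if n is n'.+1 then comph (e n') (p n').2 else idh _.
have ie n : isometric (e n).
  by elim: n => // n IH; apply: isometric_comp.
pose F n := comph (e n) (p n).1.
have iF n : isometric (F n) by exact: isometric_comp.
have Fe n k x : (k < n)%N -> bwd (F k) (fwd (e n) x) = 0.
  elim: n x => // n IH x; rewrite ltnS leq_eqVlt => /orP[/eqP ->|/IH] /=.
    by rewrite ie pq.
  exact.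
have Flt k n x : (k < n)%N -> bwd (F k) (fwd (F n) x) = 0 by exact: Fe.
have oF : orthofam F.
  split=> // k n x kn; have [h|h|//] := ltngtP k n; last exact: Flt.
  by apply: ip_ext => z; rewrite hom_adjC hom_adj Flt // ip0l ip0r.
have [B [W iW [kP eB]]] := complement oF.
exists (cls B); split; first by rewrite -(repK (a 0)) eB addC -cls_fun.
move=> n; rewrite -(repK (a n)); apply/ule_cls; exists (comph (dual (e n)) W).
have FW k x : bwd (F k) (fwd W x) = 0 by move: k; apply/kP; rewrite iW.
suff h x : fwd (e n) (bwd (e n) (fwd W x)) = fwd W x by move=> x /=; rewrite h.
elim: n x => [//|n IH] x /=.
have := pqz n (bwd (e n) (fwd W x)); have /= -> := FW n x.
by rewrite fwd0 add0r => <-.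
Qed.

End ClassMonoid.

(** * Exhaustion and transfinite packing *)

Lemma sval_neq (T : Type) (P : T -> Prop) (i j : {x | P x}) :
  i <> j -> sval i <> sval j.
Proof.
case: i j => [x Px] [y Py] /= + xy; subst y; apply; congr exist.
exact: Prop_irrelevance.
Qed.

Section Exhaustion.
Variables (R : realType) (N : nat).
Local Notation M := (uclass R N).
Local Notation "a ++ b" := (add a b).
Local Notation zero := (zero R N).

(** The projection [P] onto a subobject of class [m]. Projections serve as the
    subobjects of [A] because they form a type of the size of [A]. *)
Definition range_class (A : cdd R N) (P : hspace A -> hspace A) (m : M) :=
  exists2 V : hom (rep m) A, isometric V & forall x, fwd V (bwd V x) = P x.

Lemma range_class_unique (A : cdd R N) (P : hspace A -> hspace A) m m' :
  range_class P m -> range_class P m' -> m = m'.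
Proof.
move=> [V iV VP] [W iW WP]; rewrite -(repK m) -(repK m'); apply/cls_eq.
exists (comph (dual W) V) => x /=; first by rewrite WP -VP !iV.
by rewrite VP -WP !iW.
Qed.

Lemma ule_zero (a : M) : ule a zero -> a = zero.
Proof.
rewrite -{1}(repK a) -{1}(repK zero) => /ule_cls[V iV].
have z0 := (zeroP (rep zero)).1 (repK zero).
by rewrite -(repK a); apply/zeroP => x; rewrite -(iV x) (z0 (fwd V x)) bwd0.
Qed.

Section MaxFamily.
Variables (K : Type) (k0 : K) (a : K -> M) (Q : M -> Prop) (rho : M -> M -> Prop).
Hypothesis rho_sym : forall m m', rho m m' -> rho m' m.

Definition projections := forall k, hspace (rep (a k)) -> hspace (rep (a k)).

Definition has_class (t : projections) (m : M) := forall k, range_class (t k) m.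

Definition good (T : set projections) := [/\
  (forall t, T t -> exists m, [/\ m <> zero, Q m & has_class t m]),
  (forall t t', T t -> T t' -> t <> t' -> forall k x, t k (t' k x) = 0) &
  (forall t t' m m', T t -> T t' -> t <> t' ->
     has_class t m -> has_class t' m' -> rho m m')].

Lemma good_chain (F : set (set projections)) : F `<=` good ->
  total_on F subset -> good (\bigcup_(T in F) T).
Proof.
move=> Fg Ft; split.
- by move=> t [T FT Tt]; have [h _ _] := Fg _ FT; exact: h.
- move=> t t' [T FT Tt] [T' FT' Tt']; have [TT'|TT'] := Ft _ _ FT FT'.
    by have [_ h _] := Fg _ FT'; apply: h => //; exact: TT'.
  by have [_ h _] := Fg _ FT; apply: h => //; exact: TT'.
- move=> t t' m m' [T FT Tt] [T' FT' Tt']; have [TT'|TT'] := Ft _ _ FT FT'.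
    by have [_ _ h] := Fg _ FT'; apply: h => //; exact: TT'.
  by have [_ _ h] := Fg _ FT; apply: h => //; exact: TT'.
Qed.

(** By Zorn's lemma one chooses a maximal set of mutually orthogonal copies of
    [rho]-related classes of kind [Q], each copy being realized in all the [a k]
    at once. A further class that fits into all the remainders would enlarge it. *)
Lemma max_family : exists (I : Type) (m : I -> M) (x : K -> M), [/\
  forall k, a k = Sum m ++ x k,
  forall i, Q (m i) /\ m i <> zero,
  forall i j, i <> j -> rho (m i) (m j) &
  forall y, Q y -> (forall i, rho y (m i)) -> (forall k, ule y (x k)) -> y = zero].
Proof.
have [T [[T1 T2 T3] Tmax]] := Zorn_bigcup good_chain.
pose I := {t | T t}.
have /(_ _)/cid-/all_sig[m mP] (i : I) :
    exists m, [/\ m <> zero, Q m & has_class (sval i) m].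
  by apply: T1; exact: svalP i.
have /(_ _)/(_ _)/cid-/(_ _)/all_sig-/all_sig[V VP] (i : I) k :
    exists V : hom (rep (m i)) (rep (a k)), isometric V /\
      forall x, fwd V (bwd V x) = sval i k x.
  by have [_ _ /(_ k)[V]] := mP i; exists V.
have oV k : orthofam (fun i => V i k).
  split=> [i|i j x ij]; first exact: (VP i k).1.
  have ne : sval j <> sval i by apply: sval_neq => ji; exact: ij.
  rewrite -((VP j k).1 (bwd _ _)) -{1}((VP i k).1 x) (VP j k).2 (VP i k).2.
  by rewrite T2 ?bwd0 //; exact: svalP.
have /(_ _)/cid-/all_sig[B BP] k := complement (oV k).
have /(_ _)/cid2-/all_sig2[W iW WP] := BP.
exists I, m, (fun k => cls (B k)); split.
- by move=> k; have [_] := WP k; rewrite repK -cls_fun.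
- by move=> i; have [? ? _] := mP i.
- move=> i j ij; apply: (T3 (sval i) (sval j) (m i) (m j)); try exact: svalP.
  + exact: sval_neq.
  + by have [] := mP i.
  + by have [] := mP j.
move=> y Qy yrho yx; apply: contrapT => y0.
have /(_ _)/cid-/all_sig[E iE] k : exists E : hom (rep y) (B k), isometric E.
  by apply/ule_cls; rewrite repK.
pose U k := comph (W k) (E k).
have iU k : isometric (U k) by exact: isometric_comp.
have VU i k x : bwd (V i k) (fwd (U k) x) = 0.
  by move: i; apply/(WP k).1; rewrite /= iW.
have UV i k x : bwd (U k) (fwd (V i k) x) = 0.
  by apply: ip_ext => z; rewrite hom_adjC hom_adj VU ip0l ip0r.
pose t0 : projections := fun k x => fwd (U k) (bwd (U k) x).
have t0y : has_class t0 y by move=> k; exists (U k).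
have t0T : ~ T t0.
  move=> h; pose i : I := exist _ t0 h; apply: y0; rewrite -(repK y).
  apply/zeroP => x; have := (VP i k0).2 (fwd (U k0) x); rewrite VU fwd0 /= /t0.
  by rewrite iU => /(congr1 (bwd (U k0))); rewrite iU bwd0.
have := Tmax (T `|` [set t0]); apply.
  by split=> [t Tt|/(_ t0)]; [left|move=> h; apply: t0T; apply: h; right].
have Vt t (Tt : T t) k x : t k x = fwd (V (exist _ t Tt) k) (bwd (V (exist _ t Tt) k) x).
  by rewrite (VP (exist _ t Tt) k).2.
have my t (Tt : T t) m' : has_class t m' -> m' = m (exist _ t Tt).
  move=> /(_ k0) h; apply: range_class_unique h _.
  by have [_ _ /(_ k0)] := mP (exist _ t Tt).
split.
- by move=> t [/T1//|->]; exists y.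
- move=> t t' [Tt|->] [Tt'|->] ne k x.
  + exact: (T2 t t').
  + by rewrite (Vt _ Tt) /t0 VU fwd0.
  + by rewrite (Vt _ Tt') /t0 UV fwd0.
  + by [].
- move=> t t' m1 m2 [Tt|->] [Tt'|->] ne h1 h2.
  + exact: (T3 t t' m1 m2).
  + rewrite (my _ Tt _ h1) (range_class_unique (h2 k0) (t0y k0)).
    exact/rho_sym/yrho.
  + by rewrite (my _ Tt' _ h2) (range_class_unique (h1 k0) (t0y k0)).
  + by [].
Qed.
End MaxFamily.

Section Packing.
Variables (S : Type) (lt : S -> S -> Prop).
Hypotheses (lt_wf : well_founded lt)
  (lt_total : forall s t, s <> t -> lt s t \/ lt t s).
Variables (f : S -> M) (u : M).
Hypothesis room : forall s x, u = Sum (fun t : {t | lt t s} => f (sval t)) ++ x ->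
  ule (f s) x.
Local Notation U := (rep u).

Definition fits s (P : forall t, lt t s -> hspace U -> hspace U)
    (V : hom (rep (f s)) U) :=
  isometric V /\ forall t (h : lt t s) x, P t h (fwd V x) = 0.

Definition pack_step s (P : forall t, lt t s -> hspace U -> hspace U) :=
  match pselect (exists V, fits P V) with
  | left e => fun x : hspace U => let V := sval (cid e) in fwd V (bwd V x)
  | right _ => fun=> 0
  end.

Definition pack : S -> hspace U -> hspace U :=
  Fix lt_wf (fun=> hspace U -> hspace U) pack_step.

Lemma packE s : pack s = pack_step (fun t (_ : lt t s) => pack t).
Proof.
apply: (Fix_eq lt_wf (fun=> hspace U -> hspace U)) => t P P' PP'.
congr pack_step; apply: functional_extensionality_dep => r.
by apply: functional_extensionality_dep => h; exact: PP'.
Qed.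

Lemma pack_fits s : exists V : hom (rep (f s)) U,
  fits (fun t (_ : lt t s) => pack t) V /\ forall x, fwd V (bwd V x) = pack s x.
Proof.
elim/(well_founded_ind lt_wf): s => s IH.
have ex : exists V : hom (rep (f s)) U, fits (fun t (_ : lt t s) => pack t) V.
  pose J := {t | lt t s}.
  have /(_ _)/cid-/all_sig[V VP] (j : J) := IH (sval j) (svalP j).
  have Vlt (i j : J) x : lt (sval i) (sval j) -> bwd (V i) (fwd (V j) x) = 0.
    move=> ij; have [[iV _] VE] := VP i; have [[_ h] _] := VP j.
    by rewrite -(iV (bwd _ _)) VE h // bwd0.
  have oV : orthofam V.
    split=> [j|i j x ij]; first by have [[]] := VP j.
    have [|ji|ij'] := lt_total (s := sval j) (t := sval i).
    - by apply: sval_neq => ji; exact: ij.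
    - exact: Vlt.
    - by apply: ip_ext => z; rewrite hom_adjC hom_adj Vlt // ip0l ip0r.
  have [B [W iW [WP e]]] := complement oV.
  rewrite repK -(cls_fun (fun j : J => f (sval j))) in e.
  have /ule_cls[E iE] : ule (cls (rep (f s))) (cls B) by rewrite repK; exact: room e.
  exists (comph W E); split; first exact: isometric_comp.
  move=> t h x; have [_ <-] := VP (exist _ t h).
  suff -> : bwd (V (exist _ t h)) (fwd (comph W E) x) = 0 by rewrite fwd0.
  by move: (exist _ t h); apply/WP; rewrite /= iW.
rewrite packE /pack_step; case: pselect => // e.
by exists (sval (cid e)); split=> //; exact: svalP (cid e).
Qed.

(** The copies of the [f s] inside [u] are chosen by well-founded recursion, each
    one orthogonal to the earlier ones. *)
Lemma packing : ule (Sum f) u.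
Proof.
have /(_ _)/cid-/all_sig[V VP] := pack_fits.
have Vlt s t x : lt s t -> bwd (V s) (fwd (V t) x) = 0.
  move=> st; have [[iV _] VE] := VP s; have [[_ h] _] := VP t.
  by rewrite -(iV (bwd _ _)) VE h // bwd0.
have oV : orthofam V.
  split=> [s|s t x st]; first by have [[]] := VP s.
  have [|ts|st'] := lt_total (s := t) (t := s); [exact/nesym|exact: Vlt|].
  by apply: ip_ext => z; rewrite hom_adjC hom_adj Vlt // ip0l ip0r.
have [B [_ _ [_ e]]] := complement oV.
by apply/ule_add; exists (cls B); rewrite -(repK u) e -cls_fun.
Qed.
End Packing.

Lemma well_founded_order (S : Type) : exists lt : S -> S -> Prop,
  well_founded lt /\ forall s t, s <> t -> lt s t \/ lt t s.
Proof.
have [r rwo] := wochoice.well_ordering_principle {classic S}.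
exists (fun s t => r s t && (s != t :> {classic S})); split.
  move=> s; apply: contrapT => ns.
  have [|z [[zP zmin] _]] := rwo (fun s => `[< ~ Acc (fun s t => r s t && (s != t :> {classic S})) s >]).
    by exists s; apply/asboolP.
  move/asboolP: zP; apply; constructor => t /andP[tz ne].
  apply: contrapT => nt; have zt : r z t by apply: zmin; apply/asboolP.
  have := @wochoice.wo_chain_antisymmetric _ r predT (wochoice.withinW rwo).
  by move=> /(_ t z isT isT); rewrite tz zt => /(_ isT) e; rewrite e eqxx in ne.
move=> s t ne; have st : (s : {classic S}) != t by apply/eqP.
have := @wochoice.wo_chainW _ r predT (wochoice.withinW rwo) s t isT isT.
by case/orP => h; [left|right]; rewrite h //= eq_sym.
Qed.
End Exhaustion.

(** * The order of classes *)

Section BandTheory.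
Variables (R : realType) (N : nat).
Local Notation M := (uclass R N).
Local Notation "a ++ b" := (add a b).
Local Notation zero := (zero R N).
Local Notation "a <<= b" := (ule a b) (at level 70).
Implicit Types (a b c d e m x y : M) (X : M -> Prop).

Lemma ule_addr a b : a <<= a ++ b.
Proof. by apply/ule_add; exists b. Qed.

Lemma ule_addl a b : a <<= b ++ a.
Proof. by rewrite addC; exact: ule_addr. Qed.

Lemma ule_refl a : a <<= a.
Proof. by rewrite -{2}(add0 a); exact: ule_addr. Qed.

Lemma ule_trans b a c : a <<= b -> b <<= c -> a <<= c.
Proof.
move=> /ule_add[d ->] /ule_add[e ->]; rewrite -addA; exact: ule_addr.
Qed.

Lemma ule_addm a b c d : a <<= b -> c <<= d -> a ++ c <<= b ++ d.
Proof.
move=> /ule_add[a' ->] /ule_add[c' ->]; rewrite addACA; exact: ule_addr.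
Qed.

Lemma ule_Sum (I : Type) (f g : I -> M) : (forall i, f i <<= g i) -> Sum f <<= Sum g.
Proof.
move=> fg; have /choice[h hP] i : exists c, g i = f i ++ c by exact/ule_add.
by rewrite (funext hP) Sum_add; exact: ule_addr.
Qed.

Lemma Sum_zero (I : Type) : Sum (fun _ : I => zero) = zero.
Proof.
apply: contrapT => s0; have [i [m [m0 _ /ule_zero//]]] := common_part (ule_refl _) s0.
Qed.

Lemma Sum_single (I : Type) (i : I) (f : I -> M) :
  (forall j, j <> i -> f j = zero) -> Sum f = f i.
Proof.
move=> f0; rewrite (Sum_pred (fun j => j = i)).
rewrite (_ : (fun j : {j | j <> i} => _) = fun=> zero); last first.
  by apply/funext => -[j ji] /=; exact: f0.
rewrite Sum_zero add0 -[RHS]Sum_unit.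
rewrite -(@Sum_reindex _ _ _ _ (fun _ : unit => exist (fun j => j = i) i erefl) (fun=> tt)) //.
  by move=> [].
by move=> [j ji]; subst j.
Qed.

Lemma ule_Sum_elt (I : Type) (i : I) (f : I -> M) : f i <<= Sum f.
Proof.
rewrite (Sum_pred (fun j => j = i)).
have -> : Sum (fun j : {j | j = i} => f (sval j)) = f i.
  by apply: (@Sum_single {j | j = i} (exist _ i erefl)) => -[j ji] []; subst j.
exact: ule_addr.
Qed.

(** * Countable multiples *)

Definition omega a : M := Sum (fun _ : nat => a).

Lemma omegaS a : omega a = a ++ omega a.
Proof.
rewrite -{2}(Sum_unit a) /omega add_Sum.
rewrite -[RHS](@Sum_reindex _ _ nat (unit + nat)
  (fun n => if n is n'.+1 then inr n' else inl tt)
  (fun s => if s is inr n then n.+1 else 0%N)).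
- by congr Sum; apply/funext => -[].
- by case.
- by move=> [[]|].
Qed.

Lemma omega_add a b : omega (a ++ b) = omega a ++ omega b.
Proof. exact: Sum_add. Qed.

(** The natural numbers are split into the even and the odd ones. *)
Lemma omegaD a : omega a ++ omega a = omega a.
Proof.
rewrite /omega add_Sum.
rewrite -[LHS](@Sum_reindex _ _ nat (nat + nat)
  (fun n => if odd n then inr n./2 else inl n./2)
  (fun s => match s with inl n => n.*2 | inr n => n.*2.+1 end)).
- by congr Sum; apply/funext => n; case: ifP.
- by move=> n; case: ifP => h; rewrite -[RHS]odd_double_half h.
- by move=> [n|n] /=; rewrite ?odd_double /= ?doubleK // uphalf_double.
Qed.

Lemma omega_le a b : a <<= b -> omega a <<= omega b.
Proof. by move=> ab; exact: ule_Sum. Qed.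

Lemma omega_ge a : a <<= omega a.
Proof. by rewrite omegaS; exact: ule_addr. Qed.

(** Subtracting [x] from [a] over and over again gives, by [remainder], countably
    many orthogonal copies of [x]. *)
Lemma absorb_omega a x : a ++ x = a <-> omega x <<= a.
Proof.
split=> [ax|/ule_add[c ->]].
  have [|r [-> _]] := @remainder _ _ (fun=> a) (fun=> x); last exact: ule_addl.
  by move=> n; rewrite addC ax.
by rewrite addAC (addC _ x) -omegaS.
Qed.

Lemma omega_idem a : omega (omega a) <<= omega a.
Proof. by apply/absorb_omega; exact: omegaD. Qed.

(** As in the Cantor-Bernstein theorem: if [a = a ++ x ++ y], then [a] absorbs
    [x]. *)
Lemma ule_anti a b : a <<= b -> b <<= a -> a = b.
Proof.
move=> /ule_add[x ->] /ule_add[y e].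
have : omega (x ++ y) <<= a by apply/absorb_omega; rewrite addA.
rewrite omega_add => h; apply/esym/absorb_omega; apply: ule_trans h.
exact: ule_addr.
Qed.

(** Cancellation up to absorption: repeatedly refining [a ++ c = b ++ c] splits
    off common parts of [a] and [b]; what never gets split off is contained
    infinitely often in [c]. *)
Lemma cancellation a b c : a ++ c = b ++ c -> exists r r' d,
  [/\ a = r ++ d, b = r' ++ d, omega r <<= c & omega r' <<= c].
Proof.
pose st := {t : M * M * M | t.1.1 ++ t.2 = t.1.2 ++ t.2}.
move=> abc; pose s0 : st := exist _ (a, b, c) abc.
have /choice[F FP] (s : st) : exists s' : st, exists m,
    [/\ (sval s).1.1 = m ++ (sval s').1.1, (sval s).1.2 = m ++ (sval s').1.2,
      (sval s).2 = (sval s').1.1 ++ (sval s').2 &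
      (sval s).2 = (sval s').1.2 ++ (sval s').2].
  case: s => -[[x y] z] /= xyz; have [m [n [k [l [e1 e2 e3 e4]]]]] := refinement xyz.
  have nk : (n, k, l).1.1 ++ (n, k, l).2 = (n, k, l).1.2 ++ (n, k, l).2 by rewrite /= -e2.
  by exists (exist _ (n, k, l) nk), m.
have [m mP] := choice FP.
pose s n := iter n F s0.
have mS n := mP (s n).
have [r [ra rle]] := @remainder _ _ (fun n => (sval (s n)).1.1) (fun n => m (s n))
  (fun n => let: And4 h _ _ _ := mS n in h).
have [r' [rb rle']] := @remainder _ _ (fun n => (sval (s n)).1.2) (fun n => m (s n))
  (fun n => let: And4 _ h _ _ := mS n in h).
have [q [qa _]] := @remainder _ _ (fun n => (sval (s n)).2) (fun n => (sval (s n.+1)).1.1)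
  (fun n => let: And4 _ _ h _ := mS n in h).
have [q' [qb _]] := @remainder _ _ (fun n => (sval (s n)).2) (fun n => (sval (s n.+1)).1.2)
  (fun n => let: And4 _ _ _ h := mS n in h).
exists r, r', (Sum (fun n => m (s n))); split=> //.
- by move: qa => /= ->; apply: ule_trans (ule_addl _ _); apply: ule_Sum => n; exact: rle n.+1.
- by move: qb => /= ->; apply: ule_trans (ule_addl _ _); apply: ule_Sum => n; exact: rle' n.+1.
Qed.

(** * Disjointness and bands *)

Definition disj a b := forall m, m <<= a -> m <<= b -> m = zero.

Lemma disj_sym a b : disj a b -> disj b a.
Proof. by move=> h m mb ma; exact: h. Qed.

Lemma disj_le a b c : c <<= a -> disj a b -> disj c b.
Proof. by move=> ca h m mc mb; apply: h => //; exact: ule_trans mc ca. Qed.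

Lemma disj_Sum (I : Type) (f : I -> M) b : (forall i, disj (f i) b) -> disj (Sum f) b.
Proof.
move=> fb m mf mb; apply: contrapT => m0.
have [i [k [k0 km kf]]] := common_part mf m0.
by apply: k0; apply: (fb i) => //; exact: ule_trans km mb.
Qed.

Definition perp X : M -> Prop := fun y => forall x, X x -> disj x y.
Definition band X := perp (perp X).

Lemma perp_le X a b : a <<= b -> perp X b -> perp X a.
Proof. by move=> ab Xb x Xx; apply/disj_sym/(disj_le ab)/disj_sym/Xb. Qed.

Lemma perp_Sum X (I : Type) (f : I -> M) : (forall i, perp X (f i)) -> perp X (Sum f).
Proof. by move=> Xf x Xx; apply/disj_sym/disj_Sum => i; exact/disj_sym/Xf. Qed.

Lemma band_le X a b : a <<= b -> band X b -> band X a.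
Proof. exact: perp_le. Qed.

Lemma bandW X a : X a -> band X a.
Proof. by move=> Xa y Xy; apply/disj_sym/Xy. Qed.

Lemma band_perp X : band (perp X) = perp X.
Proof.
apply/funext => y; apply/propext; split=> [h x Xx|]; last exact: bandW.
exact/h/bandW.
Qed.

Lemma band_perp_zero X a : band X a -> perp X a -> a = zero.
Proof. by move=> h k; apply: (h a k a); exact: ule_refl. Qed.

(** A maximal orthogonal family of parts of [a] lying in [perp X] sums up to the
    component in [perp X]; the rest has no such part, hence lies in the band. *)
Lemma pr_exists X a : exists b, exists2 c, a = b ++ c & band X b /\ perp X c.
Proof.
have [I [m [x [ax Qm _ max]]]] :=
  @max_family _ _ unit tt (fun=> a) (perp X) (fun _ _ => True) (fun _ _ _ => Logic.I).
exists (x tt), (Sum m); first by rewrite addC.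
split; last by apply: perp_Sum => i; have [] := Qm i.
move=> y Xy k ky kx; apply: max => //; first exact: perp_le Xy.
by case.
Qed.

(** The part of [a] in the band generated by [X]; its other part lies in the
    complementary band. *)
Definition pr X a : M := sval (cid (pr_exists X a)).

Lemma pr_unique X a b c : a = b ++ c -> band X b -> perp X c -> pr X a = b.
Proof.
rewrite /pr; case: cid => b' /= [c' -> [Xb' Xc']] /refinement[m [n [k [l [eb' e1 eb e2]]]]] Xb Xc.
subst b' b.
have -> : n = zero.
  apply: (@band_perp_zero X); first exact: band_le (ule_addl _ _) Xb'.
  by apply: perp_le Xc; rewrite e2; exact: ule_addr.
have -> : k = zero.
  apply: (@band_perp_zero X); first exact: band_le (ule_addl _ _) Xb.
  by apply: perp_le Xc'; rewrite e1; exact: ule_addr.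
by [].
Qed.

Lemma pr_band X a : band X (pr X a).
Proof. by rewrite /pr; case: cid => b' /= [c' _ []]. Qed.

Lemma pr_split X a : a = pr X a ++ pr (perp X) a.
Proof.
have [b [c e [Xb Xc]]] := pr_exists X a.
rewrite (pr_unique e Xb Xc) {1}e (@pr_unique (perp X) a c b) //.
- by rewrite addC.
- by rewrite band_perp.
Qed.

Lemma prC_perp X a : perp X (pr (perp X) a).
Proof. by rewrite -{1}(band_perp X); exact: pr_band. Qed.

Lemma pr_sub X a : pr X a <<= a.
Proof. by rewrite {2}(pr_split X a); exact: ule_addr. Qed.

Lemma pr_id X a : band X a -> pr X a = a.
Proof.
move=> Xa; apply: (@pr_unique _ _ _ zero) => //; first by rewrite add0.
by move=> x _ m _ /ule_zero.
Qed.

Lemma pr_zero X a : perp X a -> pr X a = zero.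
Proof.
move=> Xa; apply: (@pr_unique _ _ _ a) => //; first by rewrite add0l.
by move=> x _ m _ /ule_zero.
Qed.

Lemma pr_Sum X (I : Type) (f : I -> M) : pr X (Sum f) = Sum (fun i => pr X (f i)).
Proof.
apply: (@pr_unique _ _ _ (Sum (fun i => pr (perp X) (f i)))).
- by rewrite -Sum_add; congr Sum; apply/funext => i; exact: pr_split.
- by apply: perp_Sum => i; exact: pr_band.
- by apply: perp_Sum => i; exact: prC_perp.
Qed.

Lemma pr_add X a b : pr X (a ++ b) = pr X a ++ pr X b.
Proof.
rewrite /add pr_Sum; congr Sum; by apply/funext => -[].
Qed.

Lemma pr_omega X a : pr X (omega a) = omega (pr X a).
Proof. exact: pr_Sum. Qed.

Lemma pr_le X a b : a <<= b -> pr X a <<= pr X b.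
Proof. by move=> /ule_add[c ->]; rewrite pr_add; exact: ule_addr. Qed.

(** Bands generated by one class. *)
Local Notation pr1 e := (pr (eq e)).

Lemma perp1 e a : perp (eq e) a <-> disj e a.
Proof. by split=> [|h x <-//]; exact. Qed.

Lemma pr1_self e : pr1 e e = e.
Proof. by apply: pr_id; exact: bandW. Qed.

Lemma band1_sub X e a : band X e -> band (eq e) a -> band X a.
Proof. by move=> Xe ea y Xy; apply: ea; apply/perp1/disj_sym; exact: Xe. Qed.

Lemma pr1_pr X e a : band X e -> pr1 e (pr X a) = pr1 e a.
Proof.
move=> Xe; rewrite [in RHS](pr_split X a) pr_add [X in _ = _ ++ X]pr_zero ?add0 //.
by apply/perp1; apply/disj_sym/Xe; exact: prC_perp.
Qed.

Lemma pr1_zero X e a : perp X e -> band X a -> pr1 e a = zero.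
Proof. by move=> Xe Xa; apply: pr_zero; apply/perp1/disj_sym; apply: disj_sym; exact: Xa. Qed.

Lemma le_disj a b c : a <<= b ++ c -> disj a b -> a <<= c.
Proof.
move=> /ule_add[d /esym/refinement[m [n [k [l [-> _ -> ->]]]]]] mb.
rewrite (mb m (ule_addr _ _) (ule_addr _ _)) add0l; exact: ule_addr.
Qed.

Lemma ule_add_split a b c : a <<= b ++ c -> exists a1 a2,
  [/\ a = a1 ++ a2, a1 <<= b & a2 <<= c].
Proof.
move=> /ule_add[d /esym/refinement[m [n [k [l [-> _ -> ->]]]]]].
by exists m, n; split=> //; exact: ule_addr.
Qed.

(** Exhaust [a] by parts each lying in one of the bands; as the bands are disjoint,
    a part contributes to exactly one of the terms on the right. *)
Lemma pr1_disj_Sum (I : Type) (y : I -> M) a :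
  (forall i j, i <> j -> disj (y i) (y j)) ->
  pr1 (Sum y) a = Sum (fun i => pr1 (y i) a).
Proof.
move=> yd.
have [K [p [r [ar Qp _ max]]]] := @max_family _ _ unit tt (fun=> a)
  (fun p => exists i, band (eq (y i)) p) (fun _ _ => True) (fun _ _ _ => Logic.I).
have /choice[i iP] k : exists i, band (eq (y i)) (p k) by have [] := Qp k.
have ry j : disj (y j) (r tt).
  move=> m my mr; apply: max => // [|[]//].
  by exists j; apply: perp_le my _; exact: bandW.
have pj j k : pr1 (y j) (p k) = if `[< j = i k >] then p k else zero.
  case: asboolP => [->|ne]; first exact/pr_id/iP.
  apply: pr1_zero (iP k); apply/perp1/yd; exact/nesym.
have -> : pr1 (Sum y) a = Sum p.
  apply: pr_unique (ar tt) _ _.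
    apply: perp_Sum => k; apply: band1_sub (iP k).
    by apply: perp_le (ule_Sum_elt _ _) _; exact: bandW.
  by apply/perp1/disj_Sum.
have -> : (fun j => pr1 (y j) a) = fun j => Sum (fun k => pr1 (y j) (p k)).
  apply/funext => j; rewrite (ar tt) pr_add pr_Sum [X in _ ++ X]pr_zero ?add0 //.
  exact/perp1/ry.
rewrite Sum_exchange; congr Sum; apply/funext => k.
rewrite (@Sum_single _ (i k)) => [|j ne]; rewrite pj; first by case: asboolP.
by case: asboolP.
Qed.

(** * Comparability *)

(** Take out a maximal common part: the remainders are disjoint, so on the band of
    one remainder the other vanishes. *)
Lemma comparability a b : exists X, pr X a <<= pr X b /\
  pr (perp X) b <<= pr (perp X) a.
Proof.
have [I [m [x [ax _ _ max]]]] := @max_family _ _ bool true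
  (fun i => if i then a else b) (fun=> True) (fun _ _ => True) (fun _ _ _ => Logic.I).
have [ea eb] := (ax true, ax false); rewrite /= in ea eb.
have dx : disj (x true) (x false) by move=> k k1 k2; apply: max => // -[].
exists (perp (eq (x true))); split.
  rewrite ea eb !pr_add [X in _ ++ X <<= _]pr_zero ?add0; first exact: ule_addr.
  exact: bandW.
rewrite ea eb !pr_add [X in _ ++ X <<= _]pr_zero ?add0; first exact: ule_addr.
by rewrite -/(band (perp _)) band_perp; exact/perp1.
Qed.

(** The part [s] of [a] strictly above [b]. A maximal disjoint family of classes
    on whose bands [a] is below [b] has a sum with the same property; [s] is the
    part of [a] disjoint from that sum. *)
Lemma strict_part a b : exists s, [/\ pr1 s a = s, pr (perp (eq s)) a <<= b,
  pr1 s b <<= s & forall e, e <<= s -> pr1 e s <<= pr1 e b -> e = zero].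
Proof.
pose Y e := pr1 e a <<= pr1 e b.
have Yband X e : pr X a <<= pr X b -> band X e -> Y e.
  move=> ab Xe; rewrite /Y -(pr1_pr a Xe) -(pr1_pr b Xe); exact: pr_le.
have [I [y [x [ax Qy yd max]]]] := @max_family _ _ unit tt (fun=> a) Y disj disj_sym.
set t := Sum y in ax.
have Yt : Y t.
  rewrite /Y /t !pr1_disj_Sum //; apply: ule_Sum => i; by have [] := Qy i.
have YtP e : disj t e -> e <<= a -> Y e -> e = zero.
  move=> te ea Ye; apply: max => // [i|[]].
    by apply: disj_sym; apply: disj_le te; exact: ule_Sum_elt.
  by apply: (@le_disj _ t); [rewrite -(ax tt)|exact: disj_sym].
pose s := pr (perp (eq t)) a.
have ts : disj t s by apply/perp1; exact: prC_perp.
have sa : s <<= a by exact: pr_sub.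
have as_ : a = pr1 t a ++ s by exact: pr_split.
have pts : perp (eq s) (pr1 t a).
  by apply/perp1; apply: (@pr_band (eq t)); exact/perp1.
have prs : pr1 s a = s.
  by rewrite as_ pr_add pr1_self pr_zero ?add0l.
exists s; split=> //.
- rewrite as_ pr_add [X in _ ++ X <<= _]pr_zero ?add0; last exact: bandW.
  apply: ule_trans (pr_sub _ _) _; apply: ule_trans Yt _; exact: pr_sub.
- have [Z [aZ bZ]] := comparability a b.
  have sZ : pr Z s = zero.
    apply: YtP.
    - by apply/disj_sym/(disj_le (pr_sub _ _))/disj_sym.
    - exact: ule_trans (pr_sub _ _) sa.
    - exact: (Yband _ _ aZ (@pr_band _ _)).
  have Zs : band (perp Z) s.
    by rewrite (pr_split Z s) sZ add0l; exact: pr_band.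
  rewrite -(pr1_pr b Zs) -{2}prs -(pr1_pr a Zs); exact: pr_le.
move=> e es h; apply: YtP.
- by apply/disj_sym/(disj_le es)/disj_sym.
- exact: ule_trans es sa.
have se : band (eq s) e by apply: perp_le es _; exact: bandW.
by rewrite /Y -(pr1_pr a se) prs.
Qed.

(** * Residuation *)

(** Where [a] is below [c] nothing is to be added. Elsewhere [a = c' ++ d] with
    [c'] the part of [c], and one may drop from [d] the band on which [c'] absorbs
    it. The rest [f] is least: if [c' ++ f <<= c' ++ x], cancellation splits
    [f = f1 ++ f2] with [f2 <<= x] and [f1] absorbed by [c']. Comparing [f2] with
    [omega f1], either [f] is absorbed by [c'], which is excluded, or
    [omega f1 <<= f2] and then [f = f2]. *)
Lemma residual_exists a c : exists f, a <<= c ++ f /\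
  forall x, a <<= c ++ x -> f <<= x.
Proof.
have [s [sa a1c cs _]] := strict_part a c.
have [d sd] : exists d, s = pr1 s c ++ d by exact/ule_add.
set c' := pr1 s c in cs sd.
have [t [td o1c _ tmin]] := strict_part (omega d) c'.
pose f := pr1 t d.
have tE : t = omega f by rewrite -{1}td pr_omega.
have cf : s = c' ++ f.
  have e : c' ++ pr (perp (eq t)) d = c' by apply/absorb_omega; rewrite -pr_omega.
  by rewrite {1}sd {1}(pr_split (eq t) d) (addC (pr _ _)) addA e.
exists f; split.
  rewrite (pr_split (eq s) a) sa (pr_split (eq s) c) -/c' {1}cf addAC.
  apply: ule_addm; last exact: ule_refl.
  apply: ule_addm; first exact: ule_refl.
  rewrite -[X in X <<= _](@pr_id (perp (eq s))); last exact: pr_band.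
  exact: pr_le.
move=> x /ule_add[w cx].
have [|r [r' [g [e1 e2 rc _]]]] := @cancellation (f ++ pr1 s w) (pr1 s x) c'.
  by rewrite addAC (addC f) -cf (addC (pr1 s x)) -pr_add cx pr_add sa.
have [|f1 [f2 [ff f1r f2g]]] := @ule_add_split f r g.
  by rewrite -e1; exact: ule_addr.
have f1c : omega f1 <<= c' by apply: ule_trans rc; exact: omega_le.
have [Z [Z1 Z2]] := comparability f2 (omega f1).
have Zf : pr Z f = zero.
  set e := pr Z f; apply: tmin.
    by rewrite tE; apply: ule_trans (pr_sub _ _) (omega_ge _).
  have ef : pr1 e f = e by rewrite -(pr1_pr f (@pr_band Z f)) pr1_self.
  rewrite tE pr_omega ef.
  have oe : omega e <<= c'.
    apply: ule_trans f1c; apply: ule_trans (omega_idem _).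
    apply: omega_le; rewrite /e ff pr_add.
    apply: ule_trans (pr_sub Z (omega f1)).
    rewrite pr_omega omegaS; apply: ule_addm; first exact: ule_refl.
    by rewrite -pr_omega.
  have := pr_le (eq e) oe; by rewrite pr_omega pr1_self.
have Zf1 : pr Z f1 = zero.
  by apply: ule_zero; rewrite -Zf ff; apply: pr_le; exact: ule_addr.
have of2 : omega f1 <<= f2.
  rewrite (pr_split Z (omega f1)) pr_omega Zf1 [omega zero]Sum_zero add0l.
  exact: ule_trans Z2 (pr_sub _ _).
have ff2 : f = f2 by rewrite ff addC; exact/absorb_omega.
rewrite ff2; apply: ule_trans f2g _; apply: ule_trans (pr_sub (eq s) x).
by rewrite e2; exact: ule_addl.
Qed.

(** * Bounds *)

Lemma well_founded_irrefl (S : Type) (lt : S -> S -> Prop) s :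
  well_founded lt -> ~ lt s s.
Proof.
move=> wf; elim/(well_founded_ind wf): s => s IH ss; exact: (IH s).
Qed.

(** [f s] is the least class that must be added to the earlier ones in order to
    reach [A s]; by minimality it finds room in every upper bound. *)
Lemma lub_exists (S : Type) (A : S -> M) :
  exists c, (forall s, A s <<= c) /\ forall u, (forall s, A s <<= u) -> c <<= u.
Proof.
have [lt [wf tot]] := well_founded_order S.
have /choice[res resP] (p : M * M) :
  exists f, p.1 <<= p.2 ++ f /\ forall x, p.1 <<= p.2 ++ x -> f <<= x.
  exact: residual_exists.
pose step s (rec : forall t, lt t s -> M) :=
  res (A s, Sum (fun t : {t | lt t s} => rec (sval t) (svalP t))).
pose f := Fix wf (fun=> M) step.
have fE s : f s = res (A s, Sum (fun t : {t | lt t s} => f (sval t))).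
  rewrite -[RHS]/(step s (fun t (_ : lt t s) => f t)).
  apply: (Fix_eq wf (fun=> M) step) => t g g' gg'; congr (res (_, _)).
  by congr Sum; apply/funext => -[r rt]; exact: gg'.
exists (Sum f); split=> [s|u Au].
  have [+ _] := resP (A s, Sum (fun t : {t | lt t s} => f (sval t))).
  move=> /ule_trans; apply; rewrite -fE (Sum_pred (fun t => lt t s) f).
  apply: ule_addm; first exact: ule_refl.
  have ss := well_founded_irrefl wf (s := s).
  exact: (ule_Sum_elt (exist _ s ss) (fun t : {t | ~ lt t s} => f (sval t))).
apply: (@packing _ _ S lt wf tot f u) => s x ux; rewrite fE.
by have [_] := resP (A s, Sum (fun t : {t | lt t s} => f (sval t))); apply; rewrite /= -ux; exact: Au.
Qed.

(** The lower bounds are classes of subobjects of one of the [A s0], hence form a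
    small family, whose least upper bound is the greatest lower bound. *)
Lemma glb_exists (S : Type) (s0 : S) (A : S -> M) :
  exists c, (forall s, c <<= A s) /\ forall u, (forall s, u <<= A s) -> u <<= c.
Proof.
pose U := rep (A s0).
pose I := {P : hspace U -> hspace U | exists d, (forall s, d <<= A s) /\ range_class P d}.
have /choice[d dP] (i : I) : exists d, (forall s, d <<= A s) /\ range_class (sval i) d.
  exact: svalP i.
have [c [cu cl]] := lub_exists d.
exists c; split=> [s|u uA]; first by apply: cl => i; have [] := dP i.
have /ule_cls[V iV] : cls (rep u) <<= cls U by rewrite !repK.
have h : range_class (fun z : hspace U => fwd V (bwd V z)) u by exists V.
have hI : exists d, (forall s, d <<= A s) /\
  range_class (fun z : hspace U => fwd V (bwd V z)) d by exists u.
pose i : I := exist _ _ hI.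
by have [_ /(range_class_unique h) ->] := dP i; exact: cu.
Qed.

End BandTheory.

(** * Distributivity *)

Section Lattice.
Variables (R : realType) (N : nat).
Local Notation M := (uclass R N).
Local Notation "a ++ b" := (add a b).
Local Notation zero := (zero R N).
Local Notation "a <<= b" := (ule a b) (at level 70).
Local Notation meet := Defs.meet.
Local Notation join := Defs.join.
Local Notation pr1 e := (pr (eq e)).
Implicit Types (a b c d e : M) (S : Type).

Lemma the_classP (P : M -> Prop) : (exists c, P c) -> P (the_class P).
Proof.
by move=> ex; rewrite /the_class; case: pselect => // e; exact: svalP (cid e).
Qed.

Lemma bigjoinP S (A : S -> M) : is_lub (fun c => exists s, c = A s) (bigjoin A).
Proof.
apply: the_classP; have [c [cu cl]] := lub_exists A; exists c; split.
  by move=> _ [s ->].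
by move=> d h; apply: cl => s; apply: h; exists s.
Qed.

Lemma bigmeetP S (A : S -> M) : inhabited S ->
  is_glb (fun c => exists s, c = A s) (bigmeet A).
Proof.
move=> [s0]; apply: the_classP; have [c [cl cu]] := glb_exists s0 A; exists c; split.
  by move=> _ [s ->].
by move=> d h; apply: cu => s; apply: h; exists s.
Qed.

Lemma joinP a b : is_lub (fun c => c = a \/ c = b) (join a b).
Proof.
apply: the_classP; have [c [cu cl]] := lub_exists (fun i : bool => if i then a else b).
exists c; split; first by move=> _ [->|->]; [exact: (cu true)|exact: (cu false)].
by move=> d h; apply: cl => -[]; apply: h; [left|right].
Qed.

Lemma meetP a b : is_glb (fun c => c = a \/ c = b) (meet a b).
Proof.
apply: the_classP; have [c [cl cu]] := glb_exists true (fun i : bool => if i then a else b).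
exists c; split; first by move=> _ [->|->]; [exact: (cl true)|exact: (cl false)].
by move=> d h; apply: cu => -[]; apply: h; [left|right].
Qed.

Lemma bigjoin_ub S (A : S -> M) s : A s <<= bigjoin A.
Proof. by have [h _] := bigjoinP A; apply: h; exists s. Qed.

Lemma bigjoin_le S (A : S -> M) u : (forall s, A s <<= u) -> bigjoin A <<= u.
Proof. by have [_ h] := bigjoinP A => Au; apply: h => _ [s ->]. Qed.

Lemma bigmeet_lb S (A : S -> M) s : bigmeet A <<= A s.
Proof. by have [h _] := bigmeetP A (inhabits s); apply: h; exists s. Qed.

Lemma bigmeet_ge S (A : S -> M) u : inhabited S -> (forall s, u <<= A s) -> u <<= bigmeet A.
Proof. by move=> iS; have [_ h] := bigmeetP A iS => Au; apply: h => _ [s ->]. Qed.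

Lemma join_ubl a b : a <<= join a b.
Proof. by have [h _] := joinP a b; apply: h; left. Qed.

Lemma join_ubr a b : b <<= join a b.
Proof. by have [h _] := joinP a b; apply: h; right. Qed.

Lemma join_le a b u : a <<= u -> b <<= u -> join a b <<= u.
Proof. by have [_ h] := joinP a b => au bu; apply: h => _ [->|->]. Qed.

Lemma meet_lbl a b : meet a b <<= a.
Proof. by have [h _] := meetP a b; apply: h; left. Qed.

Lemma meet_lbr a b : meet a b <<= b.
Proof. by have [h _] := meetP a b; apply: h; right. Qed.

Lemma meet_ge a b u : u <<= a -> u <<= b -> u <<= meet a b.
Proof. by have [_ h] := meetP a b => au bu; apply: h => _ [->|->]. Qed.

(** It suffices that the part [s] of [a] strictly above [b] vanishes; strictness
    means that no nonzero [e <<= s] has a band on which [s] is below [b]. *)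
Lemma le_of_strict a b :
  (forall s, s <<= a ->
    (forall e, e <<= s -> pr1 e s <<= b -> e = zero) -> s = zero) -> a <<= b.
Proof.
move=> h; have [s [sa ab _ smin]] := strict_part a b.
have s0 : s = zero.
  apply: h => //; first by rewrite -sa; exact: pr_sub.
  move=> e es eb; apply: smin => //.
  have := pr_le (eq e) eb; rewrite pr_id //; exact: pr_band.
by rewrite (pr_split (eq s) a) sa [X in X ++ _]s0 add0l.
Qed.

(** On the band [e] where the inequality fails, comparing [e] with [A s] leaves
    only the alternative [A s <<= e <<= b]; there the meet of [b] and [A s] is
    [A s] itself, so that the right-hand side dominates [bigjoin A], hence [e]. *)
Lemma meet_bigjoin_le S (A : S -> M) b :
  meet b (bigjoin A) <<= bigjoin (fun s => meet b (A s)).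
Proof.
set u := bigjoin (fun s => meet b (A s)); apply: le_of_strict => e eB emin.
have eb : e <<= b := ule_trans eB (meet_lbl _ _).
have eA : e <<= bigjoin A := ule_trans eB (meet_lbr _ _).
have Au s : meet b (A s) <<= u by exact: (bigjoin_ub (fun s => meet b (A s))).
have Ae s : pr1 e (A s) <<= e.
  have [X [X1 X2]] := comparability e (A s).
  have Xe : pr X e = zero.
    apply: emin; first exact: pr_sub.
    apply: ule_trans (Au s); apply: meet_ge.
      exact: ule_trans (pr_sub _ _) eb.
    apply: ule_trans (ule_trans _ X1) (pr_sub _ _).
    rewrite -(pr1_pr e (@pr_band _ _ X e)) pr1_self; exact: ule_refl.
  have eX : band (perp X) e by rewrite (pr_split X e) Xe add0l; exact: pr_band.
  rewrite -(pr1_pr (A s) eX) -{2}(pr1_self e) -(pr1_pr e eX); exact: pr_le.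
have Ael s : pr1 e (A s) <<= u.
  apply: ule_trans (Au s); apply: meet_ge; last exact: pr_sub.
  exact: ule_trans (Ae s) eb.
apply: emin; first exact: ule_refl.
rewrite pr1_self -(pr1_self e); apply: ule_trans (pr_le _ eA) _.
have h : bigjoin A <<= pr1 e u ++ pr (perp (eq e)) (bigjoin A).
  apply: bigjoin_le => s; rewrite (pr_split (eq e) (A s)); apply: ule_addm.
    rewrite -(@pr_id _ _ (eq e) (pr1 e (A s))); first exact: pr_le.
    exact: pr_band.
  apply: pr_le; exact: bigjoin_ub.
apply: ule_trans (pr_le (eq e) h) _; rewrite pr_add.
rewrite [X in _ ++ X]pr_zero ?add0; last exact: prC_perp.
rewrite pr_id; [exact: pr_sub|exact: pr_band].
Qed.

(** On the band [e] where the inequality fails, comparing [A s] with [b] leaves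
    only the alternative [b <<= A s]; there the join of [b] and [A s] is [A s], so
    that [e] is a lower bound of the [A s]. *)
Lemma join_bigmeet_ge S (A : S -> M) b : inhabited S ->
  bigmeet (fun s => join b (A s)) <<= join b (bigmeet A).
Proof.
move=> iS; apply: le_of_strict => e el emin.
have lA s : e <<= join b (A s).
  apply: ule_trans el _; exact: (bigmeet_lb (fun s => join b (A s))).
apply: (emin); first exact: ule_refl.
rewrite pr1_self; apply: ule_trans (join_ubr _ _); apply: bigmeet_ge => // s.
have loc X u : pr X b <<= u -> pr X (A s) <<= u -> pr X e <<= u.
  move=> bu Au; apply: ule_trans (pr_le X (lA s)) _.
  have h : join b (A s) <<= pr X u ++ pr (perp X) (join b (A s)).
    have id x : pr X (pr X x) = pr X x by apply: pr_id; exact: pr_band.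
    apply: join_le; [rewrite {1}(pr_split X b)|rewrite {1}(pr_split X (A s))].
    - apply: ule_addm; first by rewrite -id; exact: pr_le.
      by apply: pr_le; exact: join_ubl.
    - apply: ule_addm; first by rewrite -id; exact: pr_le.
      by apply: pr_le; exact: join_ubr.
  apply: ule_trans (pr_le X h) _; rewrite pr_add.
  rewrite [X in _ ++ X]pr_zero ?add0; last exact: prC_perp.
  rewrite pr_id; [exact: pr_sub|exact: pr_band].
have [X [X1 X2]] := comparability (A s) b.
have Xe : pr X e = zero.
  apply: emin; first exact: pr_sub.
  apply: ule_trans (join_ubl _ _); rewrite -(pr1_pr e (@pr_band _ _ X e)) pr1_self.
  apply: loc; first exact: pr_sub.
  exact: ule_trans X1 (pr_sub _ _).
rewrite (pr_split X e) Xe add0l; apply: loc; last exact: pr_sub.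
exact: ule_trans X2 (pr_sub _ _).
Qed.

End Lattice.

Theorem theorem15p10 (R : realType) (N : nat) (hN : (1 <= N)%N)
    (S : Type) (hS : inhabited S) (A : S -> uclass R N) (B : uclass R N) :
  meet B (bigjoin A) = bigjoin (fun s => meet B (A s)) /\
  join B (bigmeet A) = bigmeet (fun s => join B (A s)).
Proof.
split; apply: ule_anti.
- exact: meet_bigjoin_le.
- apply: bigjoin_le => s; apply: meet_ge; first exact: meet_lbl.
  apply: ule_trans (meet_lbr _ _) _; exact: bigjoin_ub.
- apply: bigmeet_ge => // s; apply: join_le; first exact: join_ubl.
  apply: ule_trans (bigmeet_lb _ _) _; exact: join_ubr.
- exact: join_bigmeet_ge.
Qed.
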